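(* Let $N\ge 1$ and $p\ge p_{N+1}:=1+\frac2{N+1}$. Set $$f(x):=\begin{cases}|x|^{-\frac2{p-1}}\chi_{B_\Omega(0,1)}(x)&\text{if }p>p_{N+1},\\[3pt]|x|^{-N-1}\big|\log|x|\big|^{-\frac{N+1}2-1}\chi_{B_\Omega(0,1/2)}(x)&\text{if }p=p_{N+1},\end{cases}$$ for $x\in\Omega$. Then there exists $\kappa_0>0$ with the following properties: (i) problem (P) possesses a local-in-time solution with $\mu=\kappa x_Nf(x)$ if $0<\kappa<\kappa_0$; (ii) problem (P) possesses no local-in-time solutions with $\mu=\kappa x_Nf(x)$ if $\kappa>\kappa_0$.
   Context: $\Omega:=\mathbb R^{N-1}\times(0,\infty)$ if $N\ge2$ and $\Omega:=(0,\infty)$ if $N=1$; points are written $x=(x',x_N)$. $B(x,r)$ is the open ball in $\mathbb R^N$, $B_\Omega(x,r):=B(x,r)\cap\overline\Omega$, and $\chi_E$ is the characteristic function of $E$. $Q_T:=\Omega\times(0,T)$. $\mathcal L(Q_T)$ is the set of nonnegative, measurable, almost everywhere finite functions on $Q_T$. A locally integrable function $g$ on $\overline\Omega$ is identified with the measure $g(x)\,dx$. Kernels: $\Gamma_d(x,t):=(4\pi t)^{-d/2}\exp(-|x|^2/(4t))$ on $\mathbb R^d\times(0,\infty)$. The Dirichlet heat kernel of $\Omega$ is $$G(x,y,t):=\Gamma_N(x-y,t)\left(1-\exp\left(-\frac{x_Ny_N}{t}\right)\right),\qquad x,y\in\overline\Omega,\ t>0,$$ and, for $x,y\in\overline\Omega$,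 $t>0$, $K(x,y,t):=y_N^{-1}G(x,y,t)$ if $y_N>0$ and $K(x,y,t):=(\partial_{y_N}G)(x,y,t)=\frac{x_N}{t}\Gamma_N(x-y,t)$ if $y_N=0$. Problem (P), for a nonnegative Radon measure $\mu$ on $\overline\Omega$, is $\partial_tu=\Delta u+u^p$ in $\Omega$, $t>0$, with $u=0$ on $\partial\Omega$ and $x_Nu(x,0)=\mu$ on $\overline\Omega$. A function $u\in\mathcal L(Q_T)$ is a solution to (P) in $Q_T$ if $$u(x,t)=\int_{\overline\Omega}K(x,y,t)\,d\mu(y)+\int_0^t\int_\Omega G(x,y,t-s)u(y,s)^p\,dy\,ds$$ for almost all $(x,t)\in Q_T$. A local-in-time solution is a solution in $Q_T$ for some $T>0$. *)

(* Defs.v *)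
From HB Require Import structures.
From mathcomp Require Import all_boot all_order all_algebra.
From mathcomp Require Import all_classical all_reals all_analysis.
From mathcomp Require Import measurable_realfun.
Set Implicit Arguments.
Unset Strict Implicit.
Unset Printing Implicit Defensive.
Import Order.TTheory GRing.Theory Num.Def Num.Theory.
Import numFieldNormedType.Exports.
Local Open Scope classical_set_scope.
Local Open Scope ring_scope.

(* R^N is N.-tuple R with the library's product sigma-algebra (generated by
   the coordinates); its Lebesgue measure is defined by recursion on N as the
   image of (Lebesgue measure on R) \x (Lebesgue measure on R^N) under
   (a, x) |-> a :: x. *)
Section lebesgue_tuple.
Context {R : realType}.
Local Open Scope ereal_scope.

Definition consT n (z : R * n.-tuple R) : n.+1.-tuple R :=
  [the n.+1.-tuple R of z.1 :: z.2].

Lemma measurable_consT n : measurable_fun [set: R * n.-tuple R] (@consT n).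
Proof. exact: measurable_cons. Qed.

Section step.
Variables (n : nat) (mu : {sigma_finite_measure set (n.-tuple R) -> \bar R}).

Definition lebesgue_step : set (n.+1.-tuple R) -> \bar R :=
  pushforward ((@lebesgue_measure R) \x mu) (@consT n).

Let lebesgue_step0 : lebesgue_step set0 = 0.
Proof. by rewrite /lebesgue_step /pushforward preimage_set0 measure0. Qed.

Let lebesgue_step_ge0 A : 0 <= lebesgue_step A.
Proof.
exact: (measure_ge0 ((@lebesgue_measure R) \x mu) (@consT n @^-1` A)).
Qed.

Let lebesgue_step_sigma_additive : semi_sigma_additive lebesgue_step.
Proof.
move=> F mF tF mUF; rewrite /lebesgue_step /pushforward preimage_bigcup.
apply: measure_semi_sigma_additive.
- by move=> n0; rewrite -[X in measurable X]setTI; exact: measurable_consT.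
- apply/trivIsetP => /= i j _ _ ij; rewrite -preimage_setI.
  by move/trivIsetP : tF => /(_ _ _ _ _ ij) ->//; rewrite preimage_set0.
- by rewrite -preimage_bigcup -[X in measurable X]setTI;
    exact: measurable_consT.
Qed.

HB.instance Definition _ := isMeasure.Build _ _ _ lebesgue_step
  lebesgue_step0 lebesgue_step_ge0 lebesgue_step_sigma_additive.

Let lebesgue_step_sigma_finite : sigma_finite setT lebesgue_step.
Proof.
have /sigma_finiteP[A [TA ndA Aoo]] := sigma_finiteT (@lebesgue_measure R).
have /sigma_finiteP[B [TB ndB Boo]] := sigma_finiteT mu.
pose F k := A k `*` B k.
have TF : setT = \bigcup_k F k.
  rewrite -setXTT TA TB predeqE => -[x y]; split.
    move=> [/= [k _ Ak] [l _ Bl]]; exists (maxn k l) => //; split.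
    - by move: x Ak; exact/subsetPset/ndA/leq_maxl.
    - by move: y Bl; exact/subsetPset/ndB/leq_maxr.
  by move=> [k _ []/= ? ?]; split; exists k.
have Foo k : measurable (F k) /\ ((@lebesgue_measure R) \x mu) (F k) < +oo.
  have [? ?] := Aoo k; have [? ?] := Boo k.
  split; first exact: measurableX.
  by rewrite product_measure1E// lte_mul_pinfty// ge0_fin_numE.
pose g (w : n.+1.-tuple R) : R * n.-tuple R := (thead w, [tuple of behead w]).
have mg : measurable_fun setT g.
  apply/measurable_fun_pairP; split => /=; first exact: measurable_tnth.
  exact: measurable_behead.
have gK z : g (consT z) = z.
  case: z => a x; rewrite /g /consT /=; congr pair; exact: val_inj.
exists (fun k => g @^-1` F k).
  by rewrite -preimage_bigcup -TF preimage_setT.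
move=> k; have [mF Flt] := Foo k; split.
  by rewrite -[X in measurable X]setTI; exact: mg.
rewrite /lebesgue_step /pushforward /=.
by rewrite (_ : _ @^-1` _ = F k)//; apply/seteqP; split=> z /=; rewrite gK.
Qed.

HB.instance Definition _ := Measure_isSigmaFinite.Build _ _ _ lebesgue_step
  lebesgue_step_sigma_finite.
End step.

Fixpoint lebesgueT (n : nat) :
    {sigma_finite_measure set (n.-tuple R) -> \bar R} :=
  match n with
  | 0 => \d_([tuple] : 0.-tuple R)
  | n'.+1 => lebesgue_step (lebesgueT n')
  end.

End lebesgue_tuple.

Section half_space.
Context {R : realType}.
Implicit Types N d : nat.

Definition enorm N (x : N.-tuple R) : R :=
  Num.sqrt (\sum_(i < N) tnth x i ^+ 2).

Definition subT N (x y : N.-tuple R) : N.-tuple R :=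
  [tuple tnth x i - tnth y i | i < N].

(* last coordinate x_N (junk value 0 for N = 0) *)
Definition lastc N (x : N.-tuple R) : R := (x : seq R)`_N.-1.

Definition Omega N : set (N.-tuple R) := [set x | 0 < lastc x].
Definition cOmega N : set (N.-tuple R) := [set x | 0 <= lastc x].
Arguments Omega N : clear implicits.
Arguments cOmega N : clear implicits.

Definition eball N (x : N.-tuple R) (r : R) : set (N.-tuple R) :=
  [set y | enorm (subT x y) < r].
Definition ballO N (x : N.-tuple R) (r : R) : set (N.-tuple R) :=
  eball x r `&` cOmega N.
Definition origin N : N.-tuple R := [tuple 0 | i < N].
Arguments origin N : clear implicits.

Definition Gamma d (x : d.-tuple R) (t : R) : R :=
  (4 * pi * t) `^ (- (d%:R / 2)) * expR (- (enorm x ^+ 2 / (4 * t))).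

Definition heatG N (x y : N.-tuple R) (t : R) : R :=
  Gamma (subT x y) t * (1 - expR (- (lastc x * lastc y / t))).

(* for y_N = 0 the value is the partial derivative of heatG in y_N *)
Definition heatK N (x y : N.-tuple R) (t : R) : R :=
  if 0 < lastc y then (lastc y)^-1 * heatG x y t
  else lastc x / t * Gamma (subT x y) t.

End half_space.
Arguments Omega {R} N.
Arguments cOmega {R} N.
Arguments origin {R} N.

(* Measurability with respect to the completion of mu, i.e. Lebesgue
   measurability on Q_T below. The library's integral of a nonnegative function
   is a supremum over Borel simple functions below it, which is the Lebesgue
   integral for completion-measurable integrands as well. *)
Definition completed_measurable_fun d (T : measurableType d) (R : realType)
    (mu : set T -> \bar R) (D : set T) (u : T -> \bar R) :=
  forall Y, measurable Y -> completed_algebra_gen mu (D `&` u @^-1` Y).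

Section problem.
Context {R : realType} (N : nat).
Local Open Scope ereal_scope.

Definition lebesgue_xt :
    {measure set (N.-tuple R * measurableTypeR R)%type -> \bar R} :=
  (@lebesgueT R N) \x (@lebesgue_measure R).

Definition QT (T : R) : set (N.-tuple R * R) := Omega N `*` `]0%R, T[.

Definition LQ (T : R) (u : N.-tuple R * R -> \bar R) : Prop :=
  [/\ forall z, QT T z -> 0 <= u z,
      completed_measurable_fun lebesgue_xt (QT T) u &
      {ae lebesgue_xt, forall z, QT T z -> u z < +oo}].

(* The values of u outside QT T are irrelevant. In the nonlinear term, products
   and powers are those of [0, +oo], with 0 * +oo = 0. *)
Definition is_solution (p : R) (mu : {measure set (N.-tuple R) -> \bar R})
    (T : R) (u : N.-tuple R * R -> \bar R) : Prop :=
  LQ T u /\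
  {ae lebesgue_xt, forall z, QT T z ->
    u z = \int[mu]_(y in cOmega N) (heatK z.1 y z.2)%:E
      + \int[@lebesgue_measure R]_(s in `]0%R, z.2[)
          \int[@lebesgueT R N]_(y in Omega N)
            ((heatG z.1 y (z.2 - s))%:E * u (y, s) `^ p)}.

Definition has_local_solution (p : R)
    (mu : {measure set (N.-tuple R) -> \bar R}) : Prop :=
  exists T : R, (0 < T)%R /\ exists u, is_solution p mu T u.

End problem.

Section initial_data.
Context {R : realType}.

Definition p_crit (d : nat) : R := 1 + 2 / d%:R.

(* the else branch is only used for p_crit N.+1 < p *)
Definition fdata N (p : R) (x : N.-tuple R) : R :=
  if p == p_crit N.+1 then
    enorm x `^ (- N.+1%:R) * `|ln (enorm x)| `^ (- (N.+1%:R / 2) - 1)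
      * \1_(ballO (origin N) (1 / 2)) x
  else
    enorm x `^ (- (2 / (p - 1))) * \1_(ballO (origin N) 1) x.

Lemma measurable_lastc N : measurable_fun setT (@lastc R N).
Proof.
case: N => [|N].
  rewrite (_ : @lastc R 0 = cst 0)//.
  by apply/funext => x; rewrite /lastc /= tuple0.
rewrite (_ : @lastc R N.+1 = (@tnth _ _)^~ ord_max).
  exact: measurable_tnth.
by apply/funext => x; rewrite /lastc (tnth_nth 0).
Qed.

Lemma measurable_enorm N : measurable_fun setT (@enorm R N).
Proof.
have mS : measurable_fun setT (fun x : N.-tuple R => \sum_(i < N) tnth x i ^+ 2).
  apply: measurable_sum => i.
  apply: (@measurable_funX _ _ _ setT (fun x : N.-tuple R => tnth x i)).
  exact: measurable_tnth.
exact: (measurableT_comp (continuous_measurable_fun (@sqrt_continuous R)) mS).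
Qed.

Lemma enorm_sub0 N (y : N.-tuple R) : enorm (subT (origin N) y) = enorm y.
Proof.
rewrite /enorm; congr Num.sqrt; apply: eq_bigr => i _.
by rewrite /subT !tnth_mktuple sub0r sqrrN.
Qed.

Lemma measurable_ballO N (r : R) : measurable (ballO (origin N) r).
Proof.
apply: measurableI.
  rewrite (_ : eball _ _ = @enorm R N @^-1` `]-oo, r[%classic).
    by rewrite -[X in measurable X]setTI; exact: measurable_enorm.
  by apply/seteqP; split=> y /=; rewrite /eball/= enorm_sub0 in_itv.
rewrite (_ : cOmega N = @lastc R N @^-1` `[0, +oo[%classic).
  by rewrite -[X in measurable X]setTI; exact: measurable_lastc.
by apply/seteqP; split=> y /=; rewrite /cOmega/= in_itv/= andbT.
Qed.

Lemma measurable_fdata N (p : R) : measurable_fun setT (@fdata N p).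
Proof.
have mE a : measurable_fun setT (fun x : N.-tuple R => enorm x `^ a).
  exact: (measurableT_comp (measurable_powR a) (@measurable_enorm N)).
have mL a :
    measurable_fun setT (fun x : N.-tuple R => `|ln (enorm x)| `^ a).
  have mln := measurableT_comp (@measurable_ln R) (@measurable_enorm N).
  have mnl := measurableT_comp (@normr_measurable R setT) mln.
  exact: (measurableT_comp (measurable_powR a) mnl).
have mI (r : R) : measurable_fun setT (\1_(ballO (origin N) r) : _ -> R).
  exact: measurable_indic (@measurable_ballO N r).
rewrite /fdata; case: (p == p_crit N.+1).
  exact: (measurable_funM (measurable_funM (mE _) (mL _)) (mI _)).
exact: (measurable_funM (mE _) (mI _)).
Qed.

(* the measure kappa * x_N * f(x) dx on R^N; it does not charge the complement
   of the closed half-space, where fdata vanishes *)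
Definition initial_measure N (p : R) (kappa : {posnum R})
    (A : set (N.-tuple R)) : \bar R :=
  (\int[@lebesgueT R N]_(x in A) (kappa%:num * lastc x * fdata p x)%:E)%E.

Section initial_measure_instance.
Variables (N : nat) (p : R) (kappa : {posnum R}).

Lemma initial_density_ge0 (x : N.-tuple R) :
  0 <= kappa%:num * lastc x * fdata p x.
Proof.
have [x0|x0] := leP 0 (lastc x).
  rewrite mulr_ge0 ?mulr_ge0//.
  by rewrite /fdata; case: ifP => _; rewrite !mulr_ge0 ?powR_ge0.
suff -> : fdata p x = 0 by rewrite mulr0.
rewrite /fdata; case: ifP => _; rewrite indicE memNset ?mulr0// => -[_];
  by rewrite /cOmega/= leNgt x0.
Qed.

Let initial0 : initial_measure p kappa (@set0 (N.-tuple R)) = 0%E.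
Proof. by rewrite /initial_measure integral_set0. Qed.

Let initial_ge0 (A : set (N.-tuple R)) : (0 <= initial_measure p kappa A)%E.
Proof.
by apply: integral_ge0 => x _; rewrite lee_fin initial_density_ge0.
Qed.

Let initial_sigma_additive :
  semi_sigma_additive (@initial_measure N p kappa).
Proof.
apply: semi_sigma_additive_nng_induced => [|x].
  apply/measurable_EFinP; apply: measurable_funM; last exact: measurable_fdata.
  by apply: measurable_funM => //; exact: measurable_lastc.
by rewrite lee_fin initial_density_ge0.
Qed.

HB.instance Definition _ := isMeasure.Build _ _ _ (@initial_measure N p kappa)
  initial0 initial_ge0 initial_sigma_additive.
End initial_measure_instance.

End initial_data.

(* Main.v *)
(* Write S(t) for the operator with kernel G, and
   Psi u (t) = \int_0^t S(t - s) u(s)^p ds, so that the equation reads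
   u = kappa S f + Psi u. A nonnegative w with kappa S f + Psi w <= w yields a
   solution by monotone iteration from 0. Hence the admissible kappa form an
   initial segment of the positive reals, and kappa_0 is its supremum; it remains
   to see that the segment is nonempty and bounded.

   Nonempty: put r = |y|^2, g = rho(r) f and w = S f + S g / rho(t), where rho(t)
   is a negative power of t if p > p_{N+1}, and a power of |log t| otherwise.
   Where r <= s one has f <= g / rho(s), and a sup bound on S(s) g makes the
   corresponding part of Psi w at most C S g / rho. For f_s = f 1_{r > s},
   convexity gives (S(s) f_s)^p <= 2^p S(s) (f_s^p), and
   \int_0^t f_s^p ds <= r f^p <= C f; by S(t - s) S(s) <= S(t) this part is at
   most C S f. So Psi w <= K w, and a small multiple of w is a supersolution.

   Bounded: let psi(y, t) = A(t) on the cubes sqrt t <= y_i <= 2 sqrt t, with A a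
   power of t times a power of |log t|. Both S f and Psi psi dominate a multiple
   of psi near t = 0, so for large kappa iterating the equation multiplies the
   constant in u >= c psi by a factor > 1, and u is infinite where psi > 0. *)

Require Import Defs.
From mathcomp Require Import all_boot all_order all_algebra.
From mathcomp Require Import all_classical all_reals all_analysis.
From mathcomp Require Import measurable_realfun ring lra.
Import Order.TTheory GRing.Theory Num.Def Num.Theory.
Import numFieldNormedType.Exports.
Local Open Scope classical_set_scope.
Local Open Scope ring_scope.
Set Implicit Arguments.
Unset Strict Implicit.
Unset Printing Implicit Defensive.

Ltac solve_measurable_proj := repeat first
  [ exact: measurable_id | exact: measurable_cst | exact: measurable_fst
  | exact: measurable_snd | apply: measurable_fun_pair
  | apply: (measurableT_comp measurable_fst)
  | apply: (measurableT_comp measurable_snd) ].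

Section integral_monotone.
Local Open Scope ereal_scope.
Context d (T : measurableType d) {R : realType} (mu : {measure set T -> \bar R}).

Lemma ge0_le_integral_any (D : set T) (f g : T -> \bar R) :
  (forall x, D x -> 0 <= f x) -> (forall x, D x -> f x <= g x) ->
  \int[mu]_(x in D) f x <= \int[mu]_(x in D) g x.
Proof.
move=> f0 fg.
have g0 x : D x -> 0 <= g x by move=> Dx; exact: le_trans (f0 _ Dx) (fg _ Dx).
rewrite !ge0_integralE//; apply: le_ereal_sup => _ [h /= hf <-].
exists h => // x; apply: le_trans (hf x) _; exact: lee_restrict.
Qed.

End integral_monotone.

Section poweR_sup.
Local Open Scope ereal_scope.
Context {R : realType}.

Lemma ge0_le_poweR (p : R) (x y : \bar R) : (0 <= p)%R -> 0 <= x -> x <= y ->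
  x `^ p <= y `^ p.
Proof.
by move=> p0 x0 xy; apply: gt0_ler_poweR => //; rewrite in_itv/= leey andbT// (le_trans x0 xy).
Qed.

Lemma ereal_sup_poweR (p : R) (u : (\bar R)^nat) : (0 < p)%R ->
  (forall n, 0 <= u n) ->
  ereal_sup (range u) `^ p = ereal_sup (range (fun n => u n `^ p)).
Proof.
move=> p0 u0; apply/eqP; rewrite eq_le; apply/andP; split; last first.
  apply: ge_ereal_sup => _ [n _ <-]; apply: ge0_le_poweR; [exact: ltW|exact: u0|].
  by apply: ereal_sup_ubound; exists n.
set c := ereal_sup (range (fun n => u n `^ p)).
have cu n : u n `^ p <= c by apply: ereal_sup_ubound; exists n.
have c0 : 0 <= c by apply: le_trans (cu 0%N); exact: poweR_ge0.
have K (y : \bar R) (a b : R) : (a * b)%R = 1%R -> 0 <= y -> (y `^ a) `^ b = y.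
  by move=> ab y0; rewrite -poweRrM ab poweRe1.
rewrite -[leRHS](K c p^-1%R p)//; last by rewrite mulVf// gt_eqF.
apply: ge0_le_poweR; first exact: ltW.
  by apply: le_trans (u0 0%N) _; apply: ereal_sup_ubound; exists 0%N.
apply: ge_ereal_sup => _ [n _ <-].
rewrite -[leLHS](K (u n) p p^-1%R)//; last by rewrite mulfV// gt_eqF.
by apply: ge0_le_poweR; rewrite ?poweR_ge0// invr_ge0 ltW.
Qed.

End poweR_sup.

Lemma geometric_unbounded {R : realType} (A a q : R) : 0 < a -> 1 < q ->
  exists n, A <= a * q ^+ n.
Proof.
move=> a0 q1; have bern n : 1 + n%:R * (q - 1) <= q ^+ n.
  elim: n => [|n IH]; first by rewrite mul0r addr0.
  have := ler_wpM2l (ltW (lt_trans ltr01 q1)) IH; rewrite -exprS.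
  apply: le_trans; rewrite -natr1.
  have : 0 <= n%:R * (q - 1) ^+ 2 by rewrite mulr_ge0 ?sqr_ge0.
  nra.
exists (truncn (A / (a * (q - 1)))).+1; rewrite mulrC -ler_pdivrMr//.
apply: le_trans (bern _); apply: ler_wpDl => //.
rewrite -ler_pdivrMr ?subr_gt0// -mulrA -invfM ltW// truncnS_gt//.
Qed.

Section kernel_equation.
Local Open Scope ereal_scope.
Context {R : realType} d (X : measurableType d).
Variable lam : {sigma_finite_measure set X -> \bar R}.
Variable G : X -> X -> R -> R.
Hypothesis G_ge0 : forall x y t, (0 <= G x y t)%R.
Hypothesis mG :
  measurable_fun setT (fun z : (X * X) * measurableTypeR R => G z.1.1 z.1.2 z.2).
Local Notation leb := (@lebesgue_measure R).
Local Notation XR := (X * measurableTypeR R)%type.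

Let nu : {measure set XR -> \bar R} := (lam : {measure set X -> \bar R}) \x leb.

Definition heatS (h : X -> \bar R) (z : X * R) := \int[lam]_y ((G z.1 y z.2)%:E * h y).

Definition duhamel (p : R) (u : X * R -> \bar R) (z : X * R) :=
  \int[leb]_s \int[lam]_y ((G z.1 y (z.2 - s))%:E * u (y, s) `^ p).

Let ae_imp (P P' : X * R -> Prop) : (forall z, P z -> P' z) ->
  {ae nu, forall z, P z} -> {ae nu, forall z, P' z}.
Proof. exact: (@filterS _ _ (ae_filter_ringOfSetsType nu)). Qed.

Lemma measurable_heatS h : measurable_fun setT h -> (forall y, 0 <= h y) ->
  measurable_fun setT (heatS h : XR -> \bar R).
Proof.
move=> mh h0.
pose f (w : XR * X) := (G w.1.1 w.2 w.1.2)%:E * h w.2.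
apply: (@measurable_fun_fubini_tonelli_F _ _ _ _ _ lam f); last first.
  by move=> w; rewrite mule_ge0 ?lee_fin//.
apply: emeasurable_funM; last exact: measurableT_comp.
have m : measurable_fun setT (fun w : XR * X => ((w.1.1, w.2), w.1.2) : (X * X) * measurableTypeR R).
  by solve_measurable_proj.
by apply/measurable_EFinP; exact: (measurableT_comp mG m).
Qed.

Lemma heatS_ge0 h z : (forall y, 0 <= h y) -> 0 <= heatS h z.
Proof. by move=> h0; apply: integral_ge0 => y _; rewrite mule_ge0 ?lee_fin//. Qed.

Lemma le_heatS h1 h2 z : (forall y, 0 <= h1 y) -> (forall y, h1 y <= h2 y) ->
  heatS h1 z <= heatS h2 z.
Proof.
move=> h0 h12; apply: ge0_le_integral_any => y _; first by rewrite mule_ge0 ?lee_fin//.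
by apply: lee_wpmul2l; rewrite ?lee_fin.
Qed.

Lemma measurable_duhamel_integrand p (u : X * R -> \bar R) :
  measurable_fun setT (u : XR -> \bar R) ->
  measurable_fun setT (fun w : (XR * measurableTypeR R) * X =>
    (G w.1.1.1 w.2 (w.1.1.2 - w.1.2))%:E * u (w.2, w.1.2) `^ p).
Proof.
move=> mu; apply: emeasurable_funM.
  have m : measurable_fun setT (fun w : (XR * measurableTypeR R) * X =>
      ((w.1.1.1, w.2), w.1.1.2 - w.1.2)%R : (X * X) * measurableTypeR R).
    apply: measurable_fun_pair; first by solve_measurable_proj.
    by apply: measurable_funB; solve_measurable_proj.
  by apply/measurable_EFinP; exact: (measurableT_comp mG m).
apply: (measurableT_comp (measurable_poweR p)).
have m : measurable_fun setT
    (fun w : (XR * measurableTypeR R) * X => (w.2, w.1.2) : XR).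
  by solve_measurable_proj.
exact: (measurableT_comp mu m).
Qed.

Lemma measurable_duhamel_slice p (u : X * R -> \bar R) (z : X * R) :
  measurable_fun setT (u : XR -> \bar R) ->
  measurable_fun setT (fun w : XR => (G z.1 w.1 (z.2 - w.2))%:E * u w `^ p).
Proof.
move=> /(measurable_duhamel_integrand p) m.
rewrite (_ : (fun w : XR => _) =
  (fun w : (XR * measurableTypeR R) * X =>
    (G w.1.1.1 w.2 (w.1.1.2 - w.1.2))%:E * u (w.2, w.1.2) `^ p) \o
  (fun w : XR => ((z : XR), w.2, w.1))); last by apply/funext => -[].
apply: (measurableT_comp m).
by solve_measurable_proj.
Qed.

Lemma measurable_duhamel p u :
  measurable_fun setT (u : XR -> \bar R) ->
  measurable_fun setT (duhamel p u : XR -> \bar R).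
Proof.
move=> mu; have m := measurable_duhamel_integrand p mu.
pose f (w : XR * measurableTypeR R) :=
  \int[lam]_y ((G w.1.1 y (w.1.2 - w.2))%:E * u (y, w.2) `^ p).
apply: (@measurable_fun_fubini_tonelli_F _ _ _ _ _ leb f).
  apply: (@measurable_fun_fubini_tonelli_F _ _ _ _ _ lam _ m).
  by move=> w; rewrite mule_ge0 ?lee_fin ?poweR_ge0.
by move=> w; apply: integral_ge0 => y _; rewrite mule_ge0 ?lee_fin ?poweR_ge0.
Qed.

Lemma duhamel_ge0 p u z : 0 <= duhamel p u z.
Proof.
by apply: integral_ge0 => s _; apply: integral_ge0 => y _; rewrite mule_ge0 ?lee_fin ?poweR_ge0.
Qed.

Lemma le_duhamel p u v z : (0 <= p)%R -> (forall w, 0 <= u w) -> (forall w, u w <= v w) ->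
  duhamel p u z <= duhamel p v z.
Proof.
move=> p0 u0 uv; apply: ge0_le_integral_any => s _.
  by apply: integral_ge0 => y _; rewrite mule_ge0 ?lee_fin ?poweR_ge0.
apply: ge0_le_integral_any => y _; first by rewrite mule_ge0 ?lee_fin ?poweR_ge0.
by apply: lee_wpmul2l; rewrite ?lee_fin//; exact: ge0_le_poweR.
Qed.

Lemma duhamelE p u z : measurable_fun setT (u : XR -> \bar R) ->
  duhamel p u z =
  \int[nu]_w ((G z.1 w.1 (z.2 - w.2))%:E * u w `^ p).
Proof.
move=> mu; rewrite /nu fubini_tonelli2//; first exact: measurable_duhamel_slice.
by move=> w; rewrite mule_ge0 ?lee_fin ?poweR_ge0.
Qed.

Lemma duhamelZ p (k : R) u z : (0 <= k)%R ->
  measurable_fun setT (u : XR -> \bar R) -> (forall w, 0 <= u w) ->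
  duhamel p (fun w => k%:E * u w) z = (k `^ p)%:E * duhamel p u z.
Proof.
move=> k0 mu u0; rewrite !duhamelE//; last exact: measurable_funeM.
rewrite -ge0_integralZl//; last 3 first.
- exact: measurable_duhamel_slice.
- by move=> w _; rewrite mule_ge0 ?lee_fin ?poweR_ge0.
- by rewrite lee_fin powR_ge0.
apply: eq_integral => w _; rewrite poweRM ?lee_fin// poweR_EFin.
by rewrite muleCA.
Qed.

(* No measurability is assumed of [v]: a solution is only measurable for the
   completed measure. *)
Lemma ae_le_duhamel p u v z : (0 < p)%R ->
  measurable_fun setT (u : XR -> \bar R) ->
  (forall w, 0 <= u w) -> (forall w, 0 <= v w) ->
  {ae nu, forall w, u w <= v w} ->
  duhamel p u z <= duhamel p v z.
Proof.
move=> p0 mu u0 v0 [Z [mZ Z0 sub]].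
pose u' := u \_ (~` Z).
have mu' : measurable_fun setT (u' : XR -> \bar R).
  apply/(measurable_restrictT _ _).1; first exact: measurableC.
  exact: measurable_funS mu.
have u'0 w : 0 <= u' w by apply: erestrict_ge0 => ? _.
apply: (@le_trans _ _ (duhamel p u' z)); last first.
  apply: le_duhamel => //; first exact: ltW.
  move=> w; rewrite /u' patchE; case: ifPn => // /set_mem Zw.
  by apply: contrapT => H; apply: Zw; apply: sub.
rewrite !duhamelE// (ge0_negligible_integral mZ)//; last 2 first.
- exact: measurable_duhamel_slice.
- by move=> ? _; rewrite mule_ge0 ?lee_fin ?poweR_ge0.
rewrite setTD integral_mkcond; apply: ge0_le_integral_any => w _.
  by apply: erestrict_ge0 => ? _; rewrite mule_ge0 ?lee_fin ?poweR_ge0.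
rewrite /u' !patchE; case: ifPn => // _.
by rewrite mule_ge0 ?lee_fin ?poweR_ge0.
Qed.

Lemma duhamel_sup p (u : (X * R -> \bar R)^nat) z : (0 < p)%R ->
  (forall n, measurable_fun setT (u n : XR -> \bar R)) ->
  (forall n w, 0 <= u n w) -> (forall w, nondecreasing_seq (u ^~ w)) ->
  duhamel p (fun w => ereal_sup (range (u ^~ w))) z =
  ereal_sup (range (fun n => duhamel p (u n) z)).
Proof.
move=> p0 mu u0 ndu.
have mg n := measurable_duhamel_slice p z (mu n).
have ndg w : nondecreasing_seq (fun n => (G z.1 w.1 (z.2 - w.2))%:E * u n w `^ p).
  move=> m n mn; apply: lee_wpmul2l; rewrite ?lee_fin//; apply: ge0_le_poweR => //.
    exact: ltW.
  exact: ndu.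
have msup : measurable_fun setT ((fun w => ereal_sup (range (u ^~ w))) : XR -> \bar R).
  rewrite (_ : (fun w => _) = fun w => limn (u ^~ w)).
    apply: (emeasurable_fun_cvg (fun n => u n : XR -> \bar R)) => // w _.
    exact: (ereal_nondecreasing_is_cvgn (ndu w)).
  by apply/funext => w; apply/esym/cvg_lim => //; exact: ereal_nondecreasing_cvgn.
rewrite duhamelE//.
have lim_sup (a : (\bar R)^nat) : nondecreasing_seq a -> limn a = ereal_sup (range a).
  by move=> nda; apply/cvg_lim => //; exact: ereal_nondecreasing_cvgn.
pose g n (w : X * R) := (G z.1 w.1 (z.2 - w.2))%:E * u n w `^ p.
have g0 n w : 0 <= g n w by rewrite mule_ge0 ?lee_fin// poweR_ge0.
transitivity (\int[nu]_w limn (g ^~ w)).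
  apply: eq_integral => w _; apply/esym/cvg_lim => //.
  rewrite ereal_sup_poweR//; apply: cvgeZl => //.
  apply: ereal_nondecreasing_cvgn => m n mn; apply: ge0_le_poweR => //.
    exact: ltW.
  exact: ndu.
rewrite (monotone_convergence _ measurableT mg (fun n w _ => g0 n w) (fun w _ => ndg w)).
rewrite lim_sup.
  by congr ereal_sup; apply: eq_imagel => n _; rewrite /= duhamelE.
by move=> m n mn; apply: ge0_le_integral_any => w _; [exact: g0|exact: ndg].
Qed.

Section solutions.
Variables (p : R) (Q : set (X * R)) (U0 : X * R -> \bar R).
Hypothesis p1 : (1 < p)%R.
Hypothesis mQ : measurable (Q : set XR).
Hypothesis mU0 : measurable_fun setT (U0 : XR -> \bar R).
Hypothesis U0_ge0 : forall z, 0 <= U0 z.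

Let p0 : (0 < p)%R. Proof. exact: lt_trans p1. Qed.

Let iterate := fix F n := if n is n'.+1 then
  (fun z => U0 z + duhamel p (F n') z) \_ Q else cst 0.

Let iterate_ge0 n z : 0 <= iterate n z.
Proof.
case: n => [|n] //=; apply: erestrict_ge0 => w _.
by rewrite adde_ge0 ?duhamel_ge0.
Qed.

Let measurable_iterate n : measurable_fun setT (iterate n : XR -> \bar R).
Proof.
elim: n => [|n IH] /=; first exact: measurable_cst.
apply/(measurable_restrictT _ _).1 => //; apply: measurable_funTS.
by apply: emeasurable_funD => //; exact: measurable_duhamel.
Qed.

Let le_iterateS n z : iterate n z <= iterate n.+1 z.
Proof.
elim: n z => [|n IH] z; first exact: (iterate_ge0 1).
apply: lee_restrict => w _; apply: leeD => //.
by apply: le_duhamel; [exact: ltW|exact: iterate_ge0|exact: IH].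
Qed.

Lemma solution_of_supersolution (w : X * R -> \bar R) :
  (forall z, 0 <= w z) ->
  {ae nu,
    forall z, Q z -> U0 z + duhamel p w z <= w z} ->
  exists u : X * R -> \bar R, [/\ measurable_fun setT (u : XR -> \bar R),
    forall z, 0 <= u z,
    {ae nu, forall z, u z <= w z},
    forall z, ~ Q z -> u z = 0 &
    forall z, Q z -> u z = U0 z + duhamel p u z].
Proof.
move=> w0 super.
have nd z : nondecreasing_seq (iterate ^~ z) by apply/nondecreasing_seqP.
have lim_sup (a : (\bar R)^nat) : nondecreasing_seq a -> limn a = ereal_sup (range a).
  by move=> nda; apply/cvg_lim => //; exact: ereal_nondecreasing_cvgn.
pose u z := ereal_sup (range (iterate ^~ z)).
have uE z : Q z -> u z = U0 z + duhamel p u z.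
  move=> Qz; rewrite /u duhamel_sup//.
  set D := fun n => duhamel p (iterate n) z.
  have ndD : nondecreasing_seq D.
    by apply/nondecreasing_seqP => n; apply: le_duhamel; [exact: ltW|exact: iterate_ge0|].
  have l1 : iterate n.+1 z @[n --> \oo] --> ereal_sup (range (iterate ^~ z)).
    by rewrite (cvg_shiftS (iterate ^~ z)); exact: ereal_nondecreasing_cvgn.
  have l2 : iterate n.+1 z @[n --> \oo] --> U0 z + ereal_sup (range D).
    rewrite (_ : (fun n => _) = fun n => U0 z + D n); last first.
      by apply/funext => n; rewrite /= patchE mem_set.
    apply: cvgeD; [|exact: cvg_cst|exact: ereal_nondecreasing_cvgn].
    apply: ge0_adde_def; rewrite inE//.
    apply: (@le_trans _ _ (D 0%N)); first exact: duhamel_ge0.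
    by apply: ereal_sup_ubound; exists 0%N.
  exact: (cvg_unique (@ereal_hausdorff R) l1 l2).
exists u; split => //.
- rewrite (_ : u = fun z => limn (iterate ^~ z)); last first.
    by apply/funext => z; rewrite lim_sup.
  apply: (emeasurable_fun_cvg (fun n => iterate n : XR -> \bar R)) => // z _.
  exact: (ereal_nondecreasing_is_cvgn (nd z)).
- by move=> z; apply: (le_trans (iterate_ge0 0 z)); apply: ereal_sup_ubound; exists 0%N.
- have le_w n : {ae nu,
      forall z, iterate n z <= w z}.
    elim: n => [|n IH]; first by apply: aeW => z /=.
    apply: ae_imp super => z super; rewrite /= patchE.
    case: ifPn => [/set_mem Qz|_]; last exact: w0.
    apply: le_trans (super Qz); apply: leeD => //.
    exact: ae_le_duhamel.
  apply: ae_imp (ae_foralln le_w) => z le_wz.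
  by apply: ge_ereal_sup => _ [n _ <-].
- move=> z Qz; apply/eqP; rewrite eq_le; apply/andP; split.
    apply: ge_ereal_sup => _ [[|n] _ <-] //=.
    by rewrite patchE memNset.
  by apply: ereal_sup_ubound; exists 0%N.
Qed.

(* Each pass through the equation improves the constant in [u >= c psi] by the
   factor [c2 * c1 `^ (p - 1) > 1]. *)
Lemma ae_infinite_on_subsolution (psi u : X * R -> \bar R) (c1 c2 : R) :
  measurable_fun setT (psi : XR -> \bar R) -> (forall z, 0 <= psi z) ->
  (forall z, ~ Q z -> psi z = 0) ->
  (0 < c1)%R -> (0 < c2)%R -> (1 < c2 * c1 `^ (p - 1))%R ->
  (forall z, Q z -> c1%:E * psi z <= U0 z) ->
  (forall z, Q z -> c2%:E * psi z <= duhamel p psi z) ->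
  (forall z, 0 <= u z) ->
  {ae nu,
    forall z, Q z -> u z = U0 z + duhamel p u z} ->
  {ae nu,
    forall z, 0 < psi z -> u z = +oo}.
Proof.
move=> mpsi psi0 psiQ c10 c20; set th := (c2 * _)%R => th1 psi_U0 psi_D u0 uE.
have H n : {ae nu,
    forall z, (c1 * th ^+ n)%:E * psi z <= u z}.
  elim: n => [|n IH].
    apply: ae_imp uE => z uE; have [Qz|nQz] := pselect (Q z); last first.
      by rewrite psiQ// mule0.
    rewrite expr0 mulr1 uE//; apply: (le_trans (psi_U0 _ Qz)).
    by rewrite leeDl// duhamel_ge0.
  apply: ae_imp uE => z uE; have [Qz|nQz] := pselect (Q z); last first.
    by rewrite psiQ// mule0.
  have k0 : (0 <= c1 * th ^+ n)%R.
    by rewrite mulr_ge0 ?exprn_ge0 ?ltW// (lt_trans _ th1).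
  have -> // : (c1 * th ^+ n.+1)%:E * psi z <= u z.
  rewrite uE//.
  have le1 : duhamel p (fun w => (c1 * th ^+ n)%:E * psi w) z <= duhamel p u z.
    apply: ae_le_duhamel => //; first exact: measurable_funeM.
    by move=> w; rewrite mule_ge0 ?lee_fin.
  apply: (@le_trans _ _ (duhamel p u z)); last by rewrite leeDr.
  apply: le_trans le1.
  rewrite duhamelZ//.
  apply: (@le_trans _ _ (((c1 * th ^+ n) `^ p)%:E * (c2%:E * psi z))); last first.
    by apply: lee_wpmul2l; rewrite ?lee_fin ?powR_ge0 ?psi_D.
  rewrite muleA -EFinM; apply: lee_wpmul2r; rewrite ?lee_fin//.
  rewrite -mulr_powRB1// exprSr mulrA -[leRHS]mulrA ler_wpM2l//.
  rewrite [leRHS]mulrC ler_wpM2l ?(ltW c20)//.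
  apply: ge0_ler_powR; rewrite ?nnegrE ?subr_ge0 ?(ltW c10) ?(ltW p1)//.
  by rewrite ler_peMr ?(ltW c10)// exprn_ege1// ltW.
apply: ae_imp (ae_foralln H) => z Hz psiz.
have [r r0 rpsi] : exists2 r : R, (0 < r)%R & r%:E <= psi z.
  case: (psi z) psiz => [r| |//]; last by exists 1%R; rewrite ?leey.
  by rewrite lte_fin => r0; exists r.
apply/eqyP => A A0.
have [n An] := geometric_unbounded A (mulr_gt0 c10 r0) th1.
apply: le_trans (Hz n); apply: (@le_trans _ _ ((c1 * th ^+ n)%:E * r%:E)).
  by rewrite -EFinM lee_fin mulrAC.
apply: lee_wpmul2l => //; rewrite lee_fin mulr_ge0 ?exprn_ge0 ?ltW//.
exact: lt_trans th1.
Qed.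
End solutions.

End kernel_equation.

Lemma measurable_invr {R : realType} : measurable_fun [set: R] (@GRing.inv R).
Proof.
rewrite (_ : @GRing.inv R =
  (fun x => if 0 <= x then x `^ (-1) else - ((- x) `^ (-1)))); last first.
  apply/funext => x; have [x0|/ltW x0] := leP 0 x; first by rewrite powR_inv1.
  by rewrite powR_inv1 ?oppr_ge0// invrN opprK.
apply: measurable_fun_ifT; first exact: measurable_fun_ler.
  exact: measurable_powR.
apply: (measurableT_comp (@oppr_measurable R setT)).
exact: (measurableT_comp (measurable_powR (-1)) (@oppr_measurable R setT)).
Qed.

Section poweR_inequalities.
Local Open Scope ereal_scope.
Context {R : realType}.

Lemma poweRD_le (p : R) (a b : \bar R) : (0 <= p)%R -> 0 <= a -> 0 <= b ->
  (a + b) `^ p <= (2 `^ p)%:E * (a `^ p + b `^ p).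
Proof.
move=> p0 a0 b0.
wlog ab : a b a0 b0 / a <= b.
  move=> W; have [ab|/ltW ba] := leP a b; first exact: W.
  by rewrite addeC [X in _ * X]addeC; exact: W.
apply: (@le_trans _ _ ((2%:E * b) `^ p)).
  apply: ge0_le_poweR => //; first exact: adde_ge0.
  by rewrite mule_natl mule2n; exact: leeD2r.
rewrite poweRM ?lee_fin// poweR_EFin; apply: lee_wpmul2l.
  by rewrite lee_fin powR_ge0.
by rewrite leeDr// poweR_ge0.
Qed.

Lemma le_mul_poweRB1 (p : R) (a : \bar R) (m : R) : (1 <= p)%R -> 0 <= a ->
  a <= m%:E -> a `^ p <= (m `^ (p - 1))%:E * a.
Proof.
move=> p1; case: a => [a| |//]; last by rewrite leye_eq.
rewrite lee_fin => a0; rewrite lee_fin => am.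
rewrite poweR_EFin -EFinM lee_fin -mulr_powRB1//; last exact: lt_le_trans p1.
rewrite mulrC ler_wpM2r// ge0_ler_powR ?subr_ge0// nnegrE//.
exact: le_trans am.
Qed.

Lemma le_split_poweR (p z : R) (h : \bar R) : (1 < p)%R -> (0 < z)%R -> 0 <= h ->
  h <= z%:E + (z `^ (1 - p))%:E * h `^ p.
Proof.
move=> p1 z0 h0; have [hz|/ltW zh] := leP h z%:E.
  by apply: (le_trans hz); rewrite leeDl// mule_ge0 ?poweR_ge0// lee_fin powR_ge0.
rewrite -[leLHS]add0e; apply: leeD; first by rewrite lee_fin ltW.
case: h h0 zh => [h| |]//.
  rewrite lee_fin => h0; rewrite lee_fin => zh.
  rewrite poweR_EFin -EFinM lee_fin -(mulr_powRB1 h0 (lt_trans ltr01 p1)).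
  rewrite mulrCA ler_peMr//.
  rewrite -opprB powRN mulrC ler_pdivlMr ?powR_gt0// mul1r.
  by rewrite ge0_ler_powR ?subr_ge0 ?nnegrE// ltW.
move=> _ _; rewrite poweRyr; last by rewrite gt_eqF// (lt_trans _ p1).
by rewrite gt0_muley// lte_fin powR_gt0.
Qed.

End poweR_inequalities.

Section kernel_existence.
Local Open Scope ereal_scope.
Context {R : realType} d (X : measurableType d).
Variable lam : {sigma_finite_measure set X -> \bar R}.
Variable G : X -> X -> R -> R.
Hypothesis G_ge0 : forall x y t, (0 <= G x y t)%R.
Hypothesis mG :
  measurable_fun setT (fun z : (X * X) * measurableTypeR R => G z.1.1 z.1.2 z.2).
Hypothesis G_le0 : forall x y t, (t <= 0)%R -> G x y t = 0%R.
Hypothesis G_mass : forall x t, \int[lam]_y (G x y t)%:E <= 1.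
Hypothesis G_semigroup : forall x y t s, (0 < t)%R -> (0 < s)%R ->
  \int[lam]_z (G x z t * G z y s)%:E <= (G x y (t + s))%:E.
Local Notation leb := (@lebesgue_measure R).
Local Notation heatS := (heatS lam G).
Local Notation duhamel := (duhamel lam G).

Let mGx x t : measurable_fun setT (fun y => G x y t).
Proof.
rewrite (_ : (fun y => _) = (fun z : (X * X) * measurableTypeR R => G z.1.1 z.1.2 z.2) \o
  (fun y => ((x, y), t : measurableTypeR R)))//.
by apply: (measurableT_comp mG); solve_measurable_proj.
Qed.

Let mGE x t : measurable_fun setT (fun y => (G x y t)%:E).
Proof. exact/measurable_EFinP. Qed.

Lemma heatSD (h1 h2 : X -> \bar R) z : measurable_fun setT h1 -> measurable_fun setT h2 ->
  (forall y, 0 <= h1 y) -> (forall y, 0 <= h2 y) ->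
  heatS (h1 \+ h2) z = heatS h1 z + heatS h2 z.
Proof.
move=> mh1 mh2 h10 h20; rewrite /heatS -ge0_integralD//.
- by apply: eq_integral => y _; rewrite ge0_muleDr.
- by move=> y _; rewrite mule_ge0 ?lee_fin.
- exact: emeasurable_funM.
- by move=> y _; rewrite mule_ge0 ?lee_fin.
- exact: emeasurable_funM.
Qed.

Lemma heatSZ (c : R) (h : X -> \bar R) z : (0 <= c)%R -> measurable_fun setT h ->
  (forall y, 0 <= h y) -> heatS (fun y => c%:E * h y) z = c%:E * heatS h z.
Proof.
move=> c0 mh h0; rewrite /heatS -ge0_integralZl//.
- by apply: eq_integral => y _; rewrite muleCA.
- exact: emeasurable_funM.
- by move=> y _; rewrite mule_ge0 ?lee_fin.
Qed.

Lemma heatS_cst (c : R) z : (0 <= c)%R -> heatS (cst c%:E) z <= c%:E.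
Proof.
move=> c0; rewrite /heatS ge0_integralZr//; last by move=> y _; rewrite lee_fin.
by rewrite -[leRHS]mul1e; apply: lee_wpmul2r; rewrite ?lee_fin.
Qed.

(* Only [<=] holds: the constant [2 `^ p] spares the optimal one, which would
   come from convexity. *)
Lemma heatS_poweR p (h : X -> \bar R) z : (1 < p)%R -> measurable_fun setT h ->
  (forall y, 0 <= h y) ->
  heatS h z `^ p <= (2 `^ p)%:E * heatS (fun y => h y `^ p) z.
Proof.
move=> p1 mh h0; have p0 : (0 < p)%R by exact: lt_trans p1.
set J := heatS (fun y => h y `^ p) z.
have mhp : measurable_fun setT (fun y => h y `^ p).
  exact: (measurableT_comp (measurable_poweR p) mh).
have J0 : 0 <= J by apply: heatS_ge0 => // y; exact: poweR_ge0.
have split_le (k : R) : (0 < k)%R -> heatS h z <= k%:E + (k `^ (1 - p))%:E * J.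
  move=> k0; apply: (@le_trans _ _
      (heatS (cst k%:E \+ (fun y => (k `^ (1 - p))%:E * h y `^ p)) z)).
    by apply: le_heatS => // y; exact: le_split_poweR.
  rewrite heatSD//; last 3 first.
  - exact: measurable_funeM.
  - by move=> y; rewrite lee_fin ltW.
  - by move=> y; rewrite mule_ge0 ?poweR_ge0// lee_fin powR_ge0.
  rewrite heatSZ ?powR_ge0//; last by move=> y; exact: poweR_ge0.
  by apply: leeD => //; apply: heatS_cst; exact: ltW.
case: J J0 split_le => [J| |]//; last first.
  by move=> _ _; rewrite gt0_muley ?leey// lte_fin powR_gt0.
rewrite lee_fin le_eqVlt => /predU1P[<- H|J0 H].
  suff -> : heatS h z = 0 by rewrite poweR0r ?mule0// gt_eqF.
  apply/eqP; rewrite eq_le heatS_ge0// andbT; apply/lee_addgt0Pr => k k0.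
  by have := H _ k0; rewrite mule0 adde0 add0e.
have Jp0 : (0 < J `^ p^-1)%R by exact: powR_gt0.
apply: (@le_trans _ _ ((2 * J `^ p^-1)%:E `^ p)).
  apply: ge0_le_poweR; [exact: ltW|exact: heatS_ge0|].
  apply: le_trans (H _ Jp0) _; rewrite -EFinM -EFinD lee_fin mulr2n mulrDl mul1r.
  rewrite lerD2l -[X in (_ * X <= _)%R](powRr1 (ltW J0)) -powRrM -powRD.
    by rewrite mulrBr mulr1 mulVf ?gt_eqF// subrK.
  by apply/implyP => _; rewrite gt_eqF.
rewrite poweR_EFin -EFinM lee_fin powRM ?(ltW Jp0)//.
by rewrite -[X in (_ * X <= _)%R]powRrM mulVf ?gt_eqF// powRr1// ltW.
Qed.

Lemma heatS_semigroup (h : X -> \bar R) x t s : (0 < t)%R -> (0 < s)%R ->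
  measurable_fun setT h -> (forall y, 0 <= h y) ->
  heatS (fun y => heatS h (y, s)) (x, t) <= heatS h (x, t + s)%R.
Proof.
move=> t0 s0 mh h0; rewrite /heatS /=.
pose f (w : X * X) := ((G x w.1 t)%:E * (G w.1 w.2 s)%:E) * h w.2.
have f0 w : 0 <= f w by rewrite !mule_ge0 ?lee_fin.
have mf : measurable_fun setT f.
  apply: emeasurable_funM; last exact: measurableT_comp.
  apply: emeasurable_funM.
    exact: (measurableT_comp (mGE x t) measurable_fst).
  apply/measurable_EFinP.
  have m : measurable_fun setT (fun w : X * X => (w, s : measurableTypeR R)).
    by solve_measurable_proj.
  exact: (measurableT_comp mG m).
have mGs y : measurable_fun setT (fun y' => (G y y' s)%:E * h y').
  by apply: emeasurable_funM.
apply: (@le_trans _ _ (\int[lam]_y \int[lam]_y' f (y, y'))).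
  apply: ge0_le_integral_any => y _.
    by rewrite mule_ge0 ?lee_fin// integral_ge0// => y' _; rewrite mule_ge0 ?lee_fin.
  rewrite -ge0_integralZl//; last 2 first.
  - by move=> y' _; rewrite mule_ge0 ?lee_fin.
  - by rewrite lee_fin.
  by under eq_integral do rewrite muleA.
rewrite -(@fubini_tonelli1 _ _ _ _ _ lam lam f)// fubini_tonelli2//.
apply: ge0_le_integral_any => y' _; first by rewrite integral_ge0.
rewrite /fubini_G /f /= ge0_integralZr//; last 2 first.
- apply: emeasurable_funM; first exact: mGE.
  apply/measurable_EFinP.
  have m : measurable_fun setT (fun w : X => ((w, y'), s : measurableTypeR R)).
    by solve_measurable_proj.
  exact: (measurableT_comp mG m).
- by move=> y _; rewrite mule_ge0 ?lee_fin.
by apply: lee_wpmul2r => //; exact: G_semigroup.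
Qed.

Section supersolution.
Variables (p T C1 C2 : R) (f g r : X -> R) (rho m : R -> R).
Hypothesis p1 : (1 < p)%R.
Hypotheses (mf : measurable_fun setT f) (mg : measurable_fun setT g)
  (mr : measurable_fun setT r).
Hypotheses (f0 : forall y, (0 <= f y)%R) (g0 : forall y, (0 <= g y)%R)
  (r0 : forall y, (0 <= r y)%R).
Hypothesis rho_gt0 : forall s, (0 < s < T)%R -> (0 < rho s)%R.
Hypothesis m_ge0 : forall s, (0 < s < T)%R -> (0 <= m s)%R.
Hypothesis mrho : measurable_fun `]0%R, T[ rho.
Hypothesis mm : measurable_fun `]0%R, T[ m.
Hypothesis f_le_g : forall s y, (0 < s < T)%R -> (r y <= s)%R -> (f y <= g y / rho s)%R.
Hypothesis C10 : (0 <= C1)%R.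
Hypothesis C20 : (0 <= C2)%R.
Hypothesis f_powR : forall y, (f y `^ p * r y <= C1 * f y)%R.
Hypothesis heatS_g : forall x t, (0 < t < T)%R -> heatS (EFin \o g) (x, t) <= (m t)%:E.
Hypothesis int_m : forall t, (0 < t < T)%R ->
  \int[leb]_(s in `]0%R, t[) ((m s / rho s) `^ (p - 1) / rho s)%:E <= (C2 / rho t)%:E.

(* [g / rho s] dominates [f] on [r <= s]; on [r > s] the power of [f] is
   integrable in [s], since [f `^ p * r <= C1 * f]. *)
Definition heat_barrier (z : X * R) : \bar R :=
  if (0 < z.2)%R then
    heatS (EFin \o f) z + ((rho z.2)^-1)%:E * heatS (EFin \o g) z
  else 0.

Let p0 : (0 < p)%R. Proof. exact: lt_trans p1. Qed.

Let H s := ((m s / rho s) `^ (p - 1) / rho s)%R.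

Let H_ge0 s : (0 < s < T)%R -> (0 <= H s)%R.
Proof. by move=> sT; rewrite divr_ge0 ?powR_ge0// ltW// rho_gt0. Qed.

Let mH : measurable_fun `]0%R, T[ H.
Proof.
have mV : measurable_fun `]0%R, T[ (fun s => (rho s)^-1)%R.
  by apply: (measurableT_comp _ mrho); exact: measurable_invr.
apply: measurable_funM => //.
apply: (measurableT_comp (measurable_powR (p - 1))).
exact: measurable_funM.
Qed.

Let tail s y := (f y `^ p * (s < r y)%R%:R)%R.

Let tail_ge0 s y : (0 <= tail s y)%R.
Proof. by rewrite mulr_ge0 ?powR_ge0. Qed.

Let mtail2 : measurable_fun setT (fun w : measurableTypeR R * X => tail w.1 w.2).
Proof.
apply: measurable_funM.
  by apply: (measurableT_comp (measurable_powR p)); exact: measurableT_comp.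
have mb : measurable_fun setT (fun w : measurableTypeR R * X => (w.1 < r w.2)%R).
  by apply: measurable_fun_ltr => //; exact: measurableT_comp.
rewrite (_ : (fun w => _) = (fun b : bool => (b%:R : R)) \o
  (fun w : measurableTypeR R * X => (w.1 < r w.2)%R))//.
by apply: measurableT_comp mb.
Qed.

Let mtail s : measurable_fun setT (tail s).
Proof.
have m2 : measurable_fun setT (fun y : X => (s : measurableTypeR R, y)).
  by solve_measurable_proj.
exact: (measurableT_comp mtail2 m2).
Qed.

Let barrier_powR_le y s : (0 < s < T)%R ->
  heat_barrier (y, s) `^ p <= (2 `^ p * 2 `^ p)%:E *
    (heatS (EFin \o tail s) (y, s) + (H s)%:E * heatS (EFin \o g) (y, s)).
Proof.
move=> sT; have rs := rho_gt0 sT; have [s0 sT'] := andP sT.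
pose fs y := (f y * (s < r y)%R%:R)%R.
have fs0 x : (0 <= fs x)%R by rewrite mulr_ge0.
have mfs : measurable_fun setT (EFin \o fs).
  apply/measurable_EFinP; apply: measurable_funM => //.
  have mb : measurable_fun setT (fun w : X => (s < r w)%R).
    exact: measurable_fun_ltr.
  rewrite (_ : (fun w => _) = (fun b : bool => (b%:R : R)) \o
    (fun w : X => (s < r w)%R))//.
  by apply: measurableT_comp mb.
have mgE : measurable_fun setT (EFin \o g) by exact/measurable_EFinP.
have Sg0 : 0 <= heatS (EFin \o g) (y, s) by apply: heatS_ge0 => // x; rewrite lee_fin.
have Sfs0 : 0 <= heatS (EFin \o fs) (y, s) by apply: heatS_ge0 => // x; rewrite lee_fin.
have Vrs : (0 <= (rho s)^-1)%R by rewrite invr_ge0 ltW.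
have le1 : heat_barrier (y, s) <= heatS (EFin \o fs) (y, s)
    + (2 / rho s)%:E * heatS (EFin \o g) (y, s).
  rewrite /heat_barrier /= s0 mulr2n mulrDl mul1r EFinD ge0_muleDl ?lee_fin//.
  rewrite addeA; apply: leeD => //.
  rewrite -heatSZ//.
  rewrite -heatSD//; last 2 first.
  - exact: measurable_funeM.
  - by move=> x; rewrite mule_ge0 ?lee_fin//.
  apply: le_heatS => // x.
  rewrite /= -EFinM -EFinD lee_fin /fs.
  have [_|rxs] := ltP s (r x); first by rewrite mulr1 lerDl mulr_ge0.
  by rewrite mulr0 add0r mulrC f_le_g.
have B0 : 0 <= heat_barrier (y, s).
  rewrite /heat_barrier /= s0 adde_ge0 ?mule_ge0 ?lee_fin//.
  by apply: heatS_ge0 => // x; rewrite lee_fin.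
apply: le_trans (ge0_le_poweR (ltW p0) B0 le1) _.
apply: le_trans (poweRD_le (ltW p0) Sfs0 _) _.
  by rewrite mule_ge0 ?lee_fin// divr_ge0// ltW.
rewrite [(2 `^ p * 2 `^ p)%:E]EFinM -[leRHS]muleA.
apply: lee_wpmul2l; first by rewrite lee_fin powR_ge0.
have St0 : 0 <= heatS (EFin \o tail s) (y, s).
  by apply: heatS_ge0 => // x; rewrite lee_fin tail_ge0.
have HSg0 : 0 <= (H s)%:E * heatS (EFin \o g) (y, s).
  by rewrite mule_ge0// lee_fin H_ge0.
rewrite (ge0_muleDr _ St0 HSg0).
apply: leeD.
  apply: le_trans (heatS_poweR _ p1 mfs _) _ => //.
  apply: lee_wpmul2l; first by rewrite lee_fin powR_ge0.
  apply: le_heatS => // x; first by rewrite poweR_ge0.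
  rewrite /= lee_fin /fs /tail; have [_|_] := ltP s (r x); first by rewrite !mulr1.
  by rewrite !mulr0 powR0// gt_eqF.
rewrite poweRM ?lee_fin ?divr_ge0 ?(ltW rs)// poweR_EFin powRM ?invr_ge0 ?(ltW rs)//.
rewrite EFinM -!muleA; apply: lee_wpmul2l; first by rewrite lee_fin powR_ge0.
apply: (@le_trans _ _ ((((rho s)^-1 `^ p)%:E * ((m s `^ (p - 1))%:E * heatS (EFin \o g) (y, s))))).
  apply: lee_wpmul2l; first by rewrite lee_fin powR_ge0.
  by apply: le_mul_poweRB1; rewrite ?(ltW p1)// heatS_g.
rewrite muleA -EFinM; apply: lee_wpmul2r => //; rewrite lee_fin.
rewrite /H powRM// ?m_ge0// -[X in (X * _ <= _)%R]mulr_powRB1//.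
by rewrite le_eqVlt; apply/orP; left; apply/eqP; ring.
Qed.

Lemma duhamel_barrier_le x t : (0 < t < T)%R ->
  duhamel p heat_barrier (x, t) <=
    (2 `^ p * 2 `^ p * (C1 + C2))%:E * heat_barrier (x, t).
Proof.
move=> tT; have [t0 tT'] := andP tT.
have K0 : (0 <= 2 `^ p * 2 `^ p :> R)%R by rewrite mulr_ge0 ?powR_ge0.
have mgE : measurable_fun setT (EFin \o g) by exact/measurable_EFinP.
have Sg0 z : 0 <= heatS (EFin \o g) z by apply: heatS_ge0 => // y; rewrite lee_fin.
have mI : measurable (`]0%R, t[%classic : set (measurableTypeR R)) by [].
have mtS : measurable_fun `]0%R, t[ (fun s => heatS (EFin \o tail s) (x, t)).
  apply: measurable_funTS.
  apply: (@measurable_fun_fubini_tonelli_F _ _ _ _ _ lam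
    (fun w : measurableTypeR R * X => (G x w.2 t)%:E * (tail w.1 w.2)%:E)).
    apply: emeasurable_funM; last exact/measurable_EFinP.
    exact: (measurableT_comp (mGE x t) measurable_snd).
  by move=> w; rewrite mule_ge0 ?lee_fin.
have mHt : measurable_fun `]0%R, t[ (EFin \o H).
  apply/measurable_EFinP; apply: measurable_funS mH => //.
  by apply: subset_itvl; rewrite bnd_simp ltW.
have st_sT s : (0 < s < t)%R -> (0 < s < T)%R.
  by move=> /andP[-> /lt_trans->].
apply: (@le_trans _ _ (\int[leb]_(s in `]0%R, t[) ((2 `^ p * 2 `^ p)%:E *
    (heatS (EFin \o tail s) (x, t) + (H s)%:E * heatS (EFin \o g) (x, t))))).
  rewrite [leRHS]integral_mkcond; apply: ge0_le_integral_any => s _.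
    by apply: integral_ge0 => y _; rewrite mule_ge0 ?lee_fin// poweR_ge0.
  rewrite patchE; case: ifPn => [|/negP]; rewrite inE/= in_itv/=; last first.
    move=> /negP; rewrite negb_and -!leNgt => st.
    rewrite integral0_eq// => y _; case/orP: st => [s0|ts].
      have -> : heat_barrier (y, s) = 0 by rewrite /heat_barrier /= ltNge s0.
      by rewrite poweR0r ?mule0// gt_eqF.
    by rewrite G_le0 ?mul0e// subr_le0.
  move=> /andP[s0 st]; have sT : (0 < s < T)%R by apply: st_sT; rewrite s0.
  pose h y := heatS (EFin \o tail s) (y, s) + (H s)%:E * heatS (EFin \o g) (y, s).
  have ht0 z : 0 <= heatS (EFin \o tail s) z.
    by apply: heatS_ge0 => // y; rewrite lee_fin tail_ge0.
  have h0 y : 0 <= h y by rewrite adde_ge0 ?mule_ge0// ?lee_fin ?H_ge0.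
  have msec k : measurable_fun setT k -> (forall y, 0 <= k y) ->
      measurable_fun setT (fun y => heatS k (y, s)).
    move=> mk k0; have m2 : measurable_fun setT (fun y : X => (y, s : measurableTypeR R)).
      by solve_measurable_proj.
    exact: (measurableT_comp (measurable_heatS lam G_ge0 mG mk k0) m2).
  have mt1 : measurable_fun setT (fun y => heatS (EFin \o tail s) (y, s)).
    apply: msec; first exact/measurable_EFinP.
    by move=> y; rewrite lee_fin tail_ge0.
  have mg1 : measurable_fun setT (fun y => heatS (EFin \o g) (y, s)).
    by apply: msec => // y; rewrite lee_fin.
  have mh : measurable_fun setT h.
    by apply: emeasurable_funD => //; exact: measurable_funeM.
  apply: (@le_trans _ _ (heatS (fun y => (2 `^ p * 2 `^ p)%:E * h y) (x, t - s)%R)).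
    apply: ge0_le_integral_any => y _; first by rewrite mule_ge0 ?lee_fin ?poweR_ge0.
    by apply: lee_wpmul2l; rewrite ?lee_fin// barrier_powR_le.
  rewrite heatSZ//; apply: lee_wpmul2l; first by rewrite lee_fin.
  rewrite /h heatSD//; last 2 first.
  - exact: measurable_funeM.
  - by move=> y; rewrite mule_ge0 ?lee_fin ?H_ge0.
  rewrite heatSZ ?H_ge0//.
  have ts0 : (0 < t - s)%R by rewrite subr_gt0.
  have semi k : measurable_fun setT k -> (forall y, 0 <= k y) ->
      heatS (fun y => heatS k (y, s)) (x, t - s)%R <= heatS k (x, t).
    by move=> mk k0; rewrite -[in leRHS](subrK s t); exact: heatS_semigroup.
  apply: leeD.
    apply: semi; first exact/measurable_EFinP.
    by move=> y; rewrite lee_fin tail_ge0.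
  apply: lee_wpmul2l; first by rewrite lee_fin H_ge0.
  by apply: semi => // y; rewrite lee_fin.
have H_ge0' s : `]0%R, t[%classic s -> 0 <= (H s)%:E.
  by rewrite /= in_itv/= => /st_sT sT; rewrite lee_fin H_ge0.
have tS_ge0 s : 0 <= heatS (EFin \o tail s) (x, t).
  by apply: heatS_ge0 => // y; rewrite lee_fin tail_ge0.
rewrite ge0_integralZl//; last 2 first.
- by apply: emeasurable_funD => //; apply: emeasurable_funM.
- by move=> s sI; rewrite adde_ge0// mule_ge0// H_ge0'.
rewrite [(2 `^ p * 2 `^ p * (C1 + C2))%:E]EFinM -[leRHS]muleA.
apply: lee_wpmul2l; first by rewrite lee_fin.
rewrite ge0_integralD//; last 2 first.
- by move=> s sI; rewrite mule_ge0// H_ge0'.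
- exact: emeasurable_funM.
rewrite ge0_integralZr//.
have B0 : 0 <= heat_barrier (x, t).
  have Sf0 : 0 <= heatS (EFin \o f) (x, t) by apply: heatS_ge0 => // y; rewrite lee_fin.
  rewrite /heat_barrier /= t0 adde_ge0// mule_ge0// lee_fin invr_ge0 ltW//.
  exact: rho_gt0.
rewrite [(C1 + C2)%:E]EFinD [leRHS]ge0_muleDl ?lee_fin//; apply: leeD.
  apply: (@le_trans _ _ (C1%:E * heatS (EFin \o f) (x, t))); last first.
    apply: lee_wpmul2l; first by rewrite lee_fin.
    rewrite /heat_barrier /= t0 leeDl// mule_ge0// lee_fin invr_ge0 ltW//.
    exact: rho_gt0.
  pose k (w : X * measurableTypeR R) :=
    (G x w.1 t)%:E * ((tail w.2 w.1) * \1_(`]0%R, t[%classic) w.2)%:E.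
  have k0 w : 0 <= k w by rewrite mule_ge0 ?lee_fin// mulr_ge0// tail_ge0.
  have mk : measurable_fun setT k.
    apply: emeasurable_funM; first exact: (measurableT_comp (mGE x t) measurable_fst).
    apply/measurable_EFinP; apply: measurable_funM.
      have m2 : measurable_fun setT (fun w : X * measurableTypeR R => (w.2, w.1)).
        by solve_measurable_proj.
      exact: (measurableT_comp mtail2 m2).
    have mind : measurable_fun setT (\1_(`]0%R, t[%classic) : measurableTypeR R -> R).
      exact: measurable_indic.
    exact: (measurableT_comp mind measurable_snd).
  rewrite (_ : integral _ _ _ = \int[leb]_s \int[lam]_y k (y, s)); last first.
    rewrite integral_mkcond; apply: eq_integral => s _.
    rewrite patchE /k /=; case: ifPn => sI.
      by apply: eq_integral => y _; rewrite indicE sI mulr1.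
    by rewrite integral0_eq// => y _; rewrite indicE (negbTE sI) mulr0 mule0.
  rewrite -(@fubini_tonelli2 _ _ _ _ _ lam leb k)// fubini_tonelli1//.
  rewrite -heatSZ//; last exact/measurable_EFinP.
  apply: ge0_le_integral_any => y _; first by rewrite integral_ge0.
  have mtI : measurable_fun setT
      (fun s : measurableTypeR R => (tail s y * \1_(`]0%R, t[%classic) s)%:E).
    apply/measurable_EFinP; apply: measurable_funM; last exact: measurable_indic.
    have m2 : measurable_fun setT (fun s : measurableTypeR R => (s, y)).
      by solve_measurable_proj.
    exact: (measurableT_comp mtail2 m2).
  have tI0 s : 0 <= (tail s y * \1_(`]0%R, t[%classic) s)%:E.
    by rewrite lee_fin mulr_ge0// tail_ge0.
  rewrite /fubini_F /k /= ge0_integralZl ?lee_fin//.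
  apply: lee_wpmul2l; first by rewrite lee_fin.
  apply: (@le_trans _ _ (\int[leb]_(s in `[0%R, r y]) (f y `^ p)%:E)).
    rewrite [leRHS]integral_mkcond; apply: ge0_le_integral_any => s _.
      by rewrite lee_fin mulr_ge0// tail_ge0.
    rewrite patchE /tail; case: ifPn => [_|/negP H'].
      rewrite lee_fin -mulrA ler_piMr ?powR_ge0// indicE.
      by case: (s < r y)%R; case: (_ \in _); rewrite ?(mulr1, mulr0).
    rewrite lee_fin -mulrA indicE !mem_setE in_itv/=.
    have [sr|_] := ltP s (r y); last by rewrite mul0r mulr0.
    have [s0|_] := ltP 0%R s; last by rewrite mulr0 mulr0.
    by exfalso; apply: H'; rewrite inE/= in_itv/= !ltW.
  rewrite integral_cst//= lebesgue_measure_itv /= lte_fin.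
  have -> : (if (0 < r y)%R then (r y)%:E - 0%:E else 0) = (r y)%:E.
    have [_|] := ltP 0%R (r y); first by rewrite sube0.
    by move=> ry; congr EFin; apply/eqP; rewrite eq_le r0.
  by rewrite -!EFinM lee_fin f_powR.
apply: (le_trans (lee_wpmul2r (Sg0 _) (int_m tT))).
rewrite EFinM -muleA; apply: lee_wpmul2l; first by rewrite lee_fin.
rewrite /heat_barrier /= t0 leeDr//.
by apply: heatS_ge0 => // y; rewrite lee_fin.
Qed.

End supersolution.

End kernel_existence.

Section lebesgue_tuple_integral.
Local Open Scope ereal_scope.
Context {R : realType}.
Local Notation leb := (@lebesgue_measure R).

Lemma integral_lebesgueTS n (h : n.+1.-tuple R -> \bar R) :
  measurable_fun setT h -> (forall x, 0 <= h x) ->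
  \int[@lebesgueT R n.+1]_x h x =
  \int[leb]_a \int[@lebesgueT R n]_x h (consT (a, x)).
Proof.
move=> mh h0.
transitivity (\int[pushforward (leb \x @lebesgueT R n) (@consT R n)]_x h x) => //.
rewrite ge0_integral_pushforward//; last exact: measurable_consT.
rewrite preimage_setT fubini_tonelli1//.
  exact: (measurableT_comp mh (@measurable_consT R n)).
by move=> x; exact: h0.
Qed.

Lemma integral_lebesgueT0 (h : 0.-tuple R -> \bar R) :
  \int[@lebesgueT R 0]_x h x = h [tuple].
Proof.
rewrite (_ : h = cst (h [tuple])); last by apply/funext => x; rewrite /= (tuple0 x).
by rewrite /= integral_dirac// diracT mul1e.
Qed.

Lemma consT_thead n (x : n.+1.-tuple R) : x = consT (thead x, [tuple of behead x]).
Proof. by rewrite [LHS]tuple_eta; apply: val_inj. Qed.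

Definition cube N (a b : R) : set (N.-tuple R) :=
  [set y | forall i, a <= tnth y i <= b]%R.

Arguments cube N a b : clear implicits.

Lemma measurable_cube N a b : measurable (cube N a b).
Proof.
rewrite (_ : cube N a b = \bigcap_(i in [set: 'I_N]) ((fun y => tnth y i) @^-1` `[a, b])).
  apply: fin_bigcap_measurable => // i _.
  by rewrite -[X in measurable X]setTI; exact: measurable_tnth.
apply/seteqP; split=> y /= H i; first by move=> _; rewrite /= in_itv/=.
by have := H i I; rewrite /= in_itv.
Qed.

Lemma lebesgueT_cube N (a b : R) : (a <= b)%R ->
  lebesgueT N (cube N a b) = ((b - a) ^+ N)%:E.
Proof.
move=> ab; elim: N => [|n IH].
  by rewrite /= diracE expr0 mem_set// => -[].
have mC := @measurable_cube n.+1 a b.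
rewrite -(setIT (cube n.+1 a b)) -integral_indic// integral_lebesgueTS//; last first.
  by apply/measurable_EFinP; exact: measurable_indic.
have E c x : \1_(cube n.+1 a b) (consT (c, x)) =
    (\1_(`[a, b]%classic) c * \1_(cube n a b) x)%R :> R.
  rewrite !indicE -natrM mulnb.
  suff -> : (consT (c, x) \in cube n.+1 a b) =
      (c \in `[a, b]%classic) && (x \in cube n a b) by [].
  apply/idP/andP.
    move=> /set_mem H; split; apply/mem_set => /=.
      by rewrite in_itv /=; have := H ord0; rewrite tnth0.
    by move=> i; have := H (lift ord0 i); rewrite tnthS.
  move=> [/set_mem /= + /set_mem H]; rewrite in_itv /= => H0; apply/mem_set => i.
  by case: (unliftP ord0 i) => [j|] ->; rewrite ?tnthS ?tnth0.
have mIx : measurable_fun setT (fun x => (\1_(cube n a b) x)%:E : \bar R).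
  by apply/measurable_EFinP; apply: measurable_indic; exact: measurable_cube.
have E2 (c : R) : \int[@lebesgueT R n]_x (\1_(cube n.+1 a b) (consT (c, x)))%:E =
    (\1_(`[a, b]%classic) c)%:E * ((b - a) ^+ n)%:E.
  under eq_integral do rewrite E EFinM.
  rewrite ge0_integralZl ?lee_fin//.
  rewrite integral_indic ?setIT//; first by congr (_ * _); exact: IH.
  exact: measurable_cube.
under eq_integral do rewrite E2.
have mIc : measurable_fun setT (fun c => (\1_(`[a, b]%classic) c)%:E : \bar R).
  by apply/measurable_EFinP; exact: measurable_indic.
rewrite ge0_integralZr ?lee_fin ?exprn_ge0 ?subr_ge0//.
rewrite integral_indic// setIT exprS EFinM; congr (_ * _).
apply: etrans (lebesgue_measure_itv _) _; rewrite /= lte_fin.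
have [_|ba] := ltP a b; first by rewrite EFinB.
by congr EFin; apply/eqP; rewrite eq_sym subr_eq0 eq_le ab ba.
Qed.

End lebesgue_tuple_integral.
Arguments cube {R} N a b.

Section gaussian.
Context {R : realType}.
Local Notation leb := (@lebesgue_measure R).
Implicit Types a b c t s : R.

Definition gauss1 a t := (4 * pi * t) `^ (- 2^-1) * expR (- (a ^+ 2 / (4 * t))).

Lemma gauss1_ge0 a t : 0 <= gauss1 a t.
Proof. by rewrite mulr_ge0 ?powR_ge0 ?expR_ge0. Qed.

Lemma gauss1N a t : gauss1 (- a) t = gauss1 a t.
Proof. by rewrite /gauss1 sqrrN. Qed.

Lemma gauss1_normal_pdf a b t : 0 < t ->
  gauss1 (a - b) t = normal_pdf b (Num.sqrt (2 * t)) a.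
Proof.
move=> t0; have t20 : 0 < 2 * t by rewrite mulr_gt0.
rewrite normal_pdfE ?gt_eqF ?sqrtr_gt0// /gauss1 /normal_peak /normal_fun /=.
rewrite sqr_sqrtr ?ltW//.
have -> : 2 * t * pi *+ 2 = 4 * pi * t by ring.
rewrite powRN powR12_sqrt; last by rewrite !mulr_ge0 ?pi_ge0// ltW.
by congr (_ * expR _); rewrite mulNr; congr (- (_ / _)); ring.
Qed.

Lemma integral_gauss1 b t : 0 < t -> (\int[leb]_a (gauss1 (b - a) t)%:E = 1)%E.
Proof.
move=> t0; under eq_integral do rewrite -gauss1N opprB gauss1_normal_pdf//.
exact: integral_normal_pdf.
Qed.

Lemma measurable_gauss1 : measurable_fun setT (fun z : R * R => gauss1 z.1 z.2).
Proof.
apply: measurable_funM.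
  apply: (measurableT_comp (measurable_powR _)).
  by apply: measurable_funM => //; exact: measurable_snd.
apply: (measurableT_comp (@measurable_expR R)).
apply: (measurableT_comp (@oppr_measurable R setT)).
apply: measurable_funM; first by apply: measurable_funX; exact: measurable_fst.
apply: (measurableT_comp measurable_invr).
by apply: measurable_funM => //; exact: measurable_snd.
Qed.

Lemma measurable_gauss1l b t : measurable_fun setT (fun a => gauss1 (b - a) t).
Proof.
have m : measurable_fun setT (fun a : R => (b - a, t) : R * R).
  by apply: measurable_fun_pair => //; exact: measurable_funB.
exact: (measurableT_comp measurable_gauss1 m).
Qed.

Lemma gauss1_mul a b c t s : 0 < t -> 0 < s ->
  gauss1 (a - c) t * gauss1 (c - b) s =
  gauss1 (a - b) (t + s) * gauss1 ((a * s + b * t) / (t + s) - c) (t * s / (t + s)).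
Proof.
move=> t0 s0; have ts0 : 0 < t + s by rewrite addr_gt0.
have p0 := @pi_gt0 R.
have nn u : 0 < u -> 0 <= 4 * pi * u by move=> u0; rewrite !mulr_ge0 ?pi_ge0 ?ltW.
have tau0 : 0 < t * s / (t + s) by rewrite divr_gt0// mulr_gt0.
rewrite /gauss1 mulrACA [RHS]mulrACA -!expRD -!powRM ?nn//.
congr (_ `^ _ * expR _); first by field; rewrite gt_eqF.
by field; rewrite !gt_eqF.
Qed.

Lemma gauss1_convolution a b t s : 0 < t -> 0 < s ->
  (\int[leb]_c (gauss1 (a - c) t * gauss1 (c - b) s)%:E = (gauss1 (a - b) (t + s))%:E)%E.
Proof.
move=> t0 s0; under eq_integral do rewrite gauss1_mul// EFinM.
have ts0 : 0 < t * s / (t + s) by rewrite divr_gt0 ?mulr_gt0 ?addr_gt0.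
rewrite ge0_integralZl ?lee_fin ?gauss1_ge0//; last 2 first.
- by apply/measurable_EFinP; exact: measurable_gauss1l.
- by move=> c _; rewrite lee_fin gauss1_ge0.
by rewrite integral_gauss1// mule1.
Qed.

End gaussian.

Section half_line.
Context {R : realType}.
Local Notation leb := (@lebesgue_measure R).
Implicit Types a b c t s : R.

Lemma integral_fold (F : R -> R) : measurable_fun setT F -> (forall c, 0 <= F c) ->
  (\int[leb]_c (F c)%:E = \int[leb]_(c in `]0%R, +oo[) (F c + F (- c))%:E)%E.
Proof.
move=> mF F0.
have mFN : measurable_fun setT (fun c => F (- c)).
  exact: (measurableT_comp mF (@oppr_measurable R setT)).
have mFE : measurable_fun setT (EFin \o F) by exact/measurable_EFinP.
have mFNE : measurable_fun setT (fun c => (F (- c))%:E) by exact/measurable_EFinP.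
under [RHS]eq_integral do rewrite EFinD.
rewrite ge0_integralD//; last 4 first.
- by move=> c _; rewrite lee_fin.
- exact: measurable_funTS.
- by move=> c _; rewrite lee_fin.
- exact: measurable_funTS.
rewrite -[X in integral _ X _](setUv (`]0%R, +oo[%classic : set R)).
rewrite ge0_integral_setU//=; last 4 first.
- exact: measurableC.
- by rewrite setUv.
- by move=> c _; rewrite lee_fin.
- exact/disj_setPCl.
congr (_ + _)%E; rewrite setCitvr.
rewrite [RHS]integral_itv_obnd_cbnd; last exact: measurable_funTS.
rewrite (@ge0_integration_by_substitution0 R (fun c => (F (- c))%:E))//.
  by apply: eq_integral => c _; rewrite opprK.
by move=> c; rewrite lee_fin.
Qed.

Definition dirichlet1 a b t := gauss1 (a - b) t - gauss1 (a + b) t.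

Lemma dirichlet1_ge0 a b t : 0 <= a -> 0 <= b -> 0 < t -> 0 <= dirichlet1 a b t.
Proof.
move=> a0 b0 t0; rewrite subr_ge0 ler_wpM2l ?powR_ge0// ler_expR lerN2.
rewrite ler_wpM2r ?invr_ge0 ?mulr_ge0 ?(ltW t0)//.
have := mulr_ge0 a0 b0; nra.
Qed.

Lemma dirichlet1_convolution a b t s : 0 < a -> 0 < b -> 0 < t -> 0 < s ->
  (\int[leb]_(c in `]0%R, +oo[) (dirichlet1 a c t * dirichlet1 c b s)%:E
    = (dirichlet1 a b (t + s))%:E)%E.
Proof.
move=> a0 b0 t0 s0.
have mg (u v : R -> R) : measurable_fun setT u -> measurable_fun setT v ->
    measurable_fun setT (fun c => gauss1 (u c) t * gauss1 (v c) s).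
  move=> mu mv; apply: measurable_funM.
    have m : measurable_fun setT (fun c : R => (u c, t) : R * R).
      exact: measurable_fun_pair.
    exact: (measurableT_comp (@measurable_gauss1 R) m).
  have m : measurable_fun setT (fun c : R => (v c, s) : R * R).
    exact: measurable_fun_pair.
  exact: (measurableT_comp (@measurable_gauss1 R) m).
have mm c0 : measurable_fun setT (fun c : R => c0 - c) by exact: measurable_funB.
have mp c0 : measurable_fun setT (fun c : R => c0 + c) by exact: measurable_funD.
have mp' c0 : measurable_fun setT (fun c : R => c + c0) by exact: measurable_funD.
have mm' c0 : measurable_fun setT (fun c : R => c - c0) by exact: measurable_funB.
pose P c := dirichlet1 a c t * dirichlet1 c b s.
pose Q c := gauss1 (a - c) t * gauss1 (c + b) s + gauss1 (a + c) t * gauss1 (c - b) s.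
pose S c := gauss1 (a - c) t * gauss1 (c - b) s + gauss1 (a + c) t * gauss1 (c + b) s.
have intS : (\int[leb]_(c in `]0%R, +oo[) (S c)%:E = (gauss1 (a - b) (t + s))%:E)%E.
  rewrite -gauss1_convolution// integral_fold.
  - by apply: eq_integral => c _; rewrite opprK -[gauss1 (- c - b) s]gauss1N opprB opprK [b + c]addrC.
  - exact: mg.
  - by move=> c; rewrite mulr_ge0 ?gauss1_ge0.
have intQ : (\int[leb]_(c in `]0%R, +oo[) (Q c)%:E = (gauss1 (a + b) (t + s))%:E)%E.
  rewrite -[in RHS](opprK b) -gauss1_convolution// integral_fold.
  - by apply: eq_integral => c _; rewrite !opprK -[gauss1 (- c + b) s]gauss1N opprD opprK.
  - by rewrite opprK; exact: mg.
  - by move=> c; rewrite mulr_ge0 ?gauss1_ge0.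
have mQ : measurable_fun setT Q by apply: measurable_funD; exact: mg.
have mP : measurable_fun setT P.
  rewrite (_ : P = fun c => S c - Q c).
    by apply: measurable_funB => //; apply: measurable_funD; exact: mg.
  by apply/funext => c; rewrite /P /S /Q /dirichlet1; ring.
have : (\int[leb]_(c in `]0%R, +oo[) (P c)%:E + (gauss1 (a + b) (t + s))%:E =
    (gauss1 (a - b) (t + s))%:E)%E.
  rewrite -intQ -intS -ge0_integralD//; last 4 first.
  - move=> c; rewrite /= in_itv/= andbT => c0.
    by rewrite lee_fin mulr_ge0 ?dirichlet1_ge0// ltW.
  - by apply: measurable_funTS; exact/measurable_EFinP.
  - by move=> c _; rewrite lee_fin /Q addr_ge0// mulr_ge0// gauss1_ge0.
  - by apply: measurable_funTS; exact/measurable_EFinP.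
  apply: eq_integral => c _; rewrite -EFinD; congr EFin.
  by rewrite /P /S /Q /dirichlet1; ring.
rewrite -/P /dirichlet1; case: (integral _ _ _) => [v| |]//= [vE].
by congr EFin; rewrite -vE addrK.
Qed.

End half_line.

Section half_space_kernel.
Context {R : realType}.
Implicit Types t s : R.

Definition dkernel N (x y : N.-tuple R) t : R :=
  if [&& 0 < lastc x, 0 < lastc y & 0 < t] then heatG x y t else 0.

Lemma enorm_sqr N (x : N.-tuple R) : enorm x ^+ 2 = \sum_(i < N) tnth x i ^+ 2.
Proof. by rewrite sqr_sqrtr// sumr_ge0// => i _; exact: sqr_ge0. Qed.

Lemma Gamma_ge0 N (x : N.-tuple R) t : 0 <= Gamma x t.
Proof. by rewrite mulr_ge0 ?powR_ge0 ?expR_ge0. Qed.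

Lemma heatG_ge0 N (x y : N.-tuple R) t : 0 <= lastc x -> 0 <= lastc y -> 0 < t ->
  0 <= heatG x y t.
Proof.
move=> x0 y0 t0; rewrite mulr_ge0 ?Gamma_ge0// subr_ge0 -expR0 ler_expR oppr_le0.
by rewrite divr_ge0 ?mulr_ge0// ltW.
Qed.

Lemma dkernel_ge0 N (x y : N.-tuple R) t : 0 <= dkernel x y t.
Proof.
by rewrite /dkernel; case: ifP => // /and3P[x0 y0 t0]; rewrite heatG_ge0// ltW.
Qed.

Lemma dkernel_le0 N (x y : N.-tuple R) t : t <= 0 -> dkernel x y t = 0.
Proof. by move=> t0; rewrite /dkernel [0 < t]ltNge t0 !andbF. Qed.

Lemma dkernelE N (x y : N.-tuple R) t : 0 < lastc x -> 0 < lastc y -> 0 < t ->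
  dkernel x y t = heatG x y t.
Proof. by move=> x0 y0 t0; rewrite /dkernel x0 y0 t0. Qed.

Lemma dkernel_le_Gamma N (x y : N.-tuple R) t : dkernel x y t <= Gamma (subT x y) t.
Proof.
rewrite /dkernel; case: ifP => [_|_]; last exact: Gamma_ge0.
by rewrite ler_piMr ?Gamma_ge0// lerBlDr lerDl expR_ge0.
Qed.

Lemma measurable_dkernel N : measurable_fun setT
  (fun z : (N.-tuple R * N.-tuple R) * measurableTypeR R => dkernel z.1.1 z.1.2 z.2).
Proof.
have mt : measurable_fun setT
    (fun z : (N.-tuple R * N.-tuple R) * measurableTypeR R => z.2 : R).
  exact: measurable_snd.
have ml1 : measurable_fun setT
    (fun z : (N.-tuple R * N.-tuple R) * measurableTypeR R => lastc z.1.1).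
  by apply: (measurableT_comp (@measurable_lastc R N)); solve_measurable_proj.
have ml2 : measurable_fun setT
    (fun z : (N.-tuple R * N.-tuple R) * measurableTypeR R => lastc z.1.2).
  by apply: (measurableT_comp (@measurable_lastc R N)); solve_measurable_proj.
apply: measurable_fun_ifT => //.
  by apply: measurable_and; [|apply: measurable_and]; exact: measurable_fun_ltr.
apply: measurable_funM; last first.
  apply: measurable_funB => //; apply: (measurableT_comp (@measurable_expR R)).
  apply: (measurableT_comp (@oppr_measurable R setT)).
  apply: measurable_funM; first exact: measurable_funM.
  exact: (measurableT_comp measurable_invr).
apply: measurable_funM.
  apply: (measurableT_comp (measurable_powR _)).
  exact: measurable_funM.
apply: (measurableT_comp (@measurable_expR R)).
apply: (measurableT_comp (@oppr_measurable R setT)).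
apply: measurable_funM; last first.
  apply: (measurableT_comp measurable_invr).
  exact: measurable_funM.
rewrite (_ : (fun z => _) = fun z : (N.-tuple R * N.-tuple R) * measurableTypeR R =>
  \sum_(i < N) (tnth z.1.1 i - tnth z.1.2 i) ^+ 2); last first.
  apply/funext => z; rewrite enorm_sqr; apply: eq_bigr => i _.
  by rewrite tnth_mktuple.
apply: measurable_sum => i; apply: measurable_funX; apply: measurable_funB.
  by apply: (measurableT_comp (@measurable_tnth _ _ N i)); solve_measurable_proj.
by apply: (measurableT_comp (@measurable_tnth _ _ N i)); solve_measurable_proj.
Qed.

Lemma Gamma_consT N (x y : N.-tuple R) (a b t : R) : 0 < t ->
  Gamma (subT (consT (a, x)) (consT (b, y))) t = gauss1 (a - b) t * Gamma (subT x y) t.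
Proof.
move=> t0; rewrite /Gamma /gauss1 mulrACA -expRD -powRD; last first.
  by apply/implyP => _; rewrite gt_eqF// !mulr_gt0// pi_gt0.
congr (_ `^ _ * expR _); first by rewrite -natr1; field.
rewrite !enorm_sqr big_ord_recl -opprD -mulrDl; congr (- (_ / _)).
congr (_ + _); first by rewrite tnth_mktuple !tnth0.
by apply: eq_bigr => i _; rewrite !tnth_mktuple !tnthS.
Qed.

Lemma Gamma0 (x : 0.-tuple R) t : Gamma x t = 1.
Proof. by rewrite /Gamma enorm_sqr big_ord0 mul0r oppr0 powRr0 mul0r oppr0 expR0 mulr1. Qed.

Lemma lastc_consT N (x : N.+1.-tuple R) (a : R) : lastc (consT (a, x)) = lastc x.
Proof. by []. Qed.

Lemma heatG_consT N (x y : N.+1.-tuple R) (a b t : R) : 0 < t ->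
  heatG (consT (a, x)) (consT (b, y)) t = gauss1 (a - b) t * heatG x y t.
Proof. by move=> t0; rewrite /heatG Gamma_consT// !lastc_consT mulrA. Qed.

Lemma heatG1 (x y : 0.-tuple R) (a b t : R) : 0 < t ->
  heatG (consT (a, x)) (consT (b, y)) t = dirichlet1 a b t.
Proof.
move=> t0; rewrite /heatG Gamma_consT// Gamma0 mulr1 /lastc /= /dirichlet1 /gauss1.
rewrite mulrBr mulr1 -[_ * expR _ * expR _]mulrA -expRD; congr (_ - _ * expR _).
by field; rewrite gt_eqF.
Qed.

Lemma dkernel_consT N (x y : N.+1.-tuple R) (a b t : R) :
  dkernel (consT (a, x)) (consT (b, y)) t = gauss1 (a - b) t * dkernel x y t.
Proof.
rewrite /dkernel !lastc_consT; case: ifP => [/and3P[x0 y0 t0]|_]; last by rewrite mulr0.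
exact: heatG_consT.
Qed.

Lemma measurable_Gamma_subT N (x : N.-tuple R) t :
  measurable_fun setT (fun y => Gamma (subT x y) t).
Proof.
apply: measurable_funM => //; apply: (measurableT_comp (@measurable_expR R)).
apply: (measurableT_comp (@oppr_measurable R setT)); apply: measurable_funM => //.
rewrite (_ : (fun y => _) = fun y => \sum_(i < N) (tnth x i - tnth y i) ^+ 2)%R.
  apply: measurable_sum => i; apply: measurable_funX; apply: measurable_funB => //.
  exact: measurable_tnth.
by apply/funext => y; rewrite enorm_sqr; apply: eq_bigr => i _; rewrite tnth_mktuple.
Qed.

Let mdk N (x : N.-tuple R) t : measurable_fun setT (fun y => dkernel x y t).
Proof.
have m : measurable_fun setT (fun y : N.-tuple R => ((x, y), t : measurableTypeR R)).
  by solve_measurable_proj.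
exact: (measurableT_comp (@measurable_dkernel N) m).
Qed.

Let mdk' N (y : N.-tuple R) t : measurable_fun setT (fun x => dkernel x y t).
Proof.
have m : measurable_fun setT (fun x : N.-tuple R => ((x, y), t : measurableTypeR R)).
  by solve_measurable_proj.
exact: (measurableT_comp (@measurable_dkernel N) m).
Qed.

Local Open Scope ereal_scope.

Lemma integral_dkernel_le1 N (x : N.-tuple R) t :
  \int[@lebesgueT R N]_y (dkernel x y t)%:E <= 1.
Proof.
have [t0|t0] := ltP 0%R t; last first.
  by rewrite integral0_eq// => y _; rewrite dkernel_le0.
have mG n (x' : n.-tuple R) := measurable_Gamma_subT x' t.
apply: (@le_trans _ _ (\int[@lebesgueT R N]_y (Gamma (subT x y) t)%:E)).
  apply: ge0_le_integral_any => y _; first by rewrite lee_fin dkernel_ge0.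
  by rewrite lee_fin dkernel_le_Gamma.
suff -> : \int[@lebesgueT R N]_y (Gamma (subT x y) t)%:E = 1 by [].
elim: N x => [|n IH] x.
  by rewrite integral_lebesgueT0 Gamma0.
rewrite integral_lebesgueTS; last 2 first.
- by apply/measurable_EFinP; exact: mG.
- by move=> y; rewrite lee_fin Gamma_ge0.
rewrite (consT_thead x); under eq_integral => b _.
  under eq_integral do rewrite Gamma_consT// EFinM.
  rewrite ge0_integralZl ?lee_fin ?gauss1_ge0//; first rewrite IH mule1; first over.
  - by apply/measurable_EFinP; exact: mG.
  - by move=> y _; rewrite lee_fin Gamma_ge0.
by rewrite integral_gauss1.
Qed.

Lemma dkernel_semigroup N (x y : N.+1.-tuple R) t s : (0 < t)%R -> (0 < s)%R ->
  \int[@lebesgueT R N.+1]_z (dkernel x z t * dkernel z y s)%:E <=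
  (dkernel x y (t + s))%:E.
Proof.
move=> t0 s0; have ts0 : (0 < t + s)%R by exact: addr_gt0.
have mdd n (x' y' : n.-tuple R) : measurable_fun setT
    (fun z => (dkernel x' z t * dkernel z y' s)%:E).
  by apply/measurable_EFinP; apply: measurable_funM; [exact: mdk|exact: mdk'].
elim: N x y => [|n IH] x y.
  rewrite (consT_thead x) (consT_thead y) integral_lebesgueTS//; last first.
    by move=> z; rewrite lee_fin mulr_ge0 ?dkernel_ge0.
  set a := thead x; set b := thead y.
  under eq_integral => c _ do rewrite integral_lebesgueT0.
  have [a0|a0] := ltP 0%R a; last first.
    rewrite integral0_eq ?lee_fin ?dkernel_ge0// => c _.
    by rewrite {1}/dkernel [lastc _]/= ltNge a0 /= mul0r.
  have [b0|b0] := ltP 0%R b; last first.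
    rewrite integral0_eq ?lee_fin ?dkernel_ge0// => c _.
    by rewrite {2}/dkernel [lastc (consT (b, _))]/= [(0 < b)%R]ltNge b0 /= andbF mulr0.
  rewrite dkernelE// heatG1// -dirichlet1_convolution// [leRHS]integral_mkcond.
  apply: ge0_le_integral_any => c _; first by rewrite lee_fin mulr_ge0 ?dkernel_ge0.
  rewrite patchE mem_setE in_itv/= andbT; case: ifPn => [c0|].
    by rewrite !dkernelE// !heatG1.
  by rewrite -leNgt => c0; rewrite {1}/dkernel [lastc (consT (c, _))]/= [(0 < c)%R]ltNge c0 /= andbF mul0r.
rewrite (consT_thead x) (consT_thead y) integral_lebesgueTS//; last first.
  by move=> z; rewrite lee_fin mulr_ge0 ?dkernel_ge0.
set a := thead x; set b := thead y.
rewrite dkernel_consT EFinM -gauss1_convolution// -ge0_integralZr ?lee_fin ?dkernel_ge0//; last 2 first.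
- apply/measurable_EFinP; apply: measurable_funM; [exact: measurable_gauss1l|].
  under eq_fun do rewrite -gauss1N opprB; exact: measurable_gauss1l.
- by move=> c _; rewrite lee_fin mulr_ge0 ?gauss1_ge0.
apply: ge0_le_integral_any => c _.
  by apply: integral_ge0 => z _; rewrite lee_fin mulr_ge0 ?dkernel_ge0.
have gg0 : (0 <= gauss1 (a - c) t * gauss1 (c - b) s)%R.
  by rewrite mulr_ge0 ?gauss1_ge0.
under eq_integral do rewrite !dkernel_consT mulrACA EFinM.
rewrite ge0_integralZl ?lee_fin//; last 2 first.
- exact: mdd.
- by move=> z _; rewrite lee_fin mulr_ge0 ?dkernel_ge0.
by apply: lee_wpmul2l; rewrite ?lee_fin//; exact: IH.
Qed.

End half_space_kernel.

Section kernel_bounds.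
Context {R : realType}.
Implicit Types t s : R.

Lemma gaussian_edge_le (a b : R) : 0 <= a -> 0 <= b ->
  expR (- ((a - b) ^+ 2 / 4)) * (1 - expR (- (a * b))) <= 2 * b.
Proof.
move=> a0 b0; have ab0 := mulr_ge0 a0 b0.
have e1 : expR (- ((a - b) ^+ 2 / 4)) <= 1.
  by rewrite -expR0 ler_expR oppr_le0 divr_ge0 ?sqr_ge0.
have f1 : 1 - expR (- (a * b)) <= a * b by have := expR_ge1Dx (- (a * b)); lra.
have f0 : 0 <= 1 - expR (- (a * b)) by rewrite subr_ge0 -expR0 ler_expR oppr_le0.
have [b1|b1] := leP 1 b.
  have : 1 - expR (- (a * b)) <= 1 by rewrite lerBlDr lerDl expR_ge0.
  have := expR_ge0 (- ((a - b) ^+ 2 / 4)); nra.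
have h : expR (- ((a - b) ^+ 2 / 4)) * a <= 2.
  rewrite expRN mulrC ler_pdivrMr ?expR_gt0//.
  have := expR_ge1Dx ((a - b) ^+ 2 / 4); have := sqr_ge0 (a - b - 2); nra.
apply: (@le_trans _ _ (expR (- ((a - b) ^+ 2 / 4)) * (a * b))).
  by rewrite ler_wpM2l ?expR_ge0.
by rewrite mulrA ler_wpM2r.
Qed.

Lemma lastc_tnth N (x : N.+1.-tuple R) : lastc x = tnth x ord_max.
Proof. by rewrite /lastc (tnth_nth 0). Qed.

Lemma sqr_tnth_le_enorm N (x : N.-tuple R) i : tnth x i ^+ 2 <= enorm x ^+ 2.
Proof. by rewrite enorm_sqr (bigD1 i)//= lerDl sumr_ge0// => j _; exact: sqr_ge0. Qed.

Lemma powR_half_nat t n : 0 <= t -> t `^ (n%:R / 2) = Num.sqrt t ^+ n.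
Proof. by move=> t0; rewrite mulrC powRrM powR12_sqrt// powR_mulrn. Qed.

Lemma dkernel_le N (x y : N.+1.-tuple R) t : 0 < t -> 0 < lastc y ->
  dkernel x y t <= 2 * t `^ (- (N.+2%:R / 2)) * lastc y.
Proof.
move=> t0 y0; rewrite /dkernel y0 t0 !andbT; case: ifPn => [x0|_]; last first.
  by rewrite !mulr_ge0 ?powR_ge0// ltW.
have st0 : 0 < Num.sqrt t by rewrite sqrtr_gt0.
have st2 : Num.sqrt t * Num.sqrt t = t by rewrite -expr2 sqr_sqrtr// ltW.
pose a := lastc x / Num.sqrt t; pose b := lastc y / Num.sqrt t.
have a0 : 0 <= a by rewrite divr_ge0// ltW.
have b0 : 0 <= b by rewrite divr_ge0// ltW.
have P4 : (4 * pi * t) `^ (- (N.+1%:R / 2)) <= t `^ (- (N.+1%:R / 2)).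
  have pi4 : 1 <= 4 * pi :> R by have := @pi_ge2 R; lra.
  rewrite !powRN lef_pV2 ?posrE ?powR_gt0 ?mulr_gt0 ?pi_gt0//.
  apply: ge0_ler_powR; rewrite ?nnegrE ?divr_ge0// ?mulr_ge0 ?pi_ge0 ?(ltW t0)//.
  by rewrite ler_peMl// ltW.
have E : heatG x y t <= t `^ (- (N.+1%:R / 2)) *
    (expR (- ((a - b) ^+ 2 / 4)) * (1 - expR (- (a * b)))).
  rewrite /heatG /Gamma -mulrA.
  have -> : lastc x * lastc y / t = a * b.
    by rewrite /a /b mulf_div st2.
  have f0 : 0 <= 1 - expR (- (a * b)).
    by rewrite subr_ge0 -expR0 ler_expR oppr_le0 mulr_ge0.
  apply: ler_pM => //; first exact: powR_ge0.
    by rewrite mulr_ge0 ?expR_ge0.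
  rewrite ler_wpM2r// ler_expR lerN2.
  rewrite (_ : (a - b) ^+ 2 / 4 = (lastc x - lastc y) ^+ 2 / (4 * t)); last first.
    by rewrite /a /b -mulrBl exprMn exprVn sqr_sqrtr ?(ltW t0)// invfM mulrA mulrAC.
  rewrite ler_wpM2r ?invr_ge0 ?mulr_ge0 ?(ltW t0)//.
  by have := sqr_tnth_le_enorm (subT x y) ord_max; rewrite tnth_mktuple -!lastc_tnth.
apply: (le_trans E); apply: (@le_trans _ _ (t `^ (- (N.+1%:R / 2)) * (2 * b))).
  by rewrite ler_wpM2l ?powR_ge0// gaussian_edge_le.
rewrite le_eqVlt; apply/orP; left; apply/eqP.
rewrite !powRN !powR_half_nat ?(ltW t0)// /b [_ ^+ N.+2]exprSr invfM.
by rewrite !mulrA [2 * _]mulrC -!mulrA; congr (_ * (_ * _)); rewrite mulrC.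
Qed.

Definition cube_cst N : R := (4 * pi) `^ (- (N.+1%:R / 2)) * expR (- (2 * N.+1%:R)) / 2.

Lemma cube_cst_gt0 N : 0 < cube_cst N.
Proof. by rewrite divr_gt0// mulr_gt0 ?expR_gt0// powR_gt0// mulr_gt0// pi_gt0. Qed.

Definition scube N t : set (N.-tuple R) := cube N (Num.sqrt t) (2 * Num.sqrt t).
Arguments scube N t : clear implicits.

Lemma scube_lastc N (x : N.+1.-tuple R) t : 0 < t -> scube N.+1 t x -> 0 < lastc x.
Proof.
move=> t0 /(_ ord_max) /andP[h _]; rewrite lastc_tnth; apply: lt_le_trans h.
by rewrite sqrtr_gt0.
Qed.

Lemma dkernel_scube_ge N (x y : N.+1.-tuple R) t s tau :
  0 < s -> s <= t -> t / 2 <= tau -> tau <= t ->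
  scube N.+1 t x -> scube N.+1 s y ->
  cube_cst N * (t `^ (- (N.+1%:R / 2)) * Num.sqrt (s / t)) <= dkernel x y tau.
Proof.
move=> s0 st ttau taut xt ys; have t0 : 0 < t by exact: lt_le_trans st.
have tau0 : 0 < tau by apply: lt_le_trans ttau; rewrite divr_gt0.
have x0 := scube_lastc t0 xt; have y0 := scube_lastc s0 ys.
have st0 : 0 < Num.sqrt t by rewrite sqrtr_gt0.
have ss0 : 0 < Num.sqrt s by rewrite sqrtr_gt0.
have sst : Num.sqrt s <= Num.sqrt t by rewrite ler_sqrt// ltW.
have st2 : Num.sqrt t ^+ 2 = t by rewrite sqr_sqrtr// ltW.
rewrite dkernelE// /heatG /cube_cst.
have Gge : (4 * pi) `^ (- (N.+1%:R / 2)) * expR (- (2 * N.+1%:R)) * t `^ (- (N.+1%:R / 2))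
    <= Gamma (subT x y) tau.
  rewrite mulrAC -powRM ?mulr_ge0 ?pi_ge0 ?(ltW t0)//.
  apply: ler_pM; rewrite ?powR_ge0 ?expR_ge0//.
    rewrite !powRN lef_pV2 ?posrE ?powR_gt0 ?mulr_gt0 ?pi_gt0//.
    apply: ge0_ler_powR; rewrite ?nnegrE ?divr_ge0 ?mulr_ge0 ?pi_ge0 ?(ltW t0) ?(ltW tau0)//.
    by rewrite ler_wpM2l// mulr_ge0// pi_ge0.
  rewrite ler_expR lerN2 ler_pdivrMr ?mulr_gt0//.
  apply: (@le_trans _ _ (\sum_(i < N.+1) 4 * t)).
    rewrite enorm_sqr; apply: ler_sum => i _; rewrite tnth_mktuple.
    have /andP[x1 x2] := xt i; have /andP[y1 y2] := ys i.
    by rewrite -st2; nra.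
  rewrite sumr_const card_ord -mulr_natl.
  have : 0 <= N.+1%:R :> R by [].
  nra.
pose r := Num.sqrt (s / t).
have rE : r = Num.sqrt s / Num.sqrt t by rewrite /r sqrtrM ?(ltW s0)// sqrtrV// ltW.
have r0 : 0 <= r by exact: sqrtr_ge0.
have r1 : r <= 1 by rewrite rE ler_pdivrMr// mul1r.
have rz : r <= lastc x * lastc y / tau.
  rewrite ler_pdivlMr// rE.
  have /andP[x1 _] := xt ord_max; have /andP[y1 _] := ys ord_max.
  rewrite -!lastc_tnth in x1 y1.
  apply: (@le_trans _ _ (Num.sqrt s / Num.sqrt t * t)).
    by rewrite ler_wpM2l// divr_ge0// ltW.
  rewrite -[X in _ * X]st2 expr2 mulrA divfK ?gt_eqF// mulrC.
  by apply: ler_pM => //; exact: ltW.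
have er : expR (- r) <= 1 - r / 2.
  rewrite expRN -[leLHS]mul1r ler_pdivrMr ?expR_gt0//.
  have := expR_ge1Dx r; nra.
have h : r / 2 <= 1 - expR (- (lastc x * lastc y / tau)).
  have : expR (- (lastc x * lastc y / tau)) <= expR (- r) by rewrite ler_expR lerN2.
  lra.
rewrite -/r.
rewrite (_ : _ * _ = (4 * pi) `^ (- (N.+1%:R / 2)) * expR (- (2 * N.+1%:R)) *
  t `^ (- (N.+1%:R / 2)) * (r / 2)); last by ring.
apply: ler_pM => //; last by rewrite divr_ge0.
by rewrite !mulr_ge0 ?powR_ge0 ?expR_ge0.
Qed.

Lemma heatS_scube_ge N (x : N.+1.-tuple R) t s tau :
  0 < s -> s <= t -> t / 2 <= tau -> tau <= t -> scube N.+1 t x ->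
  ((cube_cst N * (t `^ (- (N.+2%:R / 2)) * s `^ (N.+2%:R / 2)))%:E <=
   heatS (@lebesgueT R N.+1) (@dkernel R N.+1)
     (fun y => (\1_(scube N.+1 s) y)%:E) (x, tau))%E.
Proof.
move=> s0 st ttau taut xt; have t0 : 0 < t by exact: lt_le_trans st.
have ss0 : 0 <= Num.sqrt s by exact: sqrtr_ge0.
pose k := cube_cst N * (t `^ (- (N.+1%:R / 2)) * Num.sqrt (s / t)).
have k0 : 0 <= k by rewrite !mulr_ge0 ?powR_ge0 ?sqrtr_ge0// ltW// cube_cst_gt0.
apply: (@le_trans _ _ (\int[@lebesgueT R N.+1]_y (k%:E * (\1_(scube N.+1 s) y)%:E))%E).
  rewrite ge0_integralZl ?lee_fin//; last first.
    by apply/measurable_EFinP; apply: measurable_indic; exact: measurable_cube.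
  rewrite integral_indic ?setIT//; last exact: measurable_cube.
  rewrite [X in (_ * X)%E](lebesgueT_cube N.+1 (_ : Num.sqrt s <= 2 * Num.sqrt s)); last first.
    by rewrite ler_peMl// ler1n.
  rewrite -EFinM lee_fin (_ : 2 * _ - _ = Num.sqrt s); last by ring.
  rewrite /k -[leRHS]mulrA ler_wpM2l ?(ltW (cube_cst_gt0 N))//.
  rewrite !powRN !powR_half_nat ?(ltW t0) ?(ltW s0)// sqrtrM ?(ltW s0)// sqrtrV ?(ltW t0)//.
  rewrite !exprSr !invfM.
  by rewrite le_eqVlt; apply/orP; left; apply/eqP; ring.
apply: ge0_le_integral_any => y _; first by rewrite mule_ge0 ?lee_fin.
rewrite -!EFinM lee_fin indicE; case: (boolP (y \in scube N.+1 s)) => [/set_mem ys|_].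
  by rewrite !mulr1; exact: dkernel_scube_ge.
by rewrite !mulr0.
Qed.

End kernel_bounds.
Arguments scube {R} N t.

Section primitives.
Context {R : realType}.
Implicit Types s t a T c : R.
Local Notation leb := (@lebesgue_measure R).

Lemma integral_derive (Phi phi : R -> R) T a t : 0 < a -> a < t -> t < T ->
  (forall s, 0 < s < T -> is_derive s 1 Phi (phi s)) ->
  (forall s, 0 < s < T -> {for s, continuous phi}) ->
  (\int[leb]_(s in `[a, t]) (phi s)%:E = (Phi t)%:E - (Phi a)%:E)%E.
Proof.
move=> a0 at_ tT dPhi cphi.
have cPhi s : 0 < s < T -> {for s, continuous Phi}.
  move=> sT; apply: differentiable_continuous; apply/derivable1_diffP.
  by have [] := dPhi _ sT.
have inT s : a <= s -> s <= t -> 0 < s < T.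
  by move=> as_ st; rewrite (lt_le_trans a0 as_) (le_lt_trans st tT).
apply: continuous_FTC2 => //.
- apply: continuous_in_subspaceT => s; rewrite inE/= in_itv/= => /andP[as_ st].
  by apply: cphi; exact: inT.
- split.
  + move=> s; rewrite in_itv/= => /andP[as_ st].
    by have [] := dPhi _ (inT _ (ltW as_) (ltW st)).
  + by apply: cvg_at_right_filter; apply: cPhi; apply: inT => //; exact: ltW.
  + by apply: cvg_at_left_filter; apply: cPhi; apply: inT => //; exact: ltW.
- move=> s; rewrite in_itv/= => /andP[as_ st].
  by rewrite derive1E; have [_ ->] := dPhi _ (inT _ (ltW as_) (ltW st)).
Qed.

Lemma integral_derive_le (Phi phi : R -> R) T t : 0 < t -> t < T ->
  (forall s, 0 < s < T -> is_derive s 1 Phi (phi s)) ->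
  (forall s, 0 < s < T -> {for s, continuous phi}) ->
  (forall s, 0 < s < T -> 0 <= phi s) -> (forall s, 0 < s < T -> 0 <= Phi s) ->
  measurable_fun setT phi ->
  (\int[leb]_(s in `]0%R, t[) (phi s)%:E <= (Phi t)%:E)%E.
Proof.
move=> t0 tT dPhi cphi phi0 Phi0 mphi.
pose a n := t / n.+2%:R.
have a0 n : 0 < a n by rewrite divr_gt0.
have at_ n : a n < t by rewrite ltr_pdivrMr// ltr_pMr// ltr1n.
pose F n := `[a n, t]%classic.
have UF : \bigcup_n F n = `]0%R, t]%classic.
  apply/seteqP; split => [s [n _]|s]; rewrite /F /= !in_itv/=.
    by move=> /andP[as_ ->]; rewrite (lt_le_trans (a0 n) as_).
  move=> /andP[s0 st]; exists (truncn (t / s)) => //=; rewrite in_itv/= st andbT.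
  rewrite /a ler_pdivrMr// mulrC -ler_pdivrMr//.
  apply: le_trans (ltW (truncnS_gt _)) _.
  by rewrite ler_nat.
apply: (@le_trans _ _ (\int[leb]_(s in `]0%R, t]) (phi s)%:E)%E).
  apply: ge0_subset_integral => //=.
  - by apply: measurable_funTS; exact/measurable_EFinP.
  - move=> s; rewrite /= in_itv/= => /andP[s0 st].
    by rewrite lee_fin phi0// s0 (le_lt_trans st tT).
  - by apply: subset_itvl; rewrite bnd_simp.
have ndF : nondecreasing_seq F.
  apply/nondecreasing_seqP => n; rewrite /F subsetEset; apply: subset_itvr.
  by rewrite bnd_simp ler_wpM2l ?(ltW t0)// lef_pV2 ?posrE// ler_nat.
have FT n s : F n s -> 0 < s < T.
  rewrite /F /= in_itv/= => /andP[as_ st].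
  by rewrite (lt_le_trans (a0 n) as_) (le_lt_trans st tT).
have : (\int[leb]_(s in F n) (phi s)%:E @[n --> \oo] -->
    \int[leb]_(s in \bigcup_n F n) (phi s)%:E)%E.
  apply: (@ge0_nondecreasing_set_cvg_integral _ (measurableTypeR R) R F (EFin \o phi) leb) => //.
  - by move=> n; exact: measurable_itv.
  - by move=> n; apply: measurable_funTS; exact/measurable_EFinP.
  - by move=> n s /FT sT; rewrite lee_fin phi0.
rewrite UF => cvgF; rewrite -(cvg_lim _ cvgF)//.
apply: lime_le; first by apply/cvg_ex; eexists; exact: cvgF.
apply: nearW => n; rewrite (integral_derive (a0 n) (at_ n) tT dPhi cphi).
rewrite -EFinB lee_fin gerBl Phi0// a0 (lt_trans (at_ n) tT)//.
Qed.

Lemma is_derive_powR_div c s : 0 < s -> c != 0 ->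
  is_derive s 1 (fun x : R => x `^ c / c) (s `^ (c - 1)).
Proof.
move=> s0 c0; have d1 := is_derive1_powR c s0.
have : is_derive s 1 ((fun x : R => x `^ c) * cst c^-1) (s `^ (c - 1)).
  apply: is_derive_eq.
  by rewrite scaler0 add0r /= [LHS]mulrA mulVf// mul1r.
by [].
Qed.

Lemma is_derive_Nln_powR_div c s : 0 < s -> s < 1 -> c != 0 ->
  is_derive s 1 (fun x : R => (- ln x) `^ (- c) / c) (s^-1 * (- ln s) `^ (- c - 1)).
Proof.
move=> s0 s1 c0; have d1 := is_derive1_ln s0.
have l0 : 0 < - ln s by rewrite oppr_gt0 ln_lt0// s0.
have d2 := is_derive1_powR (- c) l0.
have d3 : is_derive s 1 (- (@ln R)) (- s^-1) by exact: is_deriveN.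
have d4 : is_derive s 1 ((fun x : R => x `^ (- c)) \o (- (@ln R)))
   (- c * (- ln s) `^ (- c - 1) * - s^-1) by exact: is_derive1_comp.
have : is_derive s 1 (((fun x : R => x `^ (- c)) \o (- (@ln R))) * cst c^-1)
    (s^-1 * (- ln s) `^ (- c - 1)).
  apply: is_derive_eq.
  rewrite scaler0 add0r /=.
  rewrite /GRing.scale /=; field; rewrite c0 gt_eqF//.
by [].
Qed.

Lemma continuous_powR c s : 0 < s -> {for s, continuous (fun x : R => x `^ c)}.
Proof.
move=> s0; apply: differentiable_continuous; apply/derivable1_diffP.
by have [] := is_derive1_powR c s0.
Qed.

Lemma continuous_Nln_powR c s : 0 < s -> s < 1 ->
  {for s, continuous (fun x : R => x^-1 * (- ln x) `^ c)}.
Proof.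
move=> s0 s1; have l0 : 0 < - ln s by rewrite oppr_gt0 ln_lt0// s0.
apply: continuousM; first by apply: inv_continuous; rewrite gt_eqF.
apply: (@continuous_comp _ _ _ (- (@ln R)) (fun x : R => x `^ c)).
  by apply: continuousN; exact: continuous_ln.
exact: continuous_powR.
Qed.

End primitives.

Section singular_data.
Local Open Scope ereal_scope.
Context {R : realType}.
Local Notation leb := (@lebesgue_measure R).

(* [lastc y * b s] on [enorm y ^ 2 < s < 2 t] is integrated first in [y], over
   the cube of half-side [sqrt s], where [lastc y <= sqrt s]. *)
Lemma heatS_singular_le N (g : N.+1.-tuple R -> R) (b : R -> R) (M C K t : R) x :
  (0 < t)%R -> (0 <= M)%R -> (0 <= C)%R -> (forall y, 0 <= g y)%R ->
  measurable_fun `]0%R, (2 * t)%R[ b -> (forall s, 0 < s < 2 * t -> 0 <= b s)%R ->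
  (forall y, 0 < lastc y -> t < enorm y ^+ 2 -> g y <= M)%R ->
  (forall y, (0 < lastc y)%R -> (enorm y ^+ 2 <= t)%R ->
    (g y)%:E <= C%:E *
      \int[leb]_(s in `]0%R, (2 * t)%R[) (b s * (enorm y ^+ 2 < s)%R%:R)%:E) ->
  \int[leb]_(s in `]0%R, (2 * t)%R[) (b s * s `^ (N.+2%:R / 2))%:E <= K%:E ->
  heatS (@lebesgueT R N.+1) (@dkernel R N.+1) (EFin \o g) (x, t) <=
    (M + 2 ^+ N.+2 * t `^ (- (N.+2%:R / 2)) * C * K)%:E.
Proof.
move=> t0 M0 C0 g0 mb b0 gM gC intb.
pose I := (`]0%R, (2 * t)%R[%classic : set (measurableTypeR R)).
pose bI : measurableTypeR R -> \bar R := (EFin \o b) \_ I.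
have mI : measurable I by exact: measurable_itv.
have bI0 s : 0 <= bI s.
  by apply: erestrict_ge0 => r; rewrite /I /= in_itv/= => r2; rewrite lee_fin b0.
have mbI : measurable_fun setT bI.
  apply: (measurable_restrictT (EFin \o b) mI).1; exact/measurable_EFinP.
pose l y : R := Num.max 0%R (@lastc R N.+1 y).
have l0 y : (0 <= l y)%R by rewrite /l le_max lexx.
have ml : measurable_fun setT l.
  by apply: measurable_maxr => //; exact: measurable_lastc.
pose q (w : N.+1.-tuple R * measurableTypeR R) :=
  ((l w.1)%:E * ((enorm w.1 ^+ 2 < w.2)%R%:R : R)%:E) * bI w.2.
have q0 w : 0 <= q w by rewrite !mule_ge0 ?lee_fin.
have mlt : measurable_fun setT (fun w : N.+1.-tuple R * measurableTypeR R =>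
    ((enorm w.1 ^+ 2 < w.2)%R%:R : R)).
  have mb' : measurable_fun setT (fun w : N.+1.-tuple R * measurableTypeR R =>
      (enorm w.1 ^+ 2 < w.2)%R).
    apply: measurable_fun_ltr; last exact: measurable_snd.
    apply: measurable_funX.
    exact: (measurableT_comp (@measurable_enorm R N.+1) measurable_fst).
  rewrite (_ : (fun w => _) = (fun c : bool => (c%:R : R)) \o
    (fun w : N.+1.-tuple R * measurableTypeR R => (enorm w.1 ^+ 2 < w.2)%R))//.
  by apply: measurableT_comp mb'.
have mq : measurable_fun setT q.
  apply: emeasurable_funM; last exact: (measurableT_comp mbI measurable_snd).
  apply: emeasurable_funM; last exact/measurable_EFinP.
  by apply/measurable_EFinP; exact: (measurableT_comp ml measurable_fst).
pose kk : R := (2 * t `^ (- (N.+2%:R / 2)) * C)%R.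
have kk0 : (0 <= kk)%R by rewrite !mulr_ge0 ?powR_ge0.
have mdk : measurable_fun setT (fun y => dkernel x y t).
  have m : measurable_fun setT (fun y : N.+1.-tuple R => ((x, y), t : measurableTypeR R)).
    by solve_measurable_proj.
  exact: (measurableT_comp (@measurable_dkernel R N.+1) m).
have mqF : measurable_fun setT (fun y => \int[leb]_s q (y, s)).
  exact: (measurable_fun_fubini_tonelli_F _ mq q0).
apply: (@le_trans _ _ (\int[@lebesgueT R N.+1]_y
    ((dkernel x y t)%:E * M%:E + kk%:E * \int[leb]_s q (y, s)))).
  apply: ge0_le_integral_any => y _; first by rewrite mule_ge0 ?lee_fin ?dkernel_ge0.
  have kq0 : 0 <= kk%:E * \int[leb]_s q (y, s).
    by rewrite mule_ge0 ?lee_fin ?integral_ge0.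
  have [y0|y0] := ltP 0%R (lastc y); last first.
    rewrite {1}/dkernel [X in [&& _, X & _]]ltNge y0 andbF mul0e adde_ge0//.
    by rewrite mule_ge0 ?lee_fin ?dkernel_ge0.
  have [ty|yt] := ltP t (enorm y ^+ 2)%R.
    apply: (@le_trans _ _ ((dkernel x y t)%:E * M%:E)); last by rewrite leeDl.
    by apply: lee_wpmul2l; rewrite ?lee_fin ?dkernel_ge0// gM.
  apply: (@le_trans _ _ (kk%:E * \int[leb]_s q (y, s))); last first.
    by rewrite leeDr// mule_ge0 ?lee_fin ?dkernel_ge0.
  have -> : \int[leb]_s q (y, s) = (l y)%:E *
      \int[leb]_(s in `]0%R, (2 * t)%R[) (b s * (enorm y ^+ 2 < s)%R%:R)%:E.
    rewrite [in RHS]integral_mkcond -ge0_integralZl ?lee_fin//; last 2 first.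
    - apply: (measurable_restrictT (fun s => (b s * (enorm y ^+ 2 < s)%R%:R)%:E) mI).1.
      apply/measurable_EFinP.
      apply: measurable_funM => //; apply: measurable_funTS.
      have m : measurable_fun setT (fun s : measurableTypeR R => (y, s)).
        by solve_measurable_proj.
      exact: (measurableT_comp mlt m).
    - move=> s _; apply: erestrict_ge0 => r; rewrite /= in_itv/= => r2.
      by rewrite lee_fin mulr_ge0 ?b0.
    apply: eq_integral => s _; rewrite /q /bI /= !patchE.
    by case: ifPn => _; rewrite ?mule0// -!EFinM; congr EFin; ring.
  apply: (@le_trans _ _ ((2 * t `^ (- (N.+2%:R / 2)) * l y)%:E * (g y)%:E)).
    apply: lee_wpmul2r; rewrite ?lee_fin//.
    by rewrite /l (max_idPr (ltW y0)); exact: dkernel_le.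
  rewrite /kk !EFinM -!muleA; do 2 (apply: lee_wpmul2l; first by rewrite lee_fin ?powR_ge0).
  by rewrite muleCA; apply: lee_wpmul2l; rewrite ?lee_fin// gC.
rewrite ge0_integralD//; last 4 first.
- by move=> y _; rewrite mule_ge0 ?lee_fin ?dkernel_ge0.
- by apply: emeasurable_funM => //; exact/measurable_EFinP.
- by move=> y _; rewrite mule_ge0 ?lee_fin ?integral_ge0.
- exact: measurable_funeM.
rewrite EFinD; apply: leeD.
  apply: (@heatS_cst R _ _ (@lebesgueT R N.+1) (@dkernel R N.+1) _ _ _ M (x, t) M0).
  - by move=> ? ? ?; exact: dkernel_ge0.
  - exact: measurable_dkernel.
  - by move=> ? ?; exact: integral_dkernel_le1.
rewrite ge0_integralZl ?lee_fin//; last by move=> y _; rewrite integral_ge0.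
rewrite (_ : (2 ^+ N.+2 * t `^ (- (N.+2%:R / 2)) * C * K)%R =
  (kk * (2 ^+ N.+1 * K))%R); last by rewrite /kk [(2 ^+ N.+2)%R]exprS; ring.
rewrite [leRHS]EFinM; apply: lee_wpmul2l; first by rewrite lee_fin.
rewrite -(@fubini_tonelli1 _ _ _ _ _ (@lebesgueT R N.+1) leb q)// fubini_tonelli2//.
rewrite [leRHS]EFinM; apply: (@le_trans _ _ ((2 ^+ N.+1)%:E *
    \int[leb]_(s in `]0%R, (2 * t)%R[) (b s * s `^ (N.+2%:R / 2))%:E)); last first.
  by apply: lee_wpmul2l; rewrite ?lee_fin ?exprn_ge0.
have mbp : measurable_fun `]0%R, (2 * t)%R[ (fun s => (b s * s `^ (N.+2%:R / 2))%:E).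
  apply/measurable_EFinP; apply: measurable_funM => //.
  by apply: measurable_funTS; exact: measurable_powR.
rewrite -ge0_integralZl ?lee_fin ?exprn_ge0//; last first.
  by move=> s; rewrite /= in_itv/= => s2; rewrite lee_fin mulr_ge0 ?b0 ?powR_ge0.
rewrite [leRHS]integral_mkcond; apply: ge0_le_integral_any => s _.
  by rewrite integral_ge0.
rewrite /fubini_G /q /bI /= !patchE; case: ifPn => [/set_mem|_]; last first.
  by rewrite integral0_eq// => y _; rewrite mule0.
rewrite /I /= in_itv/= => s2; have [s0 _] := andP s2.
apply: (@le_trans _ _ (\int[@lebesgueT R N.+1]_y
  ((Num.sqrt s * b s)%:E * (\1_(cube N.+1 (- Num.sqrt s) (Num.sqrt s)) y)%:E))).
  apply: ge0_le_integral_any => y _.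
    by rewrite !mule_ge0 ?lee_fin ?b0.
  rewrite -!EFinM lee_fin indicE.
  have [ys|_] := ltP (enorm y ^+ 2)%R s; last first.
    by rewrite mulr0 mul0r !mulr_ge0 ?sqrtr_ge0 ?b0.
  have yi i : (`|tnth y i| <= Num.sqrt s)%R.
    by rewrite -sqrtr_sqr ler_wsqrtr// (le_trans (sqr_tnth_le_enorm y i))// ltW.
  rewrite mem_set; last by move=> i /=; rewrite -ler_norml.
  rewrite !mulr1 ler_wpM2r ?b0// /l ge_max sqrtr_ge0 /= lastc_tnth.
  by apply: le_trans (yi _); exact: ler_norm.
have mc := @measurable_cube R N.+1 (- Num.sqrt s)%R (Num.sqrt s).
rewrite ge0_integralZl ?lee_fin ?mulr_ge0 ?sqrtr_ge0 ?b0//; last first.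
  by apply/measurable_EFinP; exact: measurable_indic.
rewrite integral_indic ?setIT//.
rewrite [X in (_ * X)](lebesgueT_cube N.+1 (_ : (- Num.sqrt s <= Num.sqrt s)%R)); last first.
  by rewrite ge0_cp ?sqrtr_ge0.
rewrite -!EFinM lee_fin powR_half_nat ?(ltW s0)// opprK.
rewrite (_ : (Num.sqrt s + Num.sqrt s = 2 * Num.sqrt s)%R); last by ring.
rewrite exprMn [(Num.sqrt s ^+ N.+2)%R]exprS.
by rewrite le_eqVlt; apply/orP; left; apply/eqP; ring.
Qed.

End singular_data.

Section log_power.
Context {R : realType}.
Implicit Types a b q r s t : R.

Definition logpow a q s : R := s `^ (- a) * (- ln s) `^ (- q).

Lemma Nln_gt0 s : 0 < s < 1 -> 0 < - ln s.
Proof. by move=> s01; rewrite oppr_gt0 ln_lt0. Qed.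

Lemma logpow_ge0 a q s : 0 <= logpow a q s.
Proof. by rewrite mulr_ge0 ?powR_ge0. Qed.

Lemma logpow_gt0 a q s : 0 < s < 1 -> 0 < logpow a q s.
Proof.
by move=> s01; rewrite mulr_gt0 ?powR_gt0 ?Nln_gt0//; case/andP: s01.
Qed.

Lemma logpowM a q b r s : 0 < s < 1 ->
  logpow a q s * logpow b r s = logpow (a + b) (q + r) s.
Proof.
move=> s01; have [s0 _] := andP s01; have l0 := Nln_gt0 s01.
rewrite /logpow mulrACA -!powRD -?opprD//;
  by apply/implyP => _; rewrite gt_eqF.
Qed.

Lemma logpow_powR a q r s : (logpow a q s) `^ r = logpow (a * r) (q * r) s.
Proof. by rewrite /logpow powRM ?powR_ge0// -!powRrM !mulNr. Qed.

Lemma logpowV a q s : (logpow a q s)^-1 = logpow (- a) (- q) s.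
Proof. by rewrite /logpow invfM -!powRN. Qed.

Lemma measurable_logpow a q : measurable_fun setT (logpow a q).
Proof.
apply: measurable_funM; first exact: measurable_powR.
apply: (measurableT_comp (measurable_powR _)).
exact: (measurableT_comp (@oppr_measurable R setT) (@measurable_ln R)).
Qed.

Lemma powRN_le a r s : 0 <= a -> 0 < r -> r <= s -> s `^ (- a) <= r `^ (- a).
Proof.
move=> a0 r0 rs; have s0 : 0 < s by exact: lt_le_trans rs.
rewrite !powRN lef_pV2 ?posrE ?powR_gt0//.
by apply: ge0_ler_powR; rewrite ?nnegrE// ltW.
Qed.

Lemma ge0_powR_le a r s : 0 <= a -> 0 <= r -> r <= s -> r `^ a <= s `^ a.
Proof.
by move=> a0 r0 rs; apply: ge0_ler_powR; rewrite ?nnegrE// (le_trans r0).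
Qed.

Lemma Nln_le r s : 0 < r -> r <= s -> - ln s <= - ln r.
Proof. by move=> r0 rs; rewrite lerN2 ler_ln ?posrE// (lt_le_trans r0). Qed.

Lemma logpow_dyadic a q r s : 0 <= a -> 0 <= q -> 0 < r -> r <= s -> s <= 2 * r -> s < 1 ->
  2 `^ (- a) * logpow a q r <= logpow a q s.
Proof.
move=> a0 q0 r0 rs s2 s1; have s0 : 0 < s by exact: lt_le_trans rs.
have ls : 0 < - ln s by rewrite Nln_gt0// s0.
rewrite /logpow mulrA -powRM ?(ltW r0)//; apply: ler_pM; rewrite ?powR_ge0//.
  exact: powRN_le.
by apply: powRN_le => //; exact: Nln_le.
Qed.

Lemma Nln_ge1 s : 0 < s -> s <= 1 / 4 -> 1 <= - ln s.
Proof.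
move=> s0 s4; rewrite lerNr -[leRHS]expRK ler_ln ?posrE ?expR_gt0//.
apply: (le_trans s4).
have := expR_ge1Dx (- 2^-1 : R); have e0 := expR_gt0 (- 2^-1 : R).
have -> : expR (-1 : R) = expR (- 2^-1) * expR (- 2^-1).
  by rewrite -expRD; congr expR; field.
nra.
Qed.

End log_power.

Section barrier.
Context {R : realType}.
Local Notation leb := (@lebesgue_measure R).

Definition profile N (c r0 a q : R) (y : N.-tuple R) : R :=
  if (0 < lastc y) && (enorm y ^+ 2 < r0) then c * logpow a q (enorm y ^+ 2) else 0.

Lemma enorm_sqr_gt0 N (y : N.+1.-tuple R) : 0 < lastc y -> 0 < enorm y ^+ 2.
Proof.
move=> y0; apply: lt_le_trans (sqr_tnth_le_enorm y ord_max).
by rewrite -lastc_tnth exprn_gt0.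
Qed.

Lemma profile_ge0 N (c r0 a q : R) (y : N.-tuple R) : 0 <= c -> 0 <= profile c r0 a q y.
Proof. by move=> c0; rewrite /profile; case: ifP => // _; rewrite mulr_ge0 ?logpow_ge0. Qed.

Lemma measurable_profile N (c r0 a q : R) : measurable_fun setT (@profile N c r0 a q).
Proof.
have me : measurable_fun setT (fun y : N.-tuple R => enorm y ^+ 2).
  by apply: measurable_funX; exact: measurable_enorm.
apply: measurable_fun_ifT => //.
  by apply: measurable_and; apply: measurable_fun_ltr => //; exact: measurable_lastc.
by apply: measurable_funM => //; exact: (measurableT_comp (measurable_logpow a q) me).
Qed.

Lemma logpowMr (a q c s : R) : 0 < s -> logpow a q s * s `^ c = logpow (a - c) q s.
Proof.
move=> s0; rewrite /logpow mulrAC -powRD ?opprB 1?addrC//.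
by apply/implyP => _; rewrite gt_eqF.
Qed.

Variables (N : nat) (p c r0 a q e b th C : R).
Local Notation D := (N.+2%:R / 2 : R).
Local Notation al := (a + e).
Hypotheses (p1 : 1 < p) (c0 : 0 < c) (r00 : 0 < r0) (r01 : r0 <= 1).
Hypotheses (C0 : 0 <= C) (al0 : 0 <= al) (qb0 : 0 <= q + b).
Hypothesis rho_mono : forall r s : R, 0 < r -> r <= s -> s < 1 / 4 ->
  logpow e b s <= logpow e b r.
Hypothesis rho_ge1 : forall r : R, 0 < r -> r < r0 -> 1 <= logpow e b r.
Hypothesis profile_powR : forall r : R, 0 < r -> r < r0 ->
  (c * logpow a q r) `^ (p - 1) * r <= C.
Hypothesis logpow_far : forall t s : R, 0 < t < 1 / 4 -> t < s -> s < r0 ->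
  logpow al (q + b) s <= C * logpow al th t.
Hypothesis logpow_near : forall t : R, 0 < t < 1 / 4 ->
  (\int[leb]_(s in `]0%R, (2 * t)%R[) (logpow (al + 1 - D) (q + b) s)%:E
    <= (C * (t `^ D * logpow al th t))%:E)%E.
Hypothesis logpow_int : forall t : R, 0 < t < 1 / 4 ->
  (\int[leb]_(s in `]0%R, t[)
     (logpow (a * (p - 1) - e) ((th - b) * (p - 1) - b) s)%:E
    <= (C / logpow e b t)%:E)%E.

Local Notation f := (@profile N.+1 c r0 a q).
Local Notation g := (@profile N.+1 c r0 al (q + b)).
Local Notation S := (heatS (@lebesgueT R N.+1) (@dkernel R N.+1)).

Let cm := c * C + 2 ^+ N.+2 * (c * 2 `^ (al + 1)) * C.

Let cm0 : 0 <= cm.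
Proof.
have c0' := ltW c0; apply: addr_ge0; first exact: mulr_ge0.
apply: mulr_ge0 => //; apply: mulr_ge0; first exact: exprn_ge0.
by apply: mulr_ge0; rewrite ?powR_ge0.
Qed.

Let lt14_1 (t : R) : 0 < t < 1 / 4 -> 0 < t < 1.
Proof. by move=> /andP[-> t4]; lra. Qed.

Let profile_near (t : R) y : 0 < t < 1 / 4 -> 0 < lastc y -> enorm y ^+ 2 <= t ->
  ((g y)%:E <= (c * 2 `^ (al + 1))%:E *
    \int[leb]_(s in `]0%R, (2 * t)%R[)
      (logpow (al + 1) (q + b) s * (enorm y ^+ 2 < s)%R%:R)%:E)%E.
Proof.
move=> t4 y0 yt; have [t0 t14] := andP t4.
set r := enorm y ^+ 2; have rp : 0 < r by exact: enorm_sqr_gt0.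
have rt : r <= t by [].
pose k : R := 2 `^ (- (al + 1)) * logpow (al + 1) (q + b) r.
have k0 : 0 <= k by rewrite mulr_ge0 ?powR_ge0 ?logpow_ge0.
have cc0 : 0 <= c * 2 `^ (al + 1) by rewrite mulr_ge0 ?powR_ge0// ltW.
apply: (@le_trans _ _ ((c * 2 `^ (al + 1))%:E * (k * r)%:E)%E).
  rewrite -EFinM lee_fin /k /profile y0 /= -/r.
  have -> : c * 2 `^ (al + 1) * (2 `^ (- (al + 1)) * logpow (al + 1) (q + b) r * r)
      = c * logpow al (q + b) r.
    rewrite powRN -[X in _ * (_ * X)](powRr1 (ltW rp)).
    rewrite -[X in _ * X]mulrA logpowMr// addrK mulrA -[c * _ / _]mulrA divff ?mulr1//.
  by case: ifP => // _; rewrite mulr_ge0 ?logpow_ge0// ltW.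
apply: lee_wpmul2l; first by rewrite lee_fin.
have -> : (k * r)%:E = (\int[leb]_(s in `]r, (2 * r)%R[) k%:E)%E.
  rewrite integral_cst//= lebesgue_measure_itv/= lte_fin ltr_pMl// ltr1n.
  by rewrite -EFinB -EFinM; congr (k * _)%:E; ring.
rewrite integral_mkcond [leRHS]integral_mkcond.
apply: ge0_le_integral_any => s _; first by apply: erestrict_ge0 => ? _; rewrite lee_fin.
rewrite !patchE; case: ifPn => [/set_mem|_]; last first.
  by case: ifPn => // _; rewrite lee_fin mulr_ge0 ?logpow_ge0.
rewrite /= in_itv/= => /andP[rs s2r].
have s2t : (s : R) < 2 * t by apply: lt_le_trans s2r _; rewrite ler_wpM2l.
rewrite mem_set/=; last by rewrite /= in_itv/= (lt_trans rp rs).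
rewrite rs mulr1 lee_fin; apply: logpow_dyadic => //; [exact: addr_ge0|exact: ltW|exact: ltW|].
by apply: lt_trans s2t _; lra.
Qed.

Let heatS_profile x (t : R) : 0 < t < 1 / 4 ->
  (S (EFin \o g) (x, t) <= (cm * logpow al th t)%:E)%E.
Proof.
move=> t4; have [t0 t14] := andP t4.
have M0 : 0 <= c * C * logpow al th t.
  by rewrite !mulr_ge0 ?powR_ge0// ltW.
have cc0 : 0 <= c * 2 `^ (al + 1) by rewrite mulr_ge0 ?powR_ge0// ltW.
apply: le_trans (heatS_singular_le (b := logpow (al + 1) (q + b))
  (K := C * (t `^ D * logpow al th t)) x t0 M0 cc0 _ _ _ _ _ _) _.
- by move=> y; rewrite profile_ge0// ltW.
- by apply: measurable_funTS; exact: measurable_logpow.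
- by move=> s _; exact: logpow_ge0.
- move=> y y0 ty; rewrite /profile y0 /=; case: ifPn => // yr.
  by rewrite -mulrA ler_wpM2l ?(ltW c0)// logpow_far.
- by move=> y y0 yt; exact: profile_near.
- apply: le_trans (logpow_near t4).
  rewrite le_eqVlt; apply/orP; left; apply/eqP; apply: eq_integral => s.
  by rewrite inE/= in_itv/= => /andP[s0 _]; rewrite logpowMr.
rewrite lee_fin le_eqVlt; apply/orP; left; apply/eqP.
have tD : t `^ (- D) * t `^ D = 1 by rewrite powRN mulVf// gt_eqF// powR_gt0.
rewrite /cm; set x1 := t `^ (- D); set x2 := t `^ D; set x3 := logpow al th t.
transitivity (c * C * x3 + 2 ^+ N.+2 * (c * 2 `^ (al + 1)) * C * x3 * (x1 * x2)).
  by rewrite /x1 /x2 /x3; ring.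
by rewrite tD; ring.
Qed.

Lemma exists_barrier : exists (K : R) (w : N.+1.-tuple R * R -> \bar R),
  [/\ 0 <= K, (forall z, 0 <= w z)%E,
    measurable_fun setT (w : N.+1.-tuple R * measurableTypeR R -> \bar R) &
    forall x (t : R), 0 < t < 1 / 4 ->
      [/\ (S (EFin \o f) (x, t) <= w (x, t))%E, (w (x, t) < +oo)%E &
        (duhamel (@lebesgueT R N.+1) (@dkernel R N.+1) p w (x, t) <= K%:E * w (x, t))%E]].
Proof.
pose rho := logpow e b; pose m s := cm * logpow al th s.
pose w := heat_barrier (@lebesgueT R N.+1) (@dkernel R N.+1) f g rho.
pose C2 := cm `^ (p - 1) * C.
have C20 : 0 <= C2 by rewrite mulr_ge0 ?powR_ge0.
have f0 y : 0 <= f y by rewrite profile_ge0// ltW.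
have g0 y : 0 <= g y by rewrite profile_ge0// ltW.
have S0 h z : (forall y, 0 <= h y) -> (0 <= S (EFin \o h) z)%E.
  move=> h0; apply: heatS_ge0; first by move=> *; exact: dkernel_ge0.
  by move=> y; rewrite lee_fin.
exists (2 `^ p * 2 `^ p * (C + C2)), w; split.
- by rewrite !mulr_ge0 ?powR_ge0 ?addr_ge0.
- move=> z; rewrite /w /heat_barrier; case: ifP => // _.
  by rewrite adde_ge0 ?S0// mule_ge0 ?S0// lee_fin invr_ge0 logpow_ge0.
- have mS (h : N.+1.-tuple R -> R) : measurable_fun setT h -> (forall y, 0 <= h y) ->
      measurable_fun setT
      (S (EFin \o h) : N.+1.-tuple R * measurableTypeR R -> \bar R).
    move=> mh h0; apply: measurable_heatS.
    + by move=> *; exact: dkernel_ge0.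
    + exact: measurable_dkernel.
    + exact/measurable_EFinP.
    + by move=> y; rewrite lee_fin.
  have m2 : measurable_fun setT (fun z : N.+1.-tuple R * measurableTypeR R => z.2 : R).
    exact: measurable_snd.
  apply: measurable_fun_ifT => //; first exact: measurable_fun_ltr.
  apply: emeasurable_funD; first by apply: mS => //; exact: measurable_profile.
  apply: emeasurable_funM; last by apply: mS => //; exact: measurable_profile.
  apply/measurable_EFinP; apply: (measurableT_comp measurable_invr).
  exact: (measurableT_comp (measurable_logpow e b) m2).
move=> x t t4; have [t0 t14] := andP t4; have t01 := lt14_1 t4.
have wE : w (x, t) = (S (EFin \o f) (x, t) + ((rho t)^-1)%:E * S (EFin \o g) (x, t))%E.
  by rewrite /w /heat_barrier /= t0.
have Sg : (S (EFin \o g) (x, t) < +oo)%E.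
  by apply: le_lt_trans (heatS_profile x t4) _; rewrite ltry.
split.
- by rewrite wE leeDl// mule_ge0 ?S0// lee_fin invr_ge0 logpow_ge0.
- rewrite wE lte_add_pinfty//; last first.
    by rewrite lte_mul_pinfty ?lee_fin ?invr_ge0 ?logpow_ge0.
  apply: le_lt_trans Sg; apply: le_heatS.
  + by move=> *; exact: dkernel_ge0.
  + by move=> y; rewrite lee_fin.
  move=> y; rewrite lee_fin /profile; case: ifPn => // /andP[y0 yr].
  have y2 := enorm_sqr_gt0 y0.
  rewrite -logpowM; last by rewrite y2 (lt_le_trans yr).
  by rewrite ler_wpM2l ?(ltW c0)// ler_peMr ?logpow_ge0// rho_ge1.
apply: (@duhamel_barrier_le _ _ _ _ _ _ _ _ _ _ p (1 / 4) C C2 f g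
  (fun y => enorm y ^+ 2) rho m) => //.
- by move=> *; exact: dkernel_ge0.
- exact: measurable_dkernel.
- by move=> *; exact: dkernel_le0.
- by move=> *; exact: integral_dkernel_le1.
- by move=> *; exact: dkernel_semigroup.
- exact: measurable_profile.
- exact: measurable_profile.
- by apply: measurable_funX; exact: measurable_enorm.
- by move=> y; exact: sqr_ge0.
- by move=> s /lt14_1; exact: logpow_gt0.
- by move=> s _; rewrite mulr_ge0 ?logpow_ge0.
- by apply: measurable_funTS; exact: measurable_logpow.
- by apply: measurable_funTS; apply: measurable_funM => //; exact: measurable_logpow.
- move=> s y s4 ys; have [s0 s14] := andP s4.
  have rs : 0 < rho s by apply: logpow_gt0; exact: lt14_1.
  rewrite ler_pdivlMr// /profile; case: ifPn => [/andP[y0 yr]|_]; last by rewrite mul0r.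
  have y2 := enorm_sqr_gt0 y0.
  rewrite -logpowM; last by rewrite y2 (lt_le_trans yr).
  rewrite -mulrA ler_wpM2l ?(ltW c0)// ler_wpM2l ?logpow_ge0//.
  exact: rho_mono.
- move=> y; rewrite /profile; case: ifPn => [/andP[y0 yr]|_]; last first.
    by rewrite mulr0 powR0 ?mul0r// gt_eqF// (lt_trans _ p1).
  have y2 := enorm_sqr_gt0 y0.
  have F0 : 0 <= c * logpow a q (enorm y ^+ 2) by rewrite mulr_ge0 ?logpow_ge0// ltW.
  rewrite -(mulr_powRB1 F0 (lt_trans ltr01 p1)) -[leLHS]mulrA [C * _]mulrC.
  by rewrite ler_wpM2l// profile_powR.
- move=> s s4; have [s0 s14] := andP s4; have s01 := lt14_1 s4.
  rewrite (_ : _ / _ = cm `^ (p - 1) * (C / rho s)); last by rewrite /C2 mulrA.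
  rewrite EFinM; apply: (@le_trans _ _ ((cm `^ (p - 1))%:E * \int[leb]_(s in `]0%R, s[)
     (logpow (a * (p - 1) - e) ((th - b) * (p - 1) - b) s)%:E)%E); last first.
    by apply: lee_wpmul2l; rewrite ?lee_fin ?powR_ge0// logpow_int.
  rewrite -ge0_integralZl ?lee_fin ?powR_ge0//; last 2 first.
  + by apply: measurable_funTS; apply/measurable_EFinP; exact: measurable_logpow.
  + by move=> u _; rewrite lee_fin logpow_ge0.
  rewrite le_eqVlt; apply/orP; left; apply/eqP; apply: eq_integral => u.
  rewrite inE/= in_itv/= => /andP[u0 us]; rewrite -EFinM; congr EFin.
  have u01 : 0 < u < 1 by rewrite u0 (lt_trans us) //; case/andP: s01.
  rewrite /m /rho logpowV -mulrA logpowM// powRM ?logpow_ge0// logpow_powR -mulrA logpowM//.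
  congr (_ * logpow _ _ _); ring.
Qed.

End barrier.

Section subsolution.
Context {R : realType}.
Local Notation leb := (@lebesgue_measure R).

Definition parabolic_cube N : set (N.-tuple R * measurableTypeR R) :=
  [set z | scube N z.2 z.1].
Arguments parabolic_cube N : clear implicits.

Lemma in_parabolic_cube N (y : N.-tuple R) s :
  ((y, s) \in parabolic_cube N) = (y \in scube N s).
Proof. by apply/idP/idP => /set_mem H; apply/mem_set. Qed.

Lemma measurable_parabolic_cube N : measurable (parabolic_cube N).
Proof.
rewrite (_ : parabolic_cube N = \bigcap_(i in [set: 'I_N])
    [set z | Num.sqrt z.2 <= tnth z.1 i <= 2 * Num.sqrt z.2]); last first.
  by apply/seteqP; split=> z /= H i => [_|]; exact: H.
apply: fin_bigcap_measurable => // i _.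
have ms : measurable_fun setT (fun z : N.-tuple R * measurableTypeR R => Num.sqrt z.2 : R).
  exact: (measurableT_comp (continuous_measurable_fun (@sqrt_continuous R)) measurable_snd).
have mi : measurable_fun setT (fun z : N.-tuple R * measurableTypeR R => tnth z.1 i : R).
  exact: (measurableT_comp (@measurable_tnth _ _ N i) measurable_fst).
have mb : measurable_fun setT (fun z : N.-tuple R * measurableTypeR R =>
    (Num.sqrt z.2 <= tnth z.1 i <= 2 * Num.sqrt z.2)%R).
  by apply: measurable_and; apply: measurable_fun_ler => //; exact: measurable_funM.
have /(_ [set true]) := mb measurableT; rewrite setTI => /(_ _) H.
by apply: H.
Qed.

Definition bump N (T a th : R) (z : N.-tuple R * R) : \bar R :=
  if 0 < z.2 < T then (logpow a th z.2 * \1_(parabolic_cube N) z)%:E else 0%E.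

Lemma bump_ge0 N T a th z : (0 <= @bump N T a th z)%E.
Proof.
by rewrite /bump; case: ifP => // _; rewrite lee_fin mulr_ge0 ?logpow_ge0.
Qed.

Lemma measurable_bump N T a th :
  measurable_fun setT (@bump N T a th : N.-tuple R * measurableTypeR R -> \bar R).
Proof.
have m2 : measurable_fun setT (fun z : N.-tuple R * measurableTypeR R => z.2 : R).
  exact: measurable_snd.
apply: measurable_fun_ifT => //.
  by apply: measurable_and; exact: measurable_fun_ltr.
apply/measurable_EFinP; apply: measurable_funM.
  exact: (measurableT_comp (measurable_logpow a th) m2).
by apply: measurable_indic; exact: measurable_parabolic_cube.
Qed.

Lemma bump_gt0 N T a th z : (0 < @bump N.+1 T a th z)%E <->
  [/\ 0 < z.2, z.2 < T & scube N.+1 z.2 z.1] /\ 0 < logpow a th z.2.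
Proof.
rewrite /bump; case: ifPn => [/andP[z0 zT]|zT]; last first.
  by rewrite ltxx; split => // -[[z0 z1 _] _]; rewrite z0 z1 in zT.
rewrite lte_fin indicE; case: (boolP (z \in parabolic_cube N.+1)) => [/set_mem zc|zc].
  by rewrite mulr1; split => [l0|[_]].
rewrite mulr0 ltxx; split => // -[[_ _ zs] _]; exfalso.
by move/negP: zc; apply; apply/mem_set.
Qed.

Variables (N : nat) (p c r0 a q th c3 : R).
Local Notation D := (N.+2%:R / 2 : R).
Local Notation t0 := (r0 / (4 * N.+1%:R)).
Hypotheses (p1 : 1 < p) (c0 : 0 < c) (r00 : 0 < r0) (r01 : r0 <= 1).
Hypotheses (a0 : 0 <= a) (q0 : 0 <= q) (c30 : 0 < c3).
Hypotheses (ap : a * p = a + 1) (thp : th * p = q).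
Hypothesis logpow_low : forall t : R, 0 < t < t0 ->
  ((c3 * (t `^ D * logpow a th t))%:E <=
   \int[leb]_(s in `]0%R, (t / 2)%R[) (logpow (a + 1 - D) q s)%:E)%E.

Local Notation f := (@profile R N.+1 c r0 a q).
Local Notation S := (heatS (@lebesgueT R N.+1) (@dkernel R N.+1)).

Let K : R := 4 * N.+1%:R.

Let K1 : 1 <= K.
Proof.
rewrite /K; have : 1 <= N.+1%:R :> R by rewrite ler1n.
by lra.
Qed.

Let scube_enorm (y : N.+1.-tuple R) s : 0 < s -> scube N.+1 s y ->
  s <= enorm y ^+ 2 /\ enorm y ^+ 2 <= K * s.
Proof.
move=> s0 ys; have ss : Num.sqrt s ^+ 2 = s by rewrite sqr_sqrtr// ltW.
have s00 := sqrtr_ge0 s; split.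
  apply: le_trans (sqr_tnth_le_enorm y ord0).
  by have /andP[y1 _] := ys ord0; rewrite -ss; nra.
apply: (@le_trans _ _ (\sum_(i < N.+1) 4 * s)).
  rewrite enorm_sqr; apply: ler_sum => i _.
  by have /andP[y1 y2] := ys i; rewrite -ss; nra.
rewrite sumr_const card_ord -mulr_natr /K.
by rewrite le_eqVlt; apply/orP; left; apply/eqP; ring.
Qed.

Let cubes_le_profile (y : N.+1.-tuple R) :
  ((c / K `^ (a + 1))%:E * \int[leb]_(s in `]0%R, t0[)
     (logpow (a + 1) q s * \1_(parabolic_cube N.+1) (y, s))%:E <= (f y)%:E)%E.
Proof.
have k0 : 0 <= c / K `^ (a + 1) by rewrite divr_ge0 ?powR_ge0// ltW.
have K0 : 0 < K by exact: lt_le_trans ltr01 K1.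
pose r := enorm y ^+ 2.
have [/andP[y0 yr]|nyr] := boolP ((0 < lastc y) && (enorm y ^+ 2 < r0)); last first.
  rewrite integral0_eq ?mule0 ?lee_fin ?profile_ge0 ?ltW// => s.
  rewrite /= in_itv/= => /andP[s0 st].
  rewrite indicE in_parabolic_cube memNset ?mulr0// => ys.
  move/negP: nyr; apply; apply/andP; split; first exact: scube_lastc ys.
  have [_ yK] := scube_enorm s0 ys; apply: le_lt_trans yK _.
  by rewrite mulrC -ltr_pdivlMr.
have rp : 0 < r by exact: enorm_sqr_gt0.
rewrite /profile y0 yr /= -/r.
pose k := K `^ (a + 1) * (r^-1 * logpow a q r).
apply: (@le_trans _ _ ((c / K `^ (a + 1))%:E * (k * r)%:E)%E); last first.
  rewrite -EFinM lee_fin /k le_eqVlt; apply/orP; left; apply/eqP.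
  by field; rewrite !gt_eqF// powR_gt0.
apply: lee_wpmul2l; first by rewrite lee_fin.
have kk0 : 0 <= k by rewrite !mulr_ge0 ?powR_ge0 ?logpow_ge0// invr_ge0 ltW.
have -> : (k * r)%:E = (\int[leb]_(s in `[0%R, r]) k%:E)%E.
  by rewrite integral_cst//= lebesgue_measure_itv/= lte_fin rp sube0 -EFinM.
rewrite integral_mkcond [leRHS]integral_mkcond.
apply: ge0_le_integral_any => s _.
  by apply: erestrict_ge0 => u _; rewrite lee_fin mulr_ge0 ?logpow_ge0.
rewrite !patchE; case: ifPn => [/set_mem|_]; last first.
  by case: ifP => // _; rewrite lee_fin.
rewrite /= in_itv/= => /andP[s0 st]; rewrite indicE in_parabolic_cube.
have [ys|ys] := pselect (scube N.+1 s y); last first.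
  by rewrite (memNset ys) mulr0; case: ifP => // _; rewrite lee_fin.
have [sr rK] := scube_enorm s0 ys; rewrite -/r in sr rK.
rewrite (mem_set ys) mulr1.
rewrite mem_set/=; last by rewrite /= in_itv/= (ltW s0).
have r1 : r < 1 by exact: lt_le_trans yr r01.
have s1 : s < 1 by exact: le_lt_trans sr r1.
rewrite lee_fin /k /logpow mulrA mulrA; apply: ler_pM; rewrite ?powR_ge0//; last first.
  by apply: powRN_le => //; [exact: Nln_gt0 (introT andP (conj rp r1))|exact: Nln_le].
apply: (@le_trans _ _ ((r / K) `^ (- (a + 1)))).
  apply: powRN_le; [exact: addr_ge0|exact: divr_gt0|].
  by rewrite ler_pdivrMr// mulrC.
rewrite powRM ?invr_ge0 ?(ltW rp) ?(ltW K0)//.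
rewrite -[K^-1]powR_inv1 ?(ltW K0)// -powRrM mulN1r opprK mulrC -mulrA ler_wpM2l ?powR_ge0//.
rewrite -[X in _ <= X * _](powR_inv1 (ltW rp)) -powRD; last by apply/implyP => _; rewrite gt_eqF.
by rewrite opprD addrC.
Qed.

Let mcube s : measurable_fun setT (fun y : N.+1.-tuple R => \1_(scube N.+1 s) y : R).
Proof. by apply: measurable_indic; exact: measurable_cube. Qed.

Let mheat (x : N.+1.-tuple R) t : measurable_fun setT (fun y => (dkernel x y t)%:E).
Proof.
apply/measurable_EFinP.
have m : measurable_fun setT (fun y : N.+1.-tuple R => ((x, y), t : measurableTypeR R)).
  by solve_measurable_proj.
exact: (measurableT_comp (@measurable_dkernel R N.+1) m).
Qed.

Let SZ x s t :
  S (fun y => ((logpow (a + 1) q s)%:E * (\1_(scube N.+1 s) y)%:E)%E) (x, t) =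
  ((logpow (a + 1) q s)%:E * S (fun y => (\1_(scube N.+1 s) y)%:E) (x, t))%E.
Proof.
apply: heatSZ.
- by move=> *; exact: dkernel_ge0.
- exact: measurable_dkernel.
- exact: logpow_ge0.
- by apply/measurable_EFinP.
- by move=> y; rewrite lee_fin.
Qed.

(* Both the linear and the nonlinear term dominate this integral; in the first
   one [tau s = t], in the second one [tau s = t - s]. *)
Let superposition_ge (x : N.+1.-tuple R) t (tau : R -> R) :
  0 < t < t0 -> scube N.+1 t x ->
  (forall s, 0 < s < t / 2 -> t / 2 <= tau s <= t) ->
  ((cube_cst N * c3 * logpow a th t)%:E <=
   \int[leb]_(s in `]0%R, (t / 2)%R[) ((logpow (a + 1) q s)%:E *
      S (fun y => (\1_(scube N.+1 s) y)%:E) (x, tau s)))%E.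
Proof.
move=> t01 xt htau; have [tp tt] := andP t01.
have k0 := ltW (cube_cst_gt0 N : 0 < cube_cst N :> R).
apply: (@le_trans _ _ ((cube_cst N * t `^ (- D))%:E *
    \int[leb]_(s in `]0%R, (t / 2)%R[) (logpow (a + 1 - D) q s)%:E)%E).
  apply: (@le_trans _ _ ((cube_cst N * t `^ (- D))%:E *
    (c3 * (t `^ D * logpow a th t))%:E)%E); last first.
    by apply: lee_wpmul2l; rewrite ?lee_fin ?mulr_ge0 ?powR_ge0// logpow_low.
  rewrite -EFinM lee_fin le_eqVlt; apply/orP; left; apply/eqP.
  by rewrite powRN; field; rewrite gt_eqF// powR_gt0.
rewrite -ge0_integralZl ?lee_fin ?mulr_ge0 ?powR_ge0//; last 2 first.
- by apply: measurable_funTS; apply/measurable_EFinP; exact: measurable_logpow.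
- by move=> s _; rewrite lee_fin logpow_ge0.
apply: ge0_le_integral_any => s; rewrite /= in_itv/= => /andP[s0 st].
  by rewrite -EFinM lee_fin !mulr_ge0 ?powR_ge0.
have /andP[tau1 tau2] := htau s (introT andP (conj s0 st)).
have s_t : s <= t by apply: (le_trans (ltW st)); rewrite ler_pdivrMr// ler_peMr ?ltW// ltr1n.
have := heatS_scube_ge s0 s_t tau1 tau2 xt.
move=> /(lee_wpmul2l (_ : 0 <= (logpow (a + 1) q s)%:E)%E) H.
apply: le_trans (H _); last by rewrite lee_fin logpow_ge0.
rewrite -!EFinM lee_fin -logpowMr// le_eqVlt; apply/orP; left; apply/eqP; ring.
Qed.

Lemma bump_le_heatS T z : T <= t0 ->
  ((c / K `^ (a + 1) * (cube_cst N * c3))%:E * bump T a th z <= S (EFin \o f) z)%E.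
Proof.
case: z => x t Tt0.
have c' := ltW c0.
have k0 : 0 <= c / K `^ (a + 1) by rewrite divr_ge0 ?powR_ge0// ltW.
have S0 : (0 <= S (EFin \o f) (x, t))%E.
  apply: heatS_ge0; first by move=> *; exact: dkernel_ge0.
  by move=> y; rewrite lee_fin profile_ge0.
rewrite /bump /=; case: ifPn => [/andP[tp tT]|_]; last by rewrite mule0.
rewrite indicE in_parabolic_cube; have [xt|xt] := pselect (scube N.+1 t x); last first.
  by rewrite (memNset xt) mulr0 mule0.
rewrite (mem_set xt) mulr1 EFinM -muleA.
have t01 : 0 < t < t0 by rewrite tp (lt_le_trans tT).
have th2 s : 0 < s < t / 2 -> t / 2 <= t <= t.
  by move=> _; rewrite lexx andbT ler_pdivrMr// ler_peMr ?ltW// ltr1n.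
apply: (@le_trans _ _ ((c / K `^ (a + 1))%:E *
    \int[leb]_(s in `]0%R, (t / 2)%R[) ((logpow (a + 1) q s)%:E *
      S (fun y => (\1_(scube N.+1 s) y)%:E) (x, t)))%E).
  by apply: lee_wpmul2l; rewrite ?lee_fin// -EFinM; exact: (superposition_ge (tau := fun=> t) t01 xt th2).
pose I := (`]0%R, t0[%classic : set (measurableTypeR R)).
pose h (w : N.+1.-tuple R * measurableTypeR R) :=
  ((dkernel x w.1 t)%:E * ((logpow (a + 1) q w.2 * \1_(parabolic_cube N.+1) w) * \1_I w.2)%:E)%E.
have h0 w : (0 <= h w)%E.
  by rewrite mule_ge0 ?lee_fin ?dkernel_ge0// !mulr_ge0 ?powR_ge0.
have mE : measurable_fun setT (fun w : N.+1.-tuple R * measurableTypeR R =>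
    logpow (a + 1) q w.2 * \1_(parabolic_cube N.+1) w * \1_I w.2).
  apply: measurable_funM; last first.
    have mI : measurable_fun setT (\1_I : measurableTypeR R -> R).
      by apply: measurable_indic; exact: measurable_itv.
    exact: (measurableT_comp mI measurable_snd).
  apply: measurable_funM; last by apply: measurable_indic; exact: measurable_parabolic_cube.
  exact: (measurableT_comp (measurable_logpow (a + 1) q) measurable_snd).
have mh : measurable_fun setT h.
  apply: emeasurable_funM; first exact: (measurableT_comp (mheat x t) measurable_fst).
  exact/measurable_EFinP.
have msec y : measurable_fun setT (fun s : measurableTypeR R => h (y, s)).
  have m : measurable_fun setT (fun s : measurableTypeR R => (y, s)).
    by solve_measurable_proj.
  exact: (measurableT_comp mh m).
apply: (@le_trans _ _ ((c / K `^ (a + 1))%:E *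
    \int[leb]_s \int[@lebesgueT R N.+1]_y h (y, s))%E).
  apply: lee_wpmul2l; first by rewrite lee_fin.
  rewrite integral_mkcond; apply: ge0_le_integral_any => s _.
    apply: erestrict_ge0 => u _; rewrite mule_ge0 ?lee_fin ?logpow_ge0//.
    apply: heatS_ge0; first by move=> *; exact: dkernel_ge0.
    by move=> y; rewrite lee_fin.
  rewrite patchE; case: ifPn => [/set_mem|_]; last by rewrite integral_ge0.
  rewrite /= in_itv/= => /andP[s0 st].
  have sI : s \in I.
    rewrite mem_set// /I /= in_itv/= s0 /= (lt_trans st)// (le_lt_trans _ (andP t01).2)//.
    by rewrite ler_pdivrMr// ler_peMr ?ltW// ltr1n.
  rewrite -SZ.
  rewrite le_eqVlt; apply/orP; left; apply/eqP; apply: eq_integral => y _.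
  by rewrite /h /= [\1_I s]indicE sI mulr1 -EFinM.
rewrite -(@fubini_tonelli2 _ _ _ _ _ (@lebesgueT R N.+1) leb h)// fubini_tonelli1//.
rewrite -ge0_integralZl ?lee_fin//; last 2 first.
- exact: (measurable_fun_fubini_tonelli_F _ mh h0).
- by move=> y _; rewrite integral_ge0.
apply: ge0_le_integral_any => y _.
  by rewrite mule_ge0 ?lee_fin// integral_ge0.
rewrite /fubini_F /h /=.
have mEy : measurable_fun setT (fun s : measurableTypeR R =>
    (logpow (a + 1) q s * \1_(parabolic_cube N.+1) (y, s) * \1_I s)%:E).
  apply/measurable_EFinP.
  have m : measurable_fun setT (fun s : measurableTypeR R => (y, s)).
    by solve_measurable_proj.
  exact: (measurableT_comp mE m).
rewrite ge0_integralZl ?lee_fin ?dkernel_ge0//; last first.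
  by move=> s _; rewrite lee_fin !mulr_ge0 ?powR_ge0.
rewrite muleCA; apply: lee_wpmul2l; first by rewrite lee_fin dkernel_ge0.
apply: le_trans (cubes_le_profile y); apply: lee_wpmul2l; first by rewrite lee_fin.
rewrite [leRHS]integral_mkcond le_eqVlt; apply/orP; left; apply/eqP.
apply: eq_integral => s _; rewrite patchE -/I.
by case: ifPn => sI; rewrite [\1_I s]indicE ?sI ?(negbTE sI) ?mulr1 ?mulr0.
Qed.

Lemma bump_le_duhamel T z : T <= t0 ->
  ((cube_cst N * c3)%:E * bump T a th z <=
   duhamel (@lebesgueT R N.+1) (@dkernel R N.+1) p (bump T a th) z)%E.
Proof.
case: z => x t Tt0.
have D0 : (0 <= duhamel (@lebesgueT R N.+1) (@dkernel R N.+1) p (bump T a th) (x, t))%E.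
  by apply: duhamel_ge0 => *; exact: dkernel_ge0.
rewrite {1}/bump /=; case: ifPn => [/andP[tp tT]|_]; last by rewrite mule0.
rewrite indicE in_parabolic_cube; have [xt|xt] := pselect (scube N.+1 t x); last first.
  by rewrite (memNset xt) mulr0 mule0.
rewrite (mem_set xt) mulr1 -EFinM.
have t01 : 0 < t < t0 by rewrite tp (lt_le_trans tT).
apply: le_trans (superposition_ge (tau := fun s => t - s) t01 xt _) _.
  by move=> s /andP[s0 st]; apply/andP; split; lra.
rewrite integral_mkcond; apply: ge0_le_integral_any => s _.
  apply: erestrict_ge0 => u _; rewrite mule_ge0 ?lee_fin ?logpow_ge0//.
  apply: heatS_ge0; first by move=> *; exact: dkernel_ge0.
  by move=> y; rewrite lee_fin.
rewrite patchE; case: ifPn => [/set_mem|_]; last first.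
  by apply: integral_ge0 => y _; rewrite mule_ge0 ?poweR_ge0 ?lee_fin ?dkernel_ge0.
rewrite /= in_itv/= => /andP[s0 st].
have sT : 0 < s < T.
  rewrite s0 (lt_trans st)// (le_lt_trans _ tT)//.
  by rewrite ler_pdivrMr// ler_peMr ?ltW// ltr1n.
rewrite -SZ.
rewrite le_eqVlt; apply/orP; left; apply/eqP; apply: eq_integral => y _ /=.
congr (_ * _)%E; rewrite /bump /= sT poweR_EFin -EFinM; congr EFin.
rewrite powRM ?logpow_ge0// logpow_powR ap thp; congr (_ * _).
rewrite !indicE in_parabolic_cube; case: (y \in scube N.+1 s); first by rewrite powR1.
by rewrite powR0// gt_eqF// (lt_trans ltr01 p1).
Qed.

End subsolution.

Section data.
Context {R : realType}.
Local Notation leb := (@lebesgue_measure R).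

Lemma logpow0r (a s : R) : logpow a 0 s = s `^ (- a).
Proof. by rewrite /logpow oppr0 powRr0 mulr1. Qed.

Lemma integral_powR_le (c t : R) : 0 < c -> 0 < t ->
  (\int[leb]_(s in `]0%R, t[) (s `^ (c - 1))%:E <= (t `^ c / c)%:E)%E.
Proof.
move=> c0 t0.
apply: (@integral_derive_le _ (fun s => s `^ c / c) _ (t + 1)).
- exact: t0.
- by rewrite ltrDl.
- by move=> s /andP[s0 _]; apply: is_derive_powR_div; rewrite ?gt_eqF.
- by move=> s /andP[s0 _]; exact: continuous_powR.
- by move=> s _; exact: powR_ge0.
- by move=> s _; rewrite divr_ge0 ?powR_ge0 ?ltW.
- exact: measurable_powR.
Qed.

Lemma logpow1E (q s : R) : 0 < s -> logpow 1 q s = s^-1 * (- ln s) `^ (- q).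
Proof. by move=> s0; rewrite /logpow powR_inv1// ltW. Qed.

Lemma integral_logpow1_le (c t : R) : 0 < c -> 0 < t < 1 ->
  (\int[leb]_(s in `]0%R, t[) (logpow 1 (c + 1) s)%:E <= ((- ln t) `^ (- c) / c)%:E)%E.
Proof.
move=> c0 /andP[t0 t1].
have E s : 0 < s -> logpow 1 (c + 1) s = s^-1 * (- ln s) `^ (- c - 1).
  by move=> s0; rewrite logpow1E// opprD.
have -> : (\int[leb]_(s in `]0%R, t[) (logpow 1 (c + 1) s)%:E =
    \int[leb]_(s in `]0%R, t[) (s^-1 * (- ln s) `^ (- c - 1))%:E)%E.
  by apply: eq_integral => s; rewrite inE/= in_itv/= => /andP[s0 _]; rewrite E.
apply: (@integral_derive_le _ (fun s => (- ln s) `^ (- c) / c) _ 1).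
- exact: t0.
- exact: t1.
- by move=> s /andP[s0 s1]; apply: is_derive_Nln_powR_div; rewrite ?gt_eqF.
- by move=> s /andP[s0 s1]; exact: continuous_Nln_powR.
- by move=> s /andP[s0 _]; rewrite mulr_ge0 ?powR_ge0// invr_ge0 ltW.
- by move=> s _; rewrite divr_ge0 ?powR_ge0 ?ltW.
- apply: measurable_funM; first exact: measurable_invr.
  apply: (measurableT_comp (measurable_powR _)).
  exact: (measurableT_comp (@oppr_measurable R setT) (@measurable_ln R)).
Qed.

Lemma Nln_sqr (s : R) : 0 < s -> - ln (s ^+ 2) = 2 * - ln s.
Proof. by move=> s0; rewrite lnXn// mulrN mulr_natl. Qed.

Lemma le_subset_integral_itv (f : R -> R) (a b t : R) : 0 < a -> b < t ->
  (forall s, 0 <= f s) ->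
  (\int[leb]_(s in `[a, b]) (f s)%:E <= \int[leb]_(s in `]0%R, t[) (f s)%:E)%E.
Proof.
move=> a0 bt f0; rewrite integral_mkcond [leRHS]integral_mkcond.
apply: ge0_le_integral_any => s _; first by apply: erestrict_ge0 => ? _; rewrite lee_fin.
rewrite !patchE; case: ifPn => [/set_mem|_]; last by case: ifP => // _; rewrite lee_fin.
rewrite /= in_itv/= => /andP[as_ sb].
by rewrite mem_set//= in_itv/= (lt_le_trans a0 as_) (le_lt_trans sb bt).
Qed.

Lemma mul_Nln_le (t s : R) : 0 < t -> t <= s -> s <= 1 / 4 -> t * - ln t <= s * - ln s.
Proof.
move=> t0 ts s4; have s0 : 0 < s by exact: lt_le_trans ts.
have ls := Nln_ge1 s0 s4.
have h : - ln t - - ln s <= s / t - 1.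
  rewrite opprK addrC -ln_div ?posrE//.
  by rewrite lerBrDr addrC; have := expR_ge1Dx (ln (s / t)); rewrite lnK ?posrE ?divr_gt0.
have st1 : 1 <= s / t by rewrite ler_pdivlMr// mul1r.
have sE : s = t * (s / t) by rewrite mulrC divfK// gt_eqF.
rewrite {1}sE -mulrA ler_wpM2l ?(ltW t0)//; nra.
Qed.

Lemma heatS_ext N (f g : N.-tuple R -> R) z : (forall y, 0 < lastc y -> f y = g y) ->
  heatS (@lebesgueT R N) (@dkernel R N) (EFin \o f) z =
  heatS (@lebesgueT R N) (@dkernel R N) (EFin \o g) z.
Proof.
move=> fg; apply: eq_integral => y _ /=.
have [y0|y0] := ltP 0 (lastc y); first by rewrite fg.
by rewrite /dkernel [X in [&& _, X & _]]ltNge y0 andbF !mul0e.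
Qed.

Lemma critical_logpow_far (d t s : R) : 1 <= d -> 0 < t < 1 / 4 -> t < s -> s < 1 / 4 ->
  logpow (d + 0) (d + 1 + - 2^-1) s <= logpow (d + 0) (d - 2^-1) t.
Proof.
move=> d1 /andP[t0 t4] ts s4; have s0 : 0 < s by exact: lt_trans ts.
have ls := Nln_ge1 s0 (ltW s4); have lt_ := Nln_ge1 t0 (ltW t4).
have ls0 : 0 < - ln s by lra.
have lt0 : 0 < - ln t by lra.
rewrite addr0; pose g := d - 2^-1; rewrite -/g.
have E u : 0 < u -> 0 < - ln u -> logpow d g u = (u * - ln u) `^ (- g) * u `^ (- 2^-1).
  move=> u0 l0; rewrite powRM ?(ltW u0) ?(ltW l0)// mulrAC -powRD; last first.
    by apply/implyP => _; rewrite gt_eqF.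
  by rewrite /logpow; congr (_ `^ _ * _); rewrite /g; ring.
apply: (@le_trans _ _ (logpow d g s)).
  rewrite /logpow ler_wpM2l ?powR_ge0// ler_powR// /g; lra.
rewrite !E//; apply: ler_pM; rewrite ?powR_ge0//.
  apply: powRN_le; [rewrite /g; lra|exact: mulr_gt0|].
  by apply: mul_Nln_le; rewrite // ltW.
by apply: powRN_le => //; exact: ltW.
Qed.

Lemma critical_logpow_near (d t : R) : 1 <= d -> 0 < t < 1 / 4 ->
  (\int[leb]_(s in `]0%R, (2 * t)%R[) (logpow (d + 0 + 1 - d) (d + 1 + - 2^-1) s)%:E
    <= (2 `^ (d - 2^-1) / (d - 2^-1) * (t `^ d * logpow (d + 0) (d - 2^-1) t))%:E)%E.
Proof.
move=> d1 /andP[t0 t4]; have lt_ := Nln_ge1 t0 (ltW t4).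
pose g := d - 2^-1; rewrite -/g; have g0 : 0 < g by rewrite /g; lra.
have -> : d + 0 + 1 - d = 1 by ring.
have -> : d + 1 + - 2^-1 = g + 1 by rewrite /g; ring.
have t2 : 0 < 2 * t < 1 by apply/andP; split; lra.
apply: (le_trans (integral_logpow1_le g0 t2)); rewrite lee_fin.
have -> : t `^ d * logpow (d + 0) g t = (- ln t) `^ (- g).
  by rewrite mulrC logpowMr// addr0 subrr /logpow oppr0 powRr0 mul1r.
rewrite [leRHS]mulrAC ler_wpM2r ?invr_ge0 ?(ltW g0)//.
have h : - ln t / 2 <= - ln (2 * t).
  rewrite ler_pdivrMr// mulrC -Nln_sqr; last by lra.
  apply: Nln_le; first by rewrite exprn_gt0//; lra.
  nra.
apply: (@le_trans _ _ ((- ln t / 2) `^ (- g))).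
  by apply: powRN_le => //; [exact: ltW|lra].
rewrite powRM ?invr_ge0//; last by lra.
by rewrite -[2^-1]powR_inv1// -powRrM mulN1r opprK mulrC.
Qed.

Lemma critical_logpow_int (d t : R) : 1 <= d -> 0 < t < 1 / 4 ->
  (\int[leb]_(s in `]0%R, t[)
     (logpow (d * d^-1 - 0) ((d - 2^-1 - - 2^-1) * d^-1 - - 2^-1) s)%:E
    <= (2 / logpow 0 (- 2^-1) t)%:E)%E.
Proof.
move=> d1 /andP[t0 t4]; have d0 : d != 0 by rewrite gt_eqF// (lt_le_trans ltr01).
have -> : d * d^-1 - 0 = 1 by rewrite divff// subr0.
have -> : (d - 2^-1 - - 2^-1) * d^-1 - - 2^-1 = 2^-1 + 1 by field.
have h0 : 0 < 2^-1 :> R by [].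
have t1 : 0 < t < 1 by apply/andP; split; lra.
apply: (le_trans (integral_logpow1_le h0 t1)).
rewrite lee_fin logpowV !oppr0 /logpow oppr0 powRr0 mul1r !opprK invrK mulrC.
by rewrite lexx.
Qed.

Lemma critical_logpow_low (d t : R) : 1 <= d -> 0 < t <= 1 / 4 ->
  (((1 - 2 `^ (- d)) / d * 2 `^ (- d) * (t `^ d * logpow d d t))%:E <=
   \int[leb]_(s in `]0%R, (t / 2)%R[) (logpow (d + 1 - d) (d + 1) s)%:E)%E.
Proof.
move=> d1 /andP[t0 t4]; have d0 : 0 < d by exact: lt_le_trans ltr01 d1.
have -> : d + 1 - d = 1 by ring.
have -> : t `^ d * logpow d d t = (- ln t) `^ (- d).
  by rewrite mulrC logpowMr// subrr /logpow oppr0 powRr0 mul1r.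
pose a := (t / 4) ^+ 2; have a0 : 0 < a by rewrite exprn_gt0// divr_gt0.
have lt_ := Nln_ge1 t0 t4.
have at_ : a < t / 4 by rewrite /a; nra.
have t41 : t / 4 < 1 by lra.
have t42 : t / 4 < t / 2 by lra.
apply: le_trans (le_subset_integral_itv a0 t42 _); last by move=> s; exact: logpow_ge0.
have -> : (\int[leb]_(s in `[a, (t / 4)%R]) (logpow 1 (d + 1) s)%:E =
    \int[leb]_(s in `[a, (t / 4)%R]) (s^-1 * (- ln s) `^ (- d - 1))%:E)%E.
  apply: eq_integral => s; rewrite inE/= in_itv/= => /andP[as_ _].
  by rewrite logpow1E ?opprD// (lt_le_trans a0).
have dP (s : R) : 0 < s < 1 ->
    is_derive s 1 (fun x : R => (- ln x) `^ (- d) / d) (s^-1 * (- ln s) `^ (- d - 1)).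
  by move=> /andP[s0 s1]; apply: is_derive_Nln_powR_div; rewrite ?gt_eqF.
have cP (s : R) : 0 < s < 1 -> {for s, continuous (fun x : R => x^-1 * (- ln x) `^ (- d - 1))}.
  by move=> /andP[s0 s1]; exact: continuous_Nln_powR.
rewrite (integral_derive a0 at_ t41 dP cP) -EFinB lee_fin -mulrBl /a Nln_sqr; last by rewrite divr_gt0.
set L := - ln (t / 4).
have L0 : 0 < L by rewrite Nln_gt0// divr_gt0.
have LE : L <= 2 * - ln t.
  by rewrite -Nln_sqr// /L; apply: Nln_le; [rewrite exprn_gt0|nra].
have P2 : 2 `^ (- d) <= 1 :> R.
  by rewrite -[leRHS](powRr0 2) ler_powR ?ler1n// oppr_le0 ltW.
have -> : L `^ (- d) - (2 * L) `^ (- d) = (1 - 2 `^ (- d)) * L `^ (- d).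
  by rewrite powRM ?(ltW L0)// mulrBl mul1r.
rewrite -!mulrA ler_wpM2l ?subr_ge0// mulrC ler_wpM2r ?invr_ge0 ?(ltW d0)//.
rewrite -powRM//; last by lra.
by apply: powRN_le => //; exact: ltW.
Qed.

Lemma supercritical_logpow_near (d al t : R) : al < d -> 0 < t ->
  (\int[leb]_(s in `]0%R, (2 * t)%R[) (logpow (al + 1 - d) 0 s)%:E
    <= (2 `^ (d - al) / (d - al) * (t `^ d * logpow al 0 t))%:E)%E.
Proof.
move=> ad t0; pose c := d - al; rewrite -/c; have c0 : 0 < c by rewrite subr_gt0.
have -> : (\int[leb]_(s in `]0%R, (2 * t)%R[) (logpow (al + 1 - d) 0 s)%:E =
    \int[leb]_(s in `]0%R, (2 * t)%R[) (s `^ (c - 1))%:E)%E.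
  by apply: eq_integral => s _; rewrite logpow0r; congr (_ `^ _)%:E; rewrite /c; ring.
have t2 : 0 < 2 * t by exact: mulr_gt0.
apply: (le_trans (integral_powR_le c0 t2)); rewrite lee_fin.
have -> : t `^ d * logpow al 0 t = t `^ c.
  by rewrite logpow0r -powRD//; apply/implyP => _; rewrite gt_eqF.
by rewrite powRM ?(ltW t0)// mulrAC.
Qed.

Lemma supercritical_logpow_int (e t : R) : 0 < e -> 0 < t ->
  (\int[leb]_(s in `]0%R, t[) (logpow (1 - e) 0 s)%:E
    <= (e^-1 / logpow e 0 t)%:E)%E.
Proof.
move=> e0 t0.
have -> : (\int[leb]_(s in `]0%R, t[) (logpow (1 - e) 0 s)%:E =
    \int[leb]_(s in `]0%R, t[) (s `^ (e - 1))%:E)%E.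
  by apply: eq_integral => s _; rewrite logpow0r opprB.
apply: (le_trans (integral_powR_le e0 t0)).
by rewrite logpow0r -powRN opprK mulrC.
Qed.

Lemma supercritical_logpow_low (d a t : R) : a < d -> 0 < t ->
  (((4^-1 `^ (d - a) - 8^-1 `^ (d - a)) / (d - a) * (t `^ d * logpow a 0 t))%:E <=
   \int[leb]_(s in `]0%R, (t / 2)%R[) (logpow (a + 1 - d) 0 s)%:E)%E.
Proof.
move=> ad t0; pose c := d - a; rewrite -/c; have c0 : 0 < c by rewrite subr_gt0.
have t8 : 0 < t / 8 by rewrite divr_gt0.
have t84 : t / 8 < t / 4 by lra.
have t42 : t / 4 < t / 2 by lra.
apply: le_trans (le_subset_integral_itv t8 t42 _); last by move=> s; exact: logpow_ge0.
have -> : (\int[leb]_(s in `[(t / 8)%R, (t / 4)%R]) (logpow (a + 1 - d) 0 s)%:E =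
    \int[leb]_(s in `[(t / 8)%R, (t / 4)%R]) (s `^ (c - 1))%:E)%E.
  by apply: eq_integral => s _; rewrite logpow0r; congr (_ `^ _)%:E; rewrite /c; ring.
have dP (s : R) : 0 < s < t -> is_derive s 1 (fun x : R => x `^ c / c) (s `^ (c - 1)).
  by move=> /andP[s0 _]; apply: is_derive_powR_div; rewrite ?gt_eqF.
have cP (s : R) : 0 < s < t -> {for s, continuous (fun x : R => x `^ (c - 1))}.
  by move=> /andP[s0 _]; exact: continuous_powR.
have t4t : t / 4 < t by lra.
rewrite (integral_derive t8 t84 t4t dP cP) -EFinB lee_fin -mulrBl.
have -> : t `^ d * logpow a 0 t = t `^ c.
  by rewrite logpow0r -powRD//; apply/implyP => _; rewrite gt_eqF.
rewrite !(powRM c (ltW t0))// mulrAC ler_wpM2r ?invr_ge0 ?(ltW c0)//.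
by rewrite mulrC mulrBr.
Qed.

Variable N : nat.
Local Notation D := (N.+2%:R / 2 : R).

Let D1 : 1 <= D.
Proof. by rewrite ler_pdivlMr// mul1r ler_nat. Qed.

Lemma fdata_supercritical (p : R) (y : N.+1.-tuple R) : p_crit N.+2 < p -> 0 < lastc y ->
  fdata p y = profile 1 1 (p - 1)^-1 0 y.
Proof.
move=> hp y0; rewrite /fdata gt_eqF// /profile y0 /= mul1r logpow0r indicE.
have e0 := sqrtr_ge0 (\sum_(i < N.+1) tnth y i ^+ 2).
have -> : (y \in ballO (origin N.+1) 1) = (enorm y ^+ 2 < 1).
  rewrite expr_lt1//; apply/idP/idP => [/set_mem[]|H].
    by rewrite /eball /= enorm_sub0.
  by apply/mem_set; split; [rewrite /eball/= enorm_sub0|exact: ltW].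
have -> : (enorm y ^+ 2) `^ (- (p - 1)^-1) = enorm y `^ (- (2 / (p - 1))).
  by rewrite -powR_mulrn// -powRrM mulrN.
by case: ifP => _; rewrite ?mulr1 ?mulr0.
Qed.

Lemma fdata_critical (y : N.+1.-tuple R) : 0 < lastc y ->
  fdata (p_crit N.+2) y = profile (2 `^ (D + 1)) (1 / 4) D (D + 1) y.
Proof.
move=> y0; rewrite /fdata eqxx /profile y0 /= /logpow indicE.
have e0 : 0 < enorm y.
  by have := enorm_sqr_gt0 y0; rewrite exprn_even_gt0//= lt_def sqrtr_ge0 andbT.
have -> : (y \in ballO (origin N.+1) (1 / 2)) = (enorm y ^+ 2 < 1 / 4).
  have -> : 1 / 4 = (1 / 2) ^+ 2 :> R by field.
  rewrite ltr_pXn2r ?nnegrE ?(ltW e0)//.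
  apply/idP/idP => [/set_mem[]|H].
    by rewrite /eball /= enorm_sub0.
  by apply/mem_set; split; [rewrite /eball/= enorm_sub0|exact: ltW].
case: ifPn => [e4|]; last by rewrite mulr0.
rewrite mulr1 Nln_sqr//.
have l0 : 0 <= - ln (enorm y).
  have := Nln_ge1 (enorm_sqr_gt0 y0) (ltW e4); rewrite Nln_sqr//; lra.
have -> : `|ln (enorm y)| = - ln (enorm y) by rewrite ler0_norm// -oppr_ge0.
have -> : (enorm y ^+ 2) `^ (- D) = enorm y `^ (- N.+2%:R).
  by rewrite -powR_mulrn ?(ltW e0)// -powRrM; congr (_ `^ _); field.
rewrite (powRM _ (_ : 0 <= 2) l0)// [RHS]mulrCA; congr (_ * _).
rewrite mulrA -powRD; last by apply/implyP => _; rewrite gt_eqF.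
rewrite subrr powRr0 mul1r; congr (_ `^ _); ring.
Qed.

Lemma supercritical_exponent (p : R) : p_crit N.+2 < p ->
  [/\ 1 < p, 0 < (p - 1)^-1 & (p - 1)^-1 < D].
Proof.
rewrite /p_crit => hp; have N0 : 0 < N.+2%:R :> R by [].
have h0 : 0 < 2 / N.+2%:R :> R by rewrite divr_gt0.
have p1 : 0 < p - 1 by rewrite subr_gt0 (lt_trans _ hp)// ltrDl.
split; [by rewrite -subr_gt0|by rewrite invr_gt0|].
by rewrite -[D]invrK ltf_pV2 ?posrE ?invr_gt0 ?divr_gt0// invf_div ltrBrDl.
Qed.

Lemma critical_exponent : 1 < p_crit N.+2 :> R /\ p_crit N.+2 - 1 = D^-1 :> R.
Proof.
rewrite /p_crit; split; first by rewrite ltrDl divr_gt0.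
by rewrite invf_div; ring.
Qed.

Definition data_barrier_for (p : R) (f : N.+1.-tuple R -> R) :=
  exists (K : R) (w : N.+1.-tuple R * R -> \bar R),
  [/\ 0 <= K, (forall z, 0 <= w z)%E,
    measurable_fun setT (w : N.+1.-tuple R * measurableTypeR R -> \bar R) &
    forall x (t : R), 0 < t < 1 / 4 ->
      [/\ (heatS (@lebesgueT R N.+1) (@dkernel R N.+1) (EFin \o f) (x, t)
             <= w (x, t))%E, (w (x, t) < +oo)%E &
        (duhamel (@lebesgueT R N.+1) (@dkernel R N.+1) p w (x, t) <= K%:E * w (x, t))%E]].

Lemma supercritical_barrier (p : R) : p_crit N.+2 < p ->
  data_barrier_for p (profile 1 1 (p - 1)^-1 0).
Proof.
move=> hp; have [p1 a0 aD] := supercritical_exponent hp.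
pose d := D; rewrite -/d in aD; pose a := (p - 1)^-1; rewrite -/a in a0 aD *.
have ap : a * (p - 1) = 1 by rewrite mulVf// gt_eqF// subr_gt0.
pose e := (d - a) / 2; have e0 : 0 < e by rewrite divr_gt0// subr_gt0.
have al0 : 0 < a + e by exact: addr_gt0.
have ald : a + e < d by rewrite /e; lra.
pose C0 := 2 `^ (d - (a + e)) / (d - (a + e)).
have C00 : 0 <= C0 by rewrite divr_ge0 ?powR_ge0// subr_ge0 ltW.
pose C := 1 + C0 + e^-1.
have eV : 0 <= e^-1 by rewrite invr_ge0 ltW.
have C1 : 1 <= C by rewrite /C -addrA lerDl addr_ge0.
have C2 : C0 <= C by rewrite /C addrAC lerDr addr_ge0.
have C3 : e^-1 <= C by rewrite /C lerDr addr_ge0.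
apply: (@exists_barrier R N p 1 1 a 0 e 0 0 C) => //.
- exact: le_trans ler01 C1.
- exact: ltW.
- by move=> r s r_gt0 rs _; rewrite !logpow0r; apply: powRN_le => //; exact: ltW.
- move=> r r_gt0 r1; rewrite logpow0r; apply: (@le_trans _ _ (1 `^ (- e))); first by rewrite powR1.
  by apply: powRN_le => //; exact: ltW.
- move=> r r_gt0 r1; rewrite mul1r logpow_powR ap mul0r logpow0r powR_inv1 ?(ltW r_gt0)//.
  by rewrite mulVf// gt_eqF.
- move=> t s /andP[t0 t4] ts s1; rewrite addr0 !logpow0r.
  apply: (@le_trans _ _ (t `^ (- (a + e)))).
    by apply: powRN_le => //; exact: ltW.
  by rewrite ler_peMl ?powR_ge0.
- move=> t /andP[t0 t4]; rewrite addr0.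
  apply: (le_trans (supercritical_logpow_near ald t0)); rewrite lee_fin.
  by rewrite ler_wpM2r// mulr_ge0 ?powR_ge0 ?logpow_ge0.
- move=> t /andP[t0 t4]; rewrite ap !subr0 mul0r.
  apply: (le_trans (supercritical_logpow_int e0 t0)); rewrite lee_fin.
  by rewrite ler_wpM2r// invr_ge0 logpow_ge0.
Qed.

Lemma critical_barrier :
  data_barrier_for (p_crit N.+2) (profile (2 `^ (D + 1)) (1 / 4) D (D + 1)).
Proof.
have [p1 pD] := critical_exponent.
have := D1; move: pD; set d := D => pD d1.
pose g := d - 2^-1; have g0 : 0 < g by rewrite /g; lra.
pose c : R := 2 `^ (d + 1); have c0 : 0 < c by exact: powR_gt0.
have c10 : 0 <= c `^ (d^-1) by exact: powR_ge0.
have c20 : 0 <= 2 `^ g / g by rewrite divr_ge0 ?powR_ge0 ?ltW.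
pose C := c `^ (d^-1) + 2 `^ g / g + 2.
have C1 : c `^ (d^-1) <= C by rewrite /C; lra.
have C2 : 2 `^ g / g <= C by rewrite /C; lra.
have C3 : 2 <= C by rewrite /C; lra.
apply: (@exists_barrier R N (p_crit N.+2) c (1 / 4) d (d + 1) 0 (- 2^-1) g C) => //;
  try by lra.
- move=> r s r0 rs s4; rewrite /logpow !oppr0 !powRr0 !mul1r opprK.
  have s0 : 0 < s by exact: lt_le_trans rs.
  apply: ge0_powR_le => //; last exact: Nln_le.
  by have := Nln_ge1 s0 (ltW s4); lra.
- move=> r r0 r4; rewrite /logpow oppr0 powRr0 mul1r opprK; apply: (@le_trans _ _ (1 `^ (2^-1))); first by rewrite powR1.
  by apply: ge0_powR_le => //; exact: Nln_ge1 (ltW r4).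
- move=> r r0 r4; rewrite powRM ?logpow_ge0 ?(ltW c0)// pD logpow_powR divff; last first.
    by rewrite gt_eqF// (lt_le_trans ltr01).
  rewrite logpow1E// -!mulrA [_ * r]mulrC mulKf ?gt_eqF//.
  apply: le_trans C1; rewrite ler_piMr//.
  have lr := Nln_ge1 r0 (ltW r4).
  rewrite -[leRHS](powRr0 (- ln r)); apply: ler_powR => //.
  rewrite oppr_le0 mulr_ge0 ?invr_ge0//; lra.
- move=> t s t4 ts s4; apply: le_trans (critical_logpow_far d1 t4 ts s4) _.
  by rewrite ler_peMl ?logpow_ge0//; lra.
- move=> t t4; apply: le_trans (critical_logpow_near d1 t4) _; rewrite lee_fin.
  by rewrite ler_wpM2r// mulr_ge0 ?powR_ge0 ?logpow_ge0.
- move=> t t4; rewrite pD; apply: le_trans (critical_logpow_int d1 t4) _; rewrite lee_fin.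
  by rewrite ler_wpM2r// invr_ge0 logpow_ge0.
Qed.

Lemma exists_data_barrier (p : R) : p_crit N.+2 <= p -> data_barrier_for p (fdata p).
Proof.
have transfer f : (forall y, 0 < lastc y -> fdata p y = f y) ->
    data_barrier_for p f -> data_barrier_for p (fdata p).
  move=> fE [K [w [K0 w0 mw H]]]; exists K, w; split => // x t t4.
  by have [h1 h2 h3] := H x t t4; split => //; rewrite (heatS_ext _ fE).
rewrite le_eqVlt => /predU1P[pE|hp].
  apply: transfer; last by rewrite -pE; exact: critical_barrier.
  by move=> y y0; rewrite -pE fdata_critical.
apply: transfer; last exact: supercritical_barrier.
by move=> y y0; rewrite fdata_supercritical.
Qed.

Definition subsolution_for (p : R) (f : N.+1.-tuple R -> R) :=
  exists (k1 k2 t0 a th : R), [/\ 0 < k1, 0 < k2, 0 < t0 <= 1 &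
    forall T z, T <= t0 ->
    (k1%:E * bump T a th z <=
      heatS (@lebesgueT R N.+1) (@dkernel R N.+1) (EFin \o f) z)%E /\
    (k2%:E * bump T a th z <=
      duhamel (@lebesgueT R N.+1) (@dkernel R N.+1) p (bump T a th) z)%E].

Lemma subsolution_profile (p c r0 a q th c3 : R) :
  1 < p -> 0 < c -> 0 < r0 -> r0 <= 1 -> 0 <= a -> 0 <= q -> 0 < c3 ->
  a * p = a + 1 -> th * p = q ->
  (forall t : R, 0 < t < r0 / (4 * N.+1%:R) ->
    ((c3 * (t `^ D * logpow a th t))%:E <=
     \int[leb]_(s in `]0%R, (t / 2)%R[) (logpow (a + 1 - D) q s)%:E)%E) ->
  subsolution_for p (profile c r0 a q).
Proof.
move=> p1 c0 r00 r01 a0 q0 c30 ap thp low.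
have K0 : 0 < 4 * N.+1%:R :> R by rewrite mulr_gt0.
have cc := mulr_gt0 (cube_cst_gt0 N : 0 < cube_cst N :> R) c30.
exists (c / (4 * N.+1%:R) `^ (a + 1) * (cube_cst N * c3)), (cube_cst N * c3),
  (r0 / (4 * N.+1%:R)), a, th; split => //.
- by rewrite mulr_gt0// divr_gt0// powR_gt0.
- rewrite divr_gt0//= ler_pdivrMr// mul1r (le_trans r01)//.
  have : 1 <= N.+1%:R :> R by rewrite ler1n.
  by lra.
move=> T z Tt0; split; first exact: (bump_le_heatS c0 r01 a0 q0 low z Tt0).
exact: (bump_le_duhamel p1 ap thp low z Tt0).
Qed.

Lemma exists_data_subsolution (p : R) : p_crit N.+2 <= p -> subsolution_for p (fdata p).
Proof.
have transfer f : (forall y, 0 < lastc y -> fdata p y = f y) ->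
    subsolution_for p f -> subsolution_for p (fdata p).
  move=> fE [k1 [k2 [t0 [a [th [k10 k20 t00 H]]]]]]; exists k1, k2, t0, a, th; split => //.
  by move=> T z Tt0; have [h1 h2] := H T z Tt0; split => //; rewrite (heatS_ext _ fE).
rewrite le_eqVlt => /predU1P[pE|hp].
  apply: (transfer (profile (2 `^ (D + 1)) (1 / 4) D (D + 1))).
    by move=> y y0; rewrite -pE fdata_critical.
  have [p1 pD] := critical_exponent.
  have d0 : 0 < D by exact: lt_le_trans ltr01 D1.
  rewrite pE in p1 pD.
  have pE' : p = 1 + D^-1 by rewrite -pD addrC subrK.
  have apD : D * p = D + 1 by rewrite pE' mulrDr mulr1 divff// gt_eqF.
  have P2 : 2 `^ (- D) < 1 :> R.
    rewrite powRN invf_lt1 ?powR_gt0//; apply: (@le_lt_trans _ _ (1 `^ D)).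
      by rewrite powR1.
    by apply: gt0_ltr_powR; rewrite ?nnegrE// ltr1n.
  apply: (@subsolution_profile p (2 `^ (D + 1)) (1 / 4) D (D + 1) D
    ((1 - 2 `^ (- D)) / D * 2 `^ (- D))) => //.
  - by rewrite ler_pdivrMr// mul1r ler1n.
  - by rewrite !mulr_gt0 ?powR_gt0 ?invr_gt0// subr_gt0.
  - move=> t /andP[t0 t4]; apply: critical_logpow_low; first exact: D1.
    rewrite t0 (le_trans (ltW t4))// ler_pdivrMr ?mulr_gt0// ler_peMr//.
    have : 1 <= N.+1%:R :> R by rewrite ler1n.
    by lra.
have [p1 a0 aD] := supercritical_exponent hp.
apply: (transfer (profile 1 1 (p - 1)^-1 0)).
  by move=> y y0; rewrite fdata_supercritical.
have ap : (p - 1)^-1 * p = (p - 1)^-1 + 1.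
  have n0 : p - 1 != 0 by rewrite gt_eqF// subr_gt0.
  by rewrite -[X in _ * X](subrK 1) mulrDr mulr1 mulVf// addrC.
apply: (@subsolution_profile p 1 1 (p - 1)^-1 0 0
  ((4^-1 `^ (D - (p - 1)^-1) - 8^-1 `^ (D - (p - 1)^-1)) / (D - (p - 1)^-1))) => //.
- exact: ltW.
- rewrite divr_gt0 ?subr_gt0//; apply: gt0_ltr_powR; rewrite ?nnegrE ?subr_gt0//.
  by rewrite ltf_pV2 ?posrE// ltr_nat.
- by rewrite mul0r.
- by move=> t /andP[t0 _]; exact: supercritical_logpow_low.
Qed.

End data.

Section density.
Local Open Scope ereal_scope.
Context d (T : measurableType d) {R : realType} (mu nu : {measure set T -> \bar R}).
Variable h : T -> R.
Hypotheses (mh : measurable_fun setT h) (h0 : forall y, (0 <= h y)%R).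
Hypothesis nuE : forall A, measurable A -> nu A = \int[mu]_(y in A) (h y)%:E.

Import HBNNSimple.

Let integral_density_nnsfun (F : {nnsfun T >-> R}) :
  \int[nu]_y (F y)%:E = \int[mu]_y ((F y)%:E * (h y)%:E).
Proof.
have mhE : measurable_fun setT (EFin \o h) by exact/measurable_EFinP.
rewrite integralT_nnsfun sintegralE.
have E (y : T) : (F y)%:E * (h y)%:E =
    \sum_(r \in range F) (r%:E * (\1_(F @^-1` [set r]) y)%:E * (h y)%:E).
  rewrite {1}fimfunE -fsumEFin// ge0_mule_fsuml//.
  by move=> r; rewrite EFinM; exact: nnfun_muleindic_ge0.
under [RHS]eq_integral do rewrite E.
have m1 (r : R) : measurable_fun setT (fun y => (\1_(F @^-1` [set r]) y)%:E : \bar R).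
  by apply/measurable_EFinP; exact: measurable_indic.
rewrite ge0_integral_fsum//; last 2 first.
- by move=> r; apply: emeasurable_funM => //; exact: measurable_funeM.
- by move=> r y _; apply: mule_ge0; [exact: nnfun_muleindic_ge0|rewrite lee_fin].
apply: eq_fsbigr => r; rewrite inE => -[y _ <-{r}].
have Fy0 : (0 <= F y)%R by [].
rewrite nuE//; under [RHS]eq_integral do rewrite -muleA.
rewrite ge0_integralZl ?lee_fin//; last 2 first.
- exact: emeasurable_funM.
- by move=> x _; rewrite mule_ge0 ?lee_fin.
congr (_ * _); rewrite integral_mkcond; apply: eq_integral => x _.
rewrite patchE indicE; case: ifPn => xA; first by rewrite mul1e.
by rewrite mul0e.
Qed.

Lemma integral_density (F : T -> \bar R) : measurable_fun setT F -> (forall y, 0 <= F y) ->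
  \int[nu]_y F y = \int[mu]_y (F y * (h y)%:E).
Proof.
move=> mF F0; pose F_ := nnsfun_approx measurableT mF.
have ndF y : nondecreasing_seq (fun n => (F_ n y)%:E).
  by move=> m n mn; rewrite lee_fin; exact/lefP/nd_nnsfun_approx.
have cF y : (F_ n y)%:E @[n --> \oo] --> F y by apply: cvg_nnsfun_approx.
transitivity (limn (fun n => \int[nu]_y (F_ n y)%:E)).
  rewrite -monotone_convergence//.
  - by apply: eq_integral => y _; apply/esym/cvg_lim => //; exact: cF.
  - by move=> n; exact/measurable_EFinP/measurable_funP.
  - by move=> n y _; rewrite lee_fin.
under eq_fun do rewrite integral_density_nnsfun.
rewrite -monotone_convergence//.
- apply: eq_integral => y _; apply/cvg_lim => //.
  by apply: cvgeZr => //; exact: cF.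
- move=> n; apply: emeasurable_funM; last exact/measurable_EFinP.
  exact/measurable_EFinP/measurable_funP.
- by move=> n y _; rewrite mule_ge0 ?lee_fin.
- by move=> y _ m n mn; apply: lee_wpmul2r; [rewrite lee_fin|exact: ndF].
Qed.

End density.

Section problem_as_kernel_equation.
Context {R : realType} (N : nat).
Local Notation leb := (@lebesgue_measure R).
Local Notation X := (N.+1.-tuple R).
Local Notation S := (heatS (@lebesgueT R N.+1) (@dkernel R N.+1)).
Local Notation Psi := (duhamel (@lebesgueT R N.+1) (@dkernel R N.+1)).
Local Notation dge0 := (@dkernel_ge0 R N.+1).
Local Notation dmeas := (@measurable_dkernel R N.+1).
Implicit Types (p T : R) (kappa : {posnum R}).

Lemma fdata_ge0 p (y : X) : 0 <= fdata p y.
Proof. by rewrite /fdata; case: ifP => _; rewrite !mulr_ge0 ?powR_ge0. Qed.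

Lemma measurable_Omega : measurable (Omega N.+1 : set X).
Proof.
rewrite (_ : Omega N.+1 = @lastc R N.+1 @^-1` `]0, +oo[%classic).
  by rewrite -[X in measurable X]setTI; exact: measurable_lastc.
by apply/seteqP; split=> y /=; rewrite /Omega/= in_itv/= andbT.
Qed.

Lemma measurable_cOmega : measurable (cOmega N.+1 : set X).
Proof.
rewrite (_ : cOmega N.+1 = @lastc R N.+1 @^-1` `[0, +oo[%classic).
  by rewrite -[X in measurable X]setTI; exact: measurable_lastc.
by apply/seteqP; split=> y /=; rewrite /cOmega/= in_itv/= andbT.
Qed.

Lemma measurable_QT T : measurable (QT T : set (X * measurableTypeR R)).
Proof.
apply: measurableX; first exact: measurable_Omega.
exact: measurable_itv.
Qed.

Lemma QTE T (z : X * R) : QT T z <-> [/\ 0 < lastc z.1, 0 < z.2 & z.2 < T].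
Proof.
rewrite /QT /= in_itv/= /Omega /=; split => [[h1 /andP[h2 h3]]|[h1 h2 h3]] //.
by split => //; rewrite h2.
Qed.

Local Open Scope ereal_scope.

Lemma integral_heatK p kappa (x : X) (t : R) : (0 < lastc x)%R -> (0 < t)%R ->
  \int[initial_measure p kappa]_(y in cOmega N.+1) (heatK x y t)%:E =
  (kappa%:num)%:E * S (EFin \o fdata p) (x, t).
Proof.
move=> x0 t0.
pose h (y : X) := (kappa%:num * lastc y * fdata p y)%R.
have mh : measurable_fun setT h.
  apply: measurable_funM; last exact: measurable_fdata.
  by apply: measurable_funM => //; exact: measurable_lastc.
have ml := @measurable_lastc R N.+1.
have mdk : measurable_fun setT (fun y => dkernel x y t).
  have m : measurable_fun setT (fun y : X => ((x, y), t : measurableTypeR R)).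
    by solve_measurable_proj.
  exact: (measurableT_comp dmeas m).
pose F : X -> \bar R := (fun y => (heatK x y t)%:E) \_ (cOmega N.+1).
have F0 y : 0 <= F y.
  apply: erestrict_ge0 => {}y; rewrite /cOmega /= => y0; rewrite lee_fin /heatK.
  case: ifP => [y1|_]; last by rewrite mulr_ge0 ?Gamma_ge0// divr_ge0// ltW.
  by rewrite mulr_ge0 ?invr_ge0// heatG_ge0// ltW.
have mF : measurable_fun setT F.
  apply: (measurable_restrictT (fun y => (heatK x y t)%:E) measurable_cOmega).1.
  apply: measurable_funTS; apply/measurable_EFinP.
  rewrite (_ : (fun y => _) = fun y => if (0 < lastc y)%R
      then ((lastc y)^-1 * dkernel x y t)%R else (lastc x / t * Gamma (subT x y) t)%R).
    apply: measurable_fun_ifT; first exact: measurable_fun_ltr.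
      apply: measurable_funM => //.
      exact: (measurableT_comp measurable_invr ml).
    by apply: measurable_funM => //; exact: measurable_Gamma_subT.
  by apply/funext => y; rewrite /heatK; case: ifPn => // y0; rewrite dkernelE.
rewrite integral_mkcond -/F.
have nuE (A : set X) : measurable A ->
    initial_measure p kappa A = \int[@lebesgueT R N.+1]_(y in A) (h y)%:E by [].
rewrite (integral_density mh (@initial_density_ge0 R N.+1 p kappa) nuE)//.
rewrite -heatSZ//.
- apply: eq_integral => y _; rewrite /F patchE /h /= -EFinM.
  have [y0|y0|y0] := ltgtP 0%R (lastc y).
  + rewrite mem_set; last by rewrite /cOmega/= ltW.
    rewrite /heatK y0 dkernelE// -!EFinM; congr EFin.
    by field; rewrite gt_eqF.
  + rewrite memNset; last by rewrite /cOmega/= leNgt y0.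
    rewrite /dkernel [X in [&& _, X & _]]ltNge (ltW y0) andbF.
    by rewrite mul0r; exact: mul0e.
  + by rewrite -y0 mulr0 mul0r mule0 /dkernel -y0 ltxx andbF mul0r.
- exact: dge0.
- exact: dmeas.
- by apply/measurable_EFinP; exact: measurable_fdata.
- by move=> y; rewrite lee_fin fdata_ge0.
Qed.

Lemma integral_heatG p T (u : X * R -> \bar R) (z : X * R) : (0 < p)%R -> QT T z ->
  \int[leb]_(s in `]0%R, z.2[) \int[@lebesgueT R N.+1]_(y in Omega N.+1)
    ((heatG z.1 y (z.2 - s))%:E * u (y, s) `^ p) =
  Psi p (u \_ (QT T)) z.
Proof.
move=> p0 /QTE[z0 t0 tT]; rewrite integral_mkcond; apply: eq_integral => s _.
rewrite patchE; case: ifPn => [/set_mem|/negP sz].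
  rewrite /= in_itv/= => /andP[s0 st].
  rewrite integral_mkcond; apply: eq_integral => y _; rewrite patchE.
  case: ifPn => [/set_mem y0|/negP y0].
    rewrite dkernelE ?subr_gt0// patchE mem_set//.
    by apply/QTE; split => //=; exact: lt_trans tT.
  rewrite (_ : dkernel _ _ _ = 0%R) ?mul0e//.
  rewrite /dkernel; case: ifP => // /and3P[_ y1 _].
  by exfalso; apply: y0; apply/mem_set.
rewrite integral0_eq// => y _.
have [s0|s0] := ltP 0%R s; last first.
  rewrite patchE memNset ?poweR0r ?mule0 ?gt_eqF//.
  by move=> /QTE[_ /=]; rewrite ltNge s0.
rewrite dkernel_le0 ?mul0e// subr_le0 leNgt; apply/negP => st.
by apply: sz; apply/mem_set; rewrite /= in_itv/= s0.
Qed.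

Definition linear_part p kappa (z : X * R) := (kappa%:num)%:E * S (EFin \o fdata p) z.

Lemma linear_part_ge0 p kappa z : 0 <= linear_part p kappa z.
Proof.
rewrite mule_ge0 ?lee_fin// heatS_ge0//; first exact: dge0.
by move=> y; rewrite lee_fin fdata_ge0.
Qed.

Lemma measurable_linear_part p kappa :
  measurable_fun setT (linear_part p kappa : X * measurableTypeR R -> \bar R).
Proof.
apply: measurable_funeM; apply: measurable_heatS; [exact: dge0|exact: dmeas| |].
- by apply/measurable_EFinP; exact: measurable_fdata.
- by move=> y; rewrite lee_fin fdata_ge0.
Qed.

Let ae_imp (P P' : X * R -> Prop) : (forall z, P z -> P' z) ->
  {ae @lebesgue_xt R N.+1, forall z, P z} -> {ae @lebesgue_xt R N.+1, forall z, P' z}.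
Proof. exact: (@filterS _ _ (ae_filter_ringOfSetsType (@lebesgue_xt R N.+1))). Qed.

Let ae_and (P P' : X * R -> Prop) :
  {ae @lebesgue_xt R N.+1, forall z, P z} -> {ae @lebesgue_xt R N.+1, forall z, P' z} ->
  {ae @lebesgue_xt R N.+1, forall z, P z /\ P' z}.
Proof. exact: (@filterI _ _ (ae_filter_ringOfSetsType (@lebesgue_xt R N.+1))). Qed.

Lemma has_local_solution_of_supersolution p kappa T (w : X * R -> \bar R) :
  (1 < p)%R -> (0 < T)%R -> (forall z, 0 <= w z) ->
  {ae @lebesgue_xt R N.+1, forall z, QT T z -> linear_part p kappa z + Psi p w z <= w z} ->
  {ae @lebesgue_xt R N.+1, forall z, QT T z -> w z < +oo} ->
  has_local_solution p (@initial_measure R N.+1 p kappa).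
Proof.
move=> p1 T0 w0 super wfin.
have [u [mu u0 uw uQ uE]] := solution_of_supersolution dge0 dmeas p1 (measurable_QT T)
  (measurable_linear_part p kappa) (linear_part_ge0 p kappa) w0 super.
exists T; split => //; exists u; split.
  split.
  - by move=> z _; exact: u0.
  - move=> Y mY; exists (QT T `&` u @^-1` Y); last first.
      by exists set0; [exact: negligible_set0|rewrite setU0].
    apply: measurableI; first exact: measurable_QT.
    by rewrite -[X in measurable X]setTI; exact: mu.
  - by apply: ae_imp (ae_and uw wfin) => z [uz wz] /wz; exact: le_lt_trans.
have uQT : u = u \_ (QT T).
  apply/funext => z; rewrite patchE; case: ifPn => // /negP Qz.
  by apply: uQ => /mem_set.
apply: aeW => z Qz; have [z0 t0 tT] := (QTE T z).1 Qz.
rewrite (integral_heatG u (lt_trans ltr01 p1) Qz) -uQT (uE _ Qz).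
by rewrite (integral_heatK p kappa z0 t0) -surjective_pairing.
Qed.

Lemma kernel_equation_of_solution p kappa T (u : X * R -> \bar R) : (1 < p)%R ->
  is_solution p (@initial_measure R N.+1 p kappa) T u ->
  [/\ forall z, 0 <= (u \_ (QT T)) z,
    {ae @lebesgue_xt R N.+1, forall z, QT T z -> (u \_ (QT T)) z < +oo} &
    {ae @lebesgue_xt R N.+1, forall z, QT T z ->
      (u \_ (QT T)) z = linear_part p kappa z + Psi p (u \_ (QT T)) z}].
Proof.
move=> p1 [[u0 _ ufin] uE]; split.
- by move=> z; exact: erestrict_ge0.
- by apply: ae_imp ufin => z uz Qz; rewrite patchE mem_set//; exact: uz.
apply: ae_imp uE => z uz Qz; have [z0 t0 tT] := (QTE T z).1 Qz.
rewrite {1}patchE (mem_set Qz) (uz Qz).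
rewrite (integral_heatG u (lt_trans ltr01 p1) Qz).
by rewrite (integral_heatK p kappa z0 t0) -surjective_pairing.
Qed.

Lemma has_local_solution_le p (k1 k2 : {posnum R}) : (1 < p)%R -> (k1%:num <= k2%:num)%R ->
  has_local_solution p (@initial_measure R N.+1 p k2) ->
  has_local_solution p (@initial_measure R N.+1 p k1).
Proof.
move=> p1 k12 [T [T0 [u usol]]].
have [u0 ufin uE] := kernel_equation_of_solution p1 usol.
apply: (has_local_solution_of_supersolution p1 T0 u0 _ ufin).
apply: ae_imp uE => z uz Qz; rewrite [leRHS]uz//; apply: leeD => //.
apply: lee_wpmul2r; last by rewrite lee_fin.
by apply: heatS_ge0; [exact: dge0|move=> y; rewrite lee_fin fdata_ge0].
Qed.

Lemma has_local_solution_small p : (p_crit N.+2 <= p)%R -> (1 < p)%R ->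
  exists kappa, has_local_solution p (@initial_measure R N.+1 p kappa).
Proof.
move=> hp p1; have [K [w [K0 w0 mw H]]] := exists_data_barrier hp.
pose la : R := ((2 * (K + 1))^-1 `^ (p - 1)^-1)%R.
have K2 : (0 < 2 * (K + 1))%R by rewrite mulr_gt0// ltr_wpDl.
have la0 : (0 < la)%R by rewrite powR_gt0// invr_gt0.
have p10 : (0 < p - 1)%R by rewrite subr_gt0.
have laE : (la `^ (p - 1) = (2 * (K + 1))^-1)%R.
  by rewrite /la -powRrM mulVf ?gt_eqF// powRr1// invr_ge0 ltW.
have laK : (la `^ p * K <= la / 2)%R.
  rewrite -(mulr_powRB1 (ltW la0) (lt_trans ltr01 p1)) laE -mulrA ler_wpM2l ?(ltW la0)//.
  rewrite invfM -mulrA -[leRHS]mulr1 ler_wpM2l// mulrC ler_pdivrMr ?ltr_wpDl// mul1r.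
  by rewrite lerDl.
have la2 : (0 < la / 2)%R by rewrite divr_gt0.
exists (PosNum la2).
apply: (@has_local_solution_of_supersolution p _ (1 / 4)%R (fun z => la%:E * w z)) => //.
- by move=> z; rewrite mule_ge0// lee_fin ltW.
- apply: aeW => -[x t] /QTE[/= x0 t0 t4].
  have [h1 _ h3] := H x t (introT andP (conj t0 t4)).
  rewrite (duhamelZ (@lebesgueT R N.+1) dge0 dmeas p (x, t) (ltW la0) mw w0).
  apply: (@le_trans _ _ ((la / 2)%:E * w (x, t) + (la / 2)%:E * w (x, t))).
    apply: leeD; first by apply: lee_wpmul2l; rewrite // lee_fin ltW.
    apply: (@le_trans _ _ ((la `^ p)%:E * (K%:E * w (x, t)))).
      by apply: lee_wpmul2l; rewrite ?lee_fin ?powR_ge0.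
    by rewrite muleA -EFinM; apply: lee_wpmul2r; rewrite ?lee_fin.
  rewrite -ge0_muleDl ?lee_fin ?(ltW la2)// -EFinD.
  by rewrite (_ : (la / 2 + la / 2 = la)%R)//; field.
- apply: aeW => -[x t] /QTE[/= x0 t0 t4].
  have [_ h2 _] := H x t (introT andP (conj t0 t4)).
  by rewrite lte_mul_pinfty// lee_fin ltW.
Qed.

Lemma bump_support_not_negligible T (a th : R) : (0 < T)%R -> (T <= 1)%R ->
  ~ {ae @lebesgue_xt R N.+1, forall z, ~ 0 < bump T a th z}.
Proof.
move=> T0 T1 [Z [mZ Z0 sub]].
pose tau := (T / 2)%R; have tau0 : (0 < tau)%R by rewrite divr_gt0.
have st0 : (0 < Num.sqrt tau)%R by rewrite sqrtr_gt0.
have st2 : (Num.sqrt tau ^+ 2 = tau)%R by rewrite sqr_sqrtr// ltW.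
pose B := cube N.+1 (3 / 2 * Num.sqrt tau)%R (2 * Num.sqrt tau)%R.
pose J := (`]tau, (3 / 2 * tau)%R[%classic : set (measurableTypeR R)).
have mB : measurable B by exact: measurable_cube.
have mJ : measurable J by exact: measurable_itv.
have BJ : B `*` J `<=` Z.
  move=> [x t] [/= xB]; rewrite /J /= in_itv/= => /andP[t1 t2].
  apply: sub => /= H; apply: H.
  have t0 : (0 < t)%R by exact: lt_trans t1.
  have tT : (t < T)%R by apply: lt_trans t2 _; rewrite /tau; lra.
  apply/bump_gt0; split; last by apply: logpow_gt0; rewrite t0 (lt_le_trans tT).
  split => //= i; have /andP[x1 x2] := xB i; apply/andP; split.
    apply: le_trans x1; rewrite -[leRHS](ger0_norm _) ?mulr_ge0 ?(ltW st0)//.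
    rewrite -sqrtr_sqr ler_wsqrtr// exprMn st2 (le_trans (ltW t2))//.
    by rewrite ler_wpM2r ?(ltW tau0)//; lra.
  by apply: le_trans x2 _; rewrite ler_wpM2l// ler_wsqrtr// ltW.
have BJ0 : 0 < lebesgue_xt N.+1 (B `*` J).
  have -> : lebesgue_xt N.+1 (B `*` J) = @lebesgueT R N.+1 B * leb J.
    exact: product_measure1E.
  rewrite /B lebesgueT_cube; last by rewrite ler_wpM2r ?(ltW st0)//; lra.
  rewrite lebesgue_measure_itv/= lte_fin ltr_pMl// (_ : 1 < 3 / 2)%R; last by lra.
  rewrite -EFinB -EFinM lte_fin mulr_gt0 ?exprn_gt0//; last by rewrite subr_gt0 ltr_pMl//; lra.
  by rewrite subr_gt0 ltr_pM2r//; lra.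
suff BJE : lebesgue_xt N.+1 (B `*` J) = 0 by rewrite BJE ltxx in BJ0.
by apply: (subset_measure0 _ mZ BJ Z0); exact: measurableX.
Qed.

Lemma no_local_solution_large p : (p_crit N.+2 <= p)%R -> (1 < p)%R ->
  exists k0 : R, forall kappa, (k0 < kappa%:num)%R ->
    ~ has_local_solution p (@initial_measure R N.+1 p kappa).
Proof.
move=> hp p1.
have [k1 [k2 [t0 [a [th [k10 k20 /andP[t00 t01] H]]]]]] := exists_data_subsolution hp.
have p10 : (0 < p - 1)%R by rewrite subr_gt0.
exists (k2^-1 `^ (p - 1)^-1 / k1)%R => kappa kk [T [T0 [u usol]]].
have [u0 ufin uE] := kernel_equation_of_solution p1 usol.
pose T' := Num.min T t0.
have T'0 : (0 < T')%R by rewrite lt_min T0.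
have T'T : (T' <= T)%R by rewrite ge_min lexx.
have T't0 : (T' <= t0)%R by rewrite ge_min lexx orbT.
have sub (z : X * R) : QT T' z -> QT T z.
  by move=> /QTE[h1 h2 h3]; apply/QTE; split => //; exact: lt_le_trans T'T.
have big : (1 < k2 * (kappa%:num * k1) `^ (p - 1))%R.
  rewrite mulrC -ltr_pdivrMr// mul1r.
  have -> : (k2^-1)%R = ((k2^-1 `^ (p - 1)^-1) `^ (p - 1))%R.
    by rewrite -powRrM mulVf ?gt_eqF// powRr1// invr_ge0 ltW.
  apply: gt0_ltr_powR; rewrite ?nnegrE ?powR_ge0 ?mulr_ge0 ?(ltW k10)//.
  by rewrite -ltr_pdivrMr.
have bumpQ (z : X * R) : ~ QT T' z -> bump T' a th z = 0.
  move=> nQ; apply/eqP; rewrite eq_le bump_ge0 andbT leNgt; apply/negP.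
  move=> /bump_gt0[[z0 zT zs] _]; apply: nQ; apply/QTE; split => //.
  exact: scube_lastc zs.
have ka0 : (0 < kappa%:num * k1)%R by rewrite mulr_gt0.
have inf : {ae @lebesgue_xt R N.+1, forall z, 0 < bump T' a th z -> (u \_ (QT T)) z = +oo}.
  apply: (ae_infinite_on_subsolution dge0 dmeas p1 (linear_part_ge0 p kappa)
    (measurable_bump T' a th) (@bump_ge0 R N.+1 T' a th) bumpQ ka0 k20 big _ _ u0).
  - move=> z _; rewrite EFinM -muleA; apply: lee_wpmul2l; first by rewrite lee_fin.
    by have [] := H T' z T't0.
  - by move=> z _; have [] := H T' z T't0.
  - by apply: ae_imp uE => z uz Qz; apply: uz; exact: sub.
apply: (@bump_support_not_negligible T' a th T'0 (le_trans T't0 t01)).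
apply: ae_imp (ae_and inf ufin) => z [zinf zfin] zb.
have Qz : QT T z.
  by apply: sub; apply: contrapT => /bumpQ zb0; rewrite zb0 ltxx in zb.
by have := zfin Qz; rewrite (zinf zb) ltxx.
Qed.

End problem_as_kernel_equation.

Theorem theorem5p7 (R : realType) (N : nat) (p : R)
    (hN : (1 <= N)%N) (hp : p_crit N.+1 <= p) :
  exists kappa0 : R, [/\ 0 < kappa0,
    forall kappa : {posnum R}, kappa%:num < kappa0 ->
      has_local_solution p (@initial_measure R N p kappa) &
    forall kappa : {posnum R}, kappa0 < kappa%:num ->
      ~ has_local_solution p (@initial_measure R N p kappa)].
Proof.
case: N hN hp => [//|N] _ hp.
have p1 : 1 < p by apply: lt_le_trans hp; have [] := @critical_exponent R N.
pose A := [set k | exists2 kappa : {posnum R}, kappa%:num = k &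
  has_local_solution p (@initial_measure R N.+1 p kappa)].
have [kap kapA] := has_local_solution_small hp p1.
have [k0 large] := no_local_solution_large hp p1.
have supA : has_sup A.
  split; first by exists kap%:num; exists kap.
  exists k0 => _ [kappa <- sol]; rewrite leNgt; apply/negP => kk.
  exact: large kk sol.
have le_sup kappa : has_local_solution p (@initial_measure R N.+1 p kappa) ->
    kappa%:num <= sup A.
  by move=> sol; apply: ub_le_sup; [case: supA|exists kappa].
exists (sup A); split.
- by apply: lt_le_trans (le_sup _ kapA).
- move=> kappa /(sup_gt supA.1)[_ [kappa' <- sol] /ltW kk].
  exact: has_local_solution_le p1 kk sol.
- by move=> kappa kk /le_sup; rewrite leNgt kk.
Qed.
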